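(* Let $f,g\in L^1_r(\mathrm{Aff})$, let $S$ be a trace-class operator on $L^2(\mathbb{R}_+)$, and let $T$ be a bounded operator on $L^2(\mathbb{R}_+)$. Then $$(f\star_{\mathrm{Aff}}S)\star_{\mathrm{Aff}}T=f*_{\mathrm{Aff}}(S\star_{\mathrm{Aff}}T),\qquad f\star_{\mathrm{Aff}}(g\star_{\mathrm{Aff}}S)=(f*_{\mathrm{Aff}}g)\star_{\mathrm{Aff}}S.$$
   Context: $\mathrm{Aff}=\mathbb{R}\times\mathbb{R}_+$, $\mathbb{R}_+=(0,\infty)$, is the affine group with $(x,a)\cdot(y,b)=(ay+x,ab)$; $L^1_r(\mathrm{Aff})=L^1(\mathrm{Aff},a^{-1}dx\,da)$. $L^2(\mathbb{R}_+)=L^2(\mathbb{R}_+,r^{-1}dr)$, with unitary representation $U(x,a)\psi(r)=e^{2\pi i xr}\psi(ar)$. Convolutions: for functions, $f*_{\mathrm{Aff}}g(x,a)=\int_{\mathrm{Aff}}f(y,b)g((x,a)\cdot(y,b)^{-1})\frac{dy\,db}{b}$. For $f\in L^1_r(\mathrm{Aff})$ and $S$ trace-class, $f\star_{\mathrm{Aff}}S=\int_{\mathrm{Aff}}f(x,a)U(-x,a)^*SU(-x,a)\frac{dx\,da}{a}$, a convergent Bochner integral in the trace-class operators. For $S$ trace-class and $T$ bounded, $S\star_{\mathrm{Aff}}T$ is the (bounded) function $S\star_{\mathrm{Aff}}T(x,a)=\mathrm{tr}(SU(-x,a)^*TU(-x,a))$ on $\mathrm{Aff}$. *)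

(* Defs.v *)
From HB Require Import structures.
From mathcomp Require Import all_boot all_order all_algebra.
From mathcomp Require Import all_classical all_reals all_analysis.
From mathcomp Require Import measurable_realfun complex ring.

Set Implicit Arguments.
Unset Strict Implicit.
Unset Printing Implicit Defensive.
Import Order.TTheory GRing.Theory Num.Theory.
Import numFieldNormedType.Exports.

Local Open Scope classical_set_scope.
Local Open Scope ring_scope.

Section complex_integral.
Context d (T : measurableType d) (R : realType).

Definition cmeasurable (D : set T) (f : T -> R[i]) : Prop :=
  measurable_fun D (fun x => complex.Re (f x)) /\
  measurable_fun D (fun x => complex.Im (f x)).

Definition cintegral (mu : {measure set T -> \bar R}) (D : set T)
    (f : T -> R[i]) : R[i] :=
  ((\int[mu]_(x in D) complex.Re (f x)) +i*
   (\int[mu]_(x in D) complex.Im (f x)))%C.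

End complex_integral.

Section half_line.
Variable R : realType.

Definition half_line : set (measurableTypeR R) := `]0%R, +oo[.

Lemma measurable_half_line : measurable half_line.
Proof. exact: measurable_itv. Qed.

(* The Haar measure dr / r of the multiplicative group ]0, +oo[. *)
Definition half_haar (E : set (measurableTypeR R)) : \bar R :=
  (\int[lebesgue_measure]_(r in E `&` half_line) (r^-1)%:E)%E.

Lemma half_lineP r : half_line r = (0 < r :> R).
Proof. by rewrite /half_line /= in_itv /= andbT. Qed.

Lemma half_line_inv_ge0 r : half_line r -> (0 <= (r^-1)%:E :> \bar R)%E.
Proof. by rewrite half_lineP => r0; rewrite lee_fin invr_ge0 ltW. Qed.

Lemma measurable_half_line_inv :
  measurable_fun half_line (EFin \o @GRing.inv R).
Proof.
apply/measurable_EFinP; apply: open_continuous_measurable_fun.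
  exact: interval_open.
move=> r /set_mem; rewrite half_lineP => r0.
by apply: inv_continuous; rewrite gt_eqF.
Qed.

Let half_haar0 : half_haar set0 = 0%E.
Proof. by rewrite /half_haar set0I integral_set0. Qed.

Let half_haar_ge0 E : (0 <= half_haar E)%E.
Proof. by apply: integral_ge0 => r [_]; exact: half_line_inv_ge0. Qed.

Let half_haar_sigma_additive : semi_sigma_additive half_haar.
Proof.
move=> F mF tF mUF.
have mFI k : measurable (F k `&` half_line).
  by apply: measurableI => //; exact: measurable_half_line.
rewrite {2}/half_haar setI_bigcupl ge0_integral_bigcup//.
- by apply: is_cvg_ereal_nneg_natsum => n _; exact: half_haar_ge0.
- apply: measurable_funS measurable_half_line_inv.
    exact: measurable_half_line.
  by move=> r [n _ []].
- by move=> r [n _ [_]]; exact: half_line_inv_ge0.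
- exact: trivIset_setIr.
Qed.

HB.instance Definition _ := isMeasure.Build _ _ _ half_haar
  half_haar0 half_haar_ge0 half_haar_sigma_additive.

Let half_haar_sigma_finite : sigma_finite setT half_haar.
Proof.
pose I n : set (measurableTypeR R) := `[n.+1%:R^-1, n.+1%:R]%classic.
exists (fun n => ~` half_line `|` I n).
  apply/esym/seteqP; split => // r _.
  have [r0|] := pselect (half_line r); last by exists 0%N => //; left.
  have {}r0 : 0 < r by rewrite -half_lineP.
  exists (maxn (Num.truncn r) (Num.truncn r^-1)) => //; right.
  rewrite /I /= in_itv /=; apply/andP; split.
    rewrite -[leRHS]invrK lef_pV2 ?posrE ?invr_gt0//.
    rewrite (le_trans (ltW (truncnS_gt _)))// ler_nat ltnS.
    exact: leq_maxr.
  rewrite (le_trans (ltW (truncnS_gt _)))// ler_nat ltnS.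
  exact: leq_maxl.
move=> n; split.
  apply: measurableU; last exact: measurable_itv.
  by apply: measurableC; exact: measurable_half_line.
rewrite /half_haar setIUl setICl set0U.
have I0 : I n `<=` half_line.
  move=> r; rewrite /I /= in_itv /= half_lineP => /andP[+ _].
  exact: lt_le_trans.
rewrite setIidl//.
apply: (@le_lt_trans _ _ (\int[lebesgue_measure]_(r in I n) (n.+1%:R)%:E)%E).
  apply: ge0_le_integral => //.
  - exact: measurable_itv.
  - by move=> r /I0; exact: half_line_inv_ge0.
  - apply: measurable_funS measurable_half_line_inv => //.
    exact: measurable_half_line.
  - move=> r; rewrite /I /= in_itv /= => /andP[nr _].
    rewrite lee_fin -[leRHS]invrK lef_pV2 ?posrE ?invr_gt0//.
    exact: lt_le_trans nr.
rewrite integral_cst; last exact: measurable_itv.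
rewrite lte_mul_pinfty// ?lee_fin//.
have : (lebesgue_measure (I n) < +oo)%E by
  rewrite /I lebesgue_measure_itv /=; case: ifP => _; rewrite ?ltry// -EFinB ltry.
exact.
Qed.

HB.instance Definition _ := Measure_isSigmaFinite.Build _ _ _ half_haar
  half_haar_sigma_finite.

End half_line.

Arguments half_line : clear implicits.
Arguments half_haar : clear implicits.
Arguments measurable_half_line : clear implicits.

Section L2.
Variable R : realType.
Local Notation D := (half_line R).
Local Notation mu := (half_haar R).

Definition sq_integrable (f : R -> R[i]) : Prop :=
  cmeasurable D f /\ (\int[mu]_(r in D) (Normc.normc (f r) ^+ 2)%:E < +oo)%E.

Definition ae_half_line (f g : R -> R[i]) : Prop :=
  {ae mu, forall r, D r -> f r = g r}.

Definition sq_integrable_fun := {f : R -> R[i] | `[< sq_integrable f >]}.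
HB.instance Definition _ := Choice.on sq_integrable_fun.

Definition sq_equiv (f g : sq_integrable_fun) : bool :=
  `[< ae_half_line (val f) (val g) >].

Let sq_equiv_refl : reflexive sq_equiv.
Proof. by move=> f; apply/asboolP/aeW. Qed.

Let sq_equiv_sym : symmetric sq_equiv.
Proof.
by move=> f g; apply/idP/idP => /asboolP fg; apply/asboolP;
  apply: filterS fg => r fg /fg.
Qed.

Let sq_equiv_trans : transitive sq_equiv.
Proof.
move=> g f h /asboolP fg /asboolP gh; apply/asboolP.
by apply: filterS2 fg gh => r fg gh Dr; rewrite fg// gh.
Qed.

Canonical sq_equiv_equiv :=
  EquivRel sq_equiv sq_equiv_refl sq_equiv_sym sq_equiv_trans.

(* L^2(]0, +oo[, dr / r), complex valued. *)
Definition L2 : Type := {eq_quot sq_equiv}%qT.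
HB.instance Definition _ := Choice.on L2.
HB.instance Definition _ := EqQuotient.on L2.

Definition L2_fun (u : L2) : R -> R[i] := val (repr u).

Lemma normcD_sqr (z w : R[i]) :
  Normc.normc (z + w) ^+ 2 <=
  2 * Normc.normc z ^+ 2 + 2 * Normc.normc w ^+ 2 :> R.
Proof.
have n0 (x : R[i]) : 0 <= Normc.normc x by case: x => a b; exact: sqrtr_ge0.
have h : Normc.normc (z + w) <= Normc.normc z + Normc.normc w.
  exact: le_normcD.
apply: (@le_trans _ _ ((Normc.normc z + Normc.normc w) ^+ 2)).
  by rewrite lerXn2r// nnegrE// addr_ge0.
rewrite -subr_ge0.
set a := Normc.normc z; set b := Normc.normc w.
have -> : 2 * a ^+ 2 + 2 * b ^+ 2 - (a + b) ^+ 2 = (a - b) ^+ 2.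
  by rewrite !expr2; ring.
exact: sqr_ge0.
Qed.

Lemma measurable_normc_sqr (f : R -> R[i]) : cmeasurable D f ->
  measurable_fun D (fun r => (Normc.normc (f r) ^+ 2)%:E).
Proof.
move=> [mr mi]; apply/measurable_EFinP.
have -> : (fun r => Normc.normc (f r) ^+ 2) =
    (fun r => complex.Re (f r) ^+ 2 + complex.Im (f r) ^+ 2).
  apply/funext => r; case: (f r) => a b /=.
  by rewrite sqr_sqrtr// addr_ge0 ?sqr_ge0.
by apply: measurable_funD; exact: measurable_funX.
Qed.

Lemma sq_integrable0 : sq_integrable (fun=> 0).
Proof.
split; first by split; exact: measurable_cst.
by rewrite integral0_eq// => r _; rewrite Normc.normc0 expr0n.
Qed.

Lemma sq_integrableD f g : sq_integrable f -> sq_integrable g ->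
  sq_integrable (fun r => f r + g r).
Proof.
move=> [mf If] [mg Ig].
have mfg : cmeasurable D (fun r => f r + g r).
  have [[mfr mfi] [mgr mgi]] := (mf, mg).
  split.
    have -> : (fun r => complex.Re (f r + g r)) =
        (fun r => complex.Re (f r) + complex.Re (g r)).
      by apply/funext => r; rewrite raddfD.
    exact: measurable_funD.
  have -> : (fun r => complex.Im (f r + g r)) =
      (fun r => complex.Im (f r) + complex.Im (g r)).
    by apply/funext => r; rewrite raddfD.
  exact: measurable_funD.
split=> //.
have mD := measurable_half_line R.
pose F (h : R -> R[i]) r := (2%:E * (Normc.normc (h r) ^+ 2)%:E : \bar R)%E.
have mF (h : R -> R[i]) : cmeasurable D h -> measurable_fun D (F h).
  by move=> mh; apply: measurable_funeM; exact: measurable_normc_sqr.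
have F0 (h : R -> R[i]) r : (0 <= F h r)%E by rewrite mule_ge0 ?lee_fin ?sqr_ge0.
apply: (@le_lt_trans _ _ (\int[mu]_(r in D) (F f r + F g r))%E).
  apply: ge0_le_integral => //.
  - by move=> r _; rewrite lee_fin sqr_ge0.
  - exact: measurable_normc_sqr.
  - by apply: emeasurable_funD; exact: mF.
  - by move=> r _; rewrite /F -!EFinM -EFinD lee_fin normcD_sqr.
rewrite ge0_integralD//; try exact: mF.
have IF (h : R -> R[i]) : cmeasurable D h ->
    (\int[mu]_(r in D) (Normc.normc (h r) ^+ 2)%:E < +oo)%E ->
    (\int[mu]_(r in D) F h r < +oo)%E.
  move=> mh Ih; rewrite ge0_integralZl//; try exact: measurable_normc_sqr.
  - by rewrite lte_mul_pinfty// ?lee_fin.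
  - by move=> r _; rewrite lee_fin sqr_ge0.
by rewrite lte_add_pinfty// IF.
Qed.

Lemma sq_integrableZ (c : R[i]) f : sq_integrable f ->
  sq_integrable (fun r => c * f r).
Proof.
move=> [mf If]; split.
  have [mr mi] := mf; case: c => a b.
  split.
    have -> : (fun r => complex.Re ((a +i* b)%C * f r)) =
        (fun r => a * complex.Re (f r) - b * complex.Im (f r)).
      by apply/funext => r; case: (f r).
    apply: measurable_funB; apply: measurable_funM => //; exact: measurable_cst.
  have -> : (fun r => complex.Im ((a +i* b)%C * f r)) =
      (fun r => a * complex.Im (f r) + b * complex.Re (f r)).
    by apply/funext => r; case: (f r).
  apply: measurable_funD; apply: measurable_funM => //; exact: measurable_cst.
have -> : (\int[mu]_(r in D) (Normc.normc (c * f r) ^+ 2)%:E =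
    (Normc.normc c ^+ 2)%:E * \int[mu]_(r in D) (Normc.normc (f r) ^+ 2)%:E)%E.
  rewrite -ge0_integralZl//; try exact: measurable_normc_sqr.
  - by apply: eq_integral => r _; rewrite Normc.normcM exprMn EFinM.
  - exact: measurable_half_line.
  - by move=> r _; rewrite lee_fin sqr_ge0.
  - by rewrite lee_fin sqr_ge0.
by rewrite lte_mul_pinfty// ?lee_fin ?sqr_ge0.
Qed.

Definition sq_zero : sq_integrable_fun :=
  exist _ (fun=> 0) (asboolT sq_integrable0).

(* The class of f, or 0 if f is not square integrable. *)
Definition L2_class (f : R -> R[i]) : L2 :=
  (\pi_L2 (insubd sq_zero f : sq_integrable_fun))%qT.

Lemma L2_classK f : sq_integrable f -> ae_half_line (L2_fun (L2_class f)) f.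
Proof.
move=> If; rewrite /L2_fun /L2_class.
have := reprK (L2_class f) => /eqmodP /asboolP.
by rewrite [X in ae_half_line _ X]insubdK// unfold_in; apply/asboolP.
Qed.

Lemma L2_funP (u : L2) : sq_integrable (L2_fun u).
Proof. exact/asboolP/(valP (repr u)). Qed.

Lemma L2_eq (u v : L2) : ae_half_line (L2_fun u) (L2_fun v) -> u = v.
Proof.
by move=> uv; rewrite -[u]reprK -[v]reprK; apply/eqmodP/asboolP.
Qed.

Definition L2_add (u v : L2) := L2_class (fun r => L2_fun u r + L2_fun v r).
Definition L2_scale (c : R[i]) (u : L2) := L2_class (fun r => c * L2_fun u r).
Definition L2_zero := L2_class (fun=> 0).
Definition L2_opp (u : L2) := L2_scale (-1) u.

Lemma L2_addE u v :
  ae_half_line (L2_fun (L2_add u v)) (fun r => L2_fun u r + L2_fun v r).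
Proof. by apply: L2_classK; apply: sq_integrableD; exact: L2_funP. Qed.

Lemma L2_scaleE c u :
  ae_half_line (L2_fun (L2_scale c u)) (fun r => c * L2_fun u r).
Proof. by apply: L2_classK; apply: sq_integrableZ; exact: L2_funP. Qed.

Lemma L2_zeroE : ae_half_line (L2_fun L2_zero) (fun=> 0).
Proof. exact: L2_classK sq_integrable0. Qed.

Let L2_addA : associative L2_add.
Proof.
move=> u v w; apply: L2_eq.
near=> r => Dr.
rewrite (near (L2_addE u (L2_add v w)) r)// (near (L2_addE v w) r)//.
by rewrite (near (L2_addE (L2_add u v) w) r)// (near (L2_addE u v) r)// addrA.
Unshelve. all: by end_near. Qed.

Let L2_addC : commutative L2_add.
Proof.
move=> u v; apply: L2_eq; near=> r => Dr.
by rewrite (near (L2_addE u v) r)// (near (L2_addE v u) r)// addrC.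
Unshelve. all: by end_near. Qed.

Let L2_add0 : left_id L2_zero L2_add.
Proof.
move=> u; apply: L2_eq; near=> r => Dr.
by rewrite (near (L2_addE L2_zero u) r)// (near L2_zeroE r)// add0r.
Unshelve. all: by end_near. Qed.

Let L2_addN : left_inverse L2_zero L2_opp L2_add.
Proof.
move=> u; apply: L2_eq; near=> r => Dr.
rewrite (near (L2_addE (L2_opp u) u) r)// (near (L2_scaleE (-1) u) r)//.
by rewrite (near L2_zeroE r)// mulN1r addNr.
Unshelve. all: by end_near. Qed.

HB.instance Definition _ :=
  GRing.isZmodule.Build L2 L2_addA L2_addC L2_add0 L2_addN.

Let L2_scaleA a b (u : L2) : L2_scale a (L2_scale b u) = L2_scale (a * b) u.
Proof.
apply: L2_eq; near=> r => Dr.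
rewrite (near (L2_scaleE a (L2_scale b u)) r)// (near (L2_scaleE b u) r)//.
by rewrite (near (L2_scaleE (a * b) u) r)// mulrA.
Unshelve. all: by end_near. Qed.

Let L2_scale1 : left_id 1 L2_scale.
Proof.
move=> u; apply: L2_eq; near=> r => Dr.
by rewrite (near (L2_scaleE 1 u) r)// mul1r.
Unshelve. all: by end_near. Qed.

Let L2_scaleDr : right_distributive L2_scale +%R.
Proof.
move=> a u v; apply: L2_eq; near=> r => Dr.
rewrite (near (L2_scaleE a (u + v)) r)// (near (L2_addE u v) r)//.
rewrite (near (L2_addE (L2_scale a u) (L2_scale a v)) r)//.
by rewrite (near (L2_scaleE a u) r)// (near (L2_scaleE a v) r)// mulrDr.
Unshelve. all: by end_near. Qed.

Let L2_scaleDl (u : L2) : {morph L2_scale^~ u : a b / a + b}.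
Proof.
move=> a b; apply: L2_eq; near=> r => Dr.
rewrite (near (L2_scaleE (a + b) u) r)//.
rewrite (near (L2_addE (L2_scale a u) (L2_scale b u)) r)//.
by rewrite (near (L2_scaleE a u) r)// (near (L2_scaleE b u) r)// mulrDl.
Unshelve. all: by end_near. Qed.

HB.instance Definition _ := GRing.Zmodule_isLmodule.Build R[i] L2
  L2_scaleA L2_scale1 L2_scaleDr L2_scaleDl.

End L2.

Section operators.
Variable R : realType.
Implicit Types (u v : L2 R) (A B : L2 R -> L2 R).

(* Linear in the first argument. *)
Definition inner u v : R[i] :=
  cintegral (half_haar R) (half_line R)
    (fun r => L2_fun u r * (L2_fun v r)^*%C).

Definition L2_norm u : R := Num.sqrt (complex.Re (inner u u)).

Definition bounded_op A : Prop :=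
  linear A /\ exists M : R, forall u, L2_norm (A u) <= M * L2_norm u.

(* By the Riesz representation theorem every bounded operator has exactly one
   adjoint; the default value 0 is only taken off the bounded operators. *)
Definition adjoint A : L2 R -> L2 R :=
  xget 0 [set B | forall u v, inner (A u) v = inner u (B v)].

Definition positive_op A : Prop :=
  bounded_op A /\ forall u, 0 <= inner (A u) u.

(* |A| = (A^* A)^(1/2), the unique positive square root. *)
Definition op_abs A : L2 R -> L2 R :=
  xget 0 [set B | positive_op B /\ B \o B = adjoint A \o A].

Definition orthonormal_basis (e : nat -> L2 R) : Prop :=
  (forall i j, inner (e i) (e j) = (i == j)%:R) /\
  (forall u, (forall n, inner u (e n) = 0) -> u = 0).

(* L2 R is separable and infinite dimensional, so it has orthonormal bases
   indexed by nat.  The trace norm of a bounded operator and the trace of a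
   trace-class operator do not depend on the basis. *)
Definition onb : nat -> L2 R := xget (fun=> 0) orthonormal_basis.

(* ||A||_1 = tr |A|, which is +oo when A is not a trace-class operator. *)
Definition trace_norm A : \bar R :=
  if `[< bounded_op A >]
  then (\sum_(0 <= n <oo) (complex.Re (inner (op_abs A (onb n)) (onb n)))%:E)%E
  else +oo%E.

Definition trace_class A : Prop := (trace_norm A < +oo)%E.

Definition trace A : R[i] :=
  (limn (series (fun n => complex.Re (inner (A (onb n)) (onb n)))) +i*
   limn (series (fun n => complex.Im (inner (A (onb n)) (onb n)))))%C.

End operators.

Section bochner.
Context d (T : measurableType d) (R : realType).
Variables (mu : {measure set T -> \bar R}) (D : set T).

(* The list s stands for the simple function \sum_((E, A) <- s) 1_E A. *)
Definition simple_op_fun (s : seq (set T * (L2 R -> L2 R))) : Prop :=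
  {in s, forall p, [/\ measurable p.1, p.1 `<=` D,
    (mu p.1 < +oo)%E & trace_class p.2]}.

Definition simple_op_val (s : seq (set T * (L2 R -> L2 R))) (x : T) :
    L2 R -> L2 R :=
  \sum_(p <- s) (\1_(p.1) x : R)%:C%C *: p.2.

Definition simple_op_integral (s : seq (set T * (L2 R -> L2 R))) :
    L2 R -> L2 R :=
  \sum_(p <- s) (fine (mu p.1))%:C%C *: p.2.

(* A is the Bochner integral over D of F, with values in the Banach space of
   trace-class operators.  The almost everywhere convergence expresses the
   strong measurability of F; it makes x |-> ||F x - s k x||_1 measurable up to
   a null set. *)
Definition is_bochner_integral (F : T -> L2 R -> L2 R) (A : L2 R -> L2 R) :
    Prop :=
  trace_class A /\
  exists s : nat -> seq (set T * (L2 R -> L2 R)),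
    [/\ forall k, simple_op_fun (s k),
        {ae mu, forall x, D x ->
          trace_norm (F x - simple_op_val (s k) x) @[k --> \oo] --> 0%E},
        (\int[mu]_(x in D) trace_norm (F x - simple_op_val (s k) x)%R)%E
          @[k --> \oo] --> 0%E &
        trace_norm (A - simple_op_integral (s k)) @[k --> \oo] --> 0%E].

(* The default value 0 is only taken when F is not Bochner integrable. *)
Definition bochner_integral (F : T -> L2 R -> L2 R) : L2 R -> L2 R :=
  xget 0 (is_bochner_integral F).

End bochner.

(* A function on Aff = R x ]0, +oo[ is represented by a function on the plane,
   whose values off aff are irrelevant. *)
Notation plane R := (measurableTypeR R * measurableTypeR R)%type.

(* The right Haar measure a^-1 dx da. *)
Notation aff_haar R := (@lebesgue_measure R \x half_haar R)%E.

Section affine_group.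
Variable R : realType.

Local Notation plane := (plane R).
Local Notation aff_haar := (aff_haar R).

Definition aff : set plane := [set p | 0 < p.2 :> R].

Definition aff_mul (p q : plane) : plane :=
  (p.2 * q.1 + p.1 : R, p.2 * q.2 : R).

Definition aff_inv (p : plane) : plane := (- (p.1 / p.2) : R, p.2^-1 : R).

Definition aff_L1 (f : plane -> R[i]) : Prop :=
  cmeasurable aff f /\
  (\int[aff_haar]_(p in aff) (Normc.normc (f p))%:E < +oo)%E.

Definition expi (t : R) : R[i] := (cos t +i* sin t)%C.

Definition aff_rep (x a : R) (u : L2 R) : L2 R :=
  L2_class (fun r => expi (2 * pi * x * r) * L2_fun u (a * r)).

(* U(-x, a)^* A U(-x, a) at p = (x, a). *)
Definition aff_shift (p : plane) (A : L2 R -> L2 R) : L2 R -> L2 R :=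
  adjoint (aff_rep (- p.1 : R) p.2) \o A \o aff_rep (- p.1 : R) p.2.

Definition fun_conv (f g : plane -> R[i]) (p : plane) : R[i] :=
  cintegral aff_haar aff (fun q => f q * g (aff_mul p (aff_inv q))).

Definition fun_op_conv (f : plane -> R[i]) (S : L2 R -> L2 R) :
    L2 R -> L2 R :=
  bochner_integral aff_haar aff (fun p => f p *: aff_shift p S).

Definition op_conv (S T : L2 R -> L2 R) (p : plane) : R[i] :=
  trace (S \o aff_shift p T).

End affine_group.

Arguments aff : clear implicits.

(* Main.v *)
From HB Require Import structures.
From mathcomp Require Import all_boot all_order all_algebra.
From mathcomp Require Import all_classical all_reals all_analysis.
From mathcomp Require Import measurable_realfun complex ring lra.
Require Import Defs.

Set Implicit Arguments.
Unset Strict Implicit.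
Unset Printing Implicit Defensive.
Import Order.TTheory GRing.Theory Num.Theory.
Import numFieldNormedType.Exports.

(** Put [W (x, a) = U(-x, a)]. Then [W] is a unitary representation of the
    affine group and [aff_shift p A = W p^-1 A W p], and both laws come from
    this, from Fubini's theorem and from the right invariance of the Haar
    measure.

    The link between the operator [f * S], a Bochner integral, and integrals of
    functions is that a functional [phi] that is continuous for the trace norm
    satisfies [phi (f * S) = int f(q) phi (aff_shift q S) dq]
    ([fun_op_conv_functional]).

    For the first law take [phi X = tr (X o aff_shift p T)]. Since conjugation
    by [W q] can be moved across the trace ([tr_conj]), [phi (aff_shift q S)] is
    the trace of [S] composed with [aff_shift (p q^-1) T], which is the
    integrand of the convolution of [f] and [op_conv S T].

    For the second law it is enough to compare the matrix coefficients
    [phi X = <X u, v>]. With [s p = <S (W p u), W p v>] the left-hand side is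
    the iterated integral of [f(q) g(p) s(p q)], and the right-hand side is the
    integral of [f(q) g(p q^-1) s(p)] over both variables; [conv_pairing]
    identifies them.

    It remains to see that the Bochner integrals exist and that the trace norm
    behaves. The trace norm is defined through the absolute value of an
    operator along a basis; [trace_normP] replaces it by the condition
    [trace_bound], a supremum of finite sums of matrix coefficients, for which
    the triangle inequality and unitary invariance are evident. The passage
    uses adjoints and the polar decomposition ([factor_exists]), square roots
    of positive operators ([sqrt_exists]), and hence the completeness of [L2]
    ([L2_complete]). The same argument shows that finite-rank operators are
    dense among trace-class operators ([finite_rank_dense]). Density reduces
    the integrability of [p |-> f p *: aff_shift p S] to rank-one [S], where it
    follows from the measurability of the matrix coefficients of [W]
    ([approximable_shift]), and it also yields [tr_conj].

    The definitions choose an orthonormal basis of [L2]. If there were none,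
    they would fall back on the zero sequence, every bounded operator would
    have trace norm 0 and both laws would be trivial; this case distinction
    replaces a proof that [L2] is separable. *)

Local Open Scope classical_set_scope.
Local Open Scope ring_scope.

Notation nc := Normc.normc.
Notation Re := complex.Re.
Notation Im := complex.Im.

(** * Complex numbers *)

Section complex_numbers.
Variable R : realType.
Implicit Types z w : R[i].

Lemma ReD z w : Re (z + w) = Re z + Re w. Proof. by case: z w => ? ? []. Qed.
Lemma ImD z w : Im (z + w) = Im z + Im w. Proof. by case: z w => ? ? []. Qed.
Lemma ReN z : Re (- z) = - Re z. Proof. by case: z. Qed.
Lemma ImN z : Im (- z) = - Im z. Proof. by case: z. Qed.
Lemma ReB z w : Re (z - w) = Re z - Re w. Proof. by rewrite ReD ReN. Qed.
Lemma ImB z w : Im (z - w) = Im z - Im w. Proof. by rewrite ImD ImN. Qed.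
Lemma ReM z w : Re (z * w) = Re z * Re w - Im z * Im w.
Proof. by case: z w => ? ? []. Qed.
Lemma ImM z w : Im (z * w) = Re z * Im w + Im z * Re w.
Proof. by case: z w => ? ? [? ?] /=; rewrite addrC. Qed.
Lemma ReJ z : Re z^*%C = Re z. Proof. by case: z. Qed.
Lemma ImJ z : Im z^*%C = - Im z. Proof. by case: z. Qed.

Lemma Re_sum I (s : seq I) (F : I -> R[i]) :
  Re (\sum_(i <- s) F i) = \sum_(i <- s) Re (F i).
Proof. exact: (big_morph _ ReD). Qed.
Lemma Im_sum I (s : seq I) (F : I -> R[i]) :
  Im (\sum_(i <- s) F i) = \sum_(i <- s) Im (F i).
Proof. exact: (big_morph _ ImD). Qed.

Lemma complex_ext z w : Re z = Re w -> Im z = Im w -> z = w.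
Proof. by case: z w => ? ? [? ?] /= -> ->. Qed.

Lemma conjM z w : (z * w)^*%C = z^*%C * w^*%C. Proof. exact: rmorphM. Qed.
Lemma conjD z w : (z + w)^*%C = z^*%C + w^*%C. Proof. exact: rmorphD. Qed.
Lemma conjN z : (- z)^*%C = - z^*%C. Proof. exact: rmorphN. Qed.
Lemma conjB z w : (z - w)^*%C = z^*%C - w^*%C. Proof. exact: rmorphB. Qed.

Lemma nc_ge0 z : 0 <= nc z :> R. Proof. by case: z => a b; exact: sqrtr_ge0. Qed.
Hint Resolve nc_ge0 : core.

Lemma nc_sqr z : nc z ^+ 2 = Re z ^+ 2 + Im z ^+ 2.
Proof. by case: z => a b /=; rewrite sqr_sqrtr// addr_ge0 ?sqr_ge0. Qed.

Lemma normr_Re_le z : `|Re z| <= nc z.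
Proof.
rewrite -(ler_pXn2r (n := 2))// ?nnegrE//.
by rewrite nc_sqr real_normK ?num_real// lerDl sqr_ge0.
Qed.

Lemma normr_Im_le z : `|Im z| <= nc z.
Proof.
rewrite -(ler_pXn2r (n := 2))// ?nnegrE//.
by rewrite nc_sqr real_normK ?num_real// lerDr sqr_ge0.
Qed.

Lemma Re_le_nc z : Re z <= nc z.
Proof. exact: le_trans (ler_norm _) (normr_Re_le _). Qed.

Lemma ncJ z : nc z^*%C = nc z. Proof. by case: z => a b /=; rewrite sqrrN. Qed.

Lemma nc_real (x : R) : nc x%:C%C = `|x|.
Proof. by rewrite /= expr0n /= addr0 sqrtr_sqr. Qed.

Lemma ReZ (t : R) z : Re (t%:C%C * z) = t * Re z.
Proof. by rewrite ReM /= mul0r subr0. Qed.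

Lemma nc_eq0 z : nc z = 0 -> z = 0. Proof. by move/Normc.eq0_normc. Qed.

Lemma nc_le_sum I (s : seq I) (F : I -> R[i]) :
  nc (\sum_(i <- s) F i) <= \sum_(i <- s) nc (F i).
Proof.
elim/big_ind2: _ => //; first by rewrite Normc.normc0.
by move=> x a y b xa yb; apply: le_trans (le_normcD _ _) (lerD xa yb).
Qed.

Lemma ncBC z w : nc (z - w) = nc (w - z). Proof. by rewrite -normcN opprB. Qed.

Lemma mulcJ z : z * z^*%C = (nc z ^+ 2)%:C%C.
Proof.
rewrite nc_sqr; case: z => a b.
apply: complex_ext; rewrite ?ReM ?ImM /= ?expr2; ring.
Qed.

(** A unimodular factor that rotates [z] to the nonnegative real axis. *)
Lemma rotate_to_real z : exists2 w, nc w = 1 & w * z = (nc z)%:C%C.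
Proof.
have [->|z0] := eqVneq z 0.
  by exists 1; rewrite ?Normc.normc1 ?mul1r ?Normc.normc0.
have nz0 : nc z != 0 by apply: contra z0 => /eqP/nc_eq0->.
exists ((nc z)^-1%:C%C * z^*%C).
  by rewrite Normc.normcM nc_real ncJ ger0_norm ?invr_ge0// mulVf.
rewrite -mulrA [_^*%C * _]mulrC mulcJ -rmorphM expr2 mulrA mulVf// mul1r //.
Qed.

End complex_numbers.
#[global] Hint Extern 0 (is_true (0 <= Normc.normc _)) =>
  solve [exact: nc_ge0] : core.

(** * Integrals of complex functions *)

Section complex_integrals.
Context d (T : measurableType d) (R : realType).
Variables (mu : {measure set T -> \bar R}) (D : set T) (mD : measurable D).
Implicit Types f g : T -> R[i].

Definition cintegrable f :=
  cmeasurable D f /\ (\int[mu]_(x in D) (nc (f x))%:E < +oo)%E.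

Lemma cmeasurableD f g : cmeasurable D f -> cmeasurable D g ->
  cmeasurable D (fun x => f x + g x).
Proof.
move=> [fr fi] [gr gi]; split.
  by under eq_fun do rewrite ReD; exact: measurable_funD.
by under eq_fun do rewrite ImD; exact: measurable_funD.
Qed.

Lemma cmeasurableM f g : cmeasurable D f -> cmeasurable D g ->
  cmeasurable D (fun x => f x * g x).
Proof.
move=> [fr fi] [gr gi]; split.
  under eq_fun do rewrite ReM.
  by apply: measurable_funB; exact: measurable_funM.
under eq_fun do rewrite ImM.
by apply: measurable_funD; exact: measurable_funM.
Qed.

Lemma cmeasurable_cst (c : R[i]) : cmeasurable D (fun=> c).
Proof. by split; exact: measurable_cst. Qed.

Lemma cmeasurableJ f : cmeasurable D f -> cmeasurable D (fun x => (f x)^*%C).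
Proof.
move=> [fr fi]; split; first by under eq_fun do rewrite ReJ.
by under eq_fun do rewrite ImJ; exact: measurableT_comp.
Qed.

Lemma cmeasurableN f : cmeasurable D f -> cmeasurable D (fun x => - f x).
Proof.
move=> [fr fi]; split.
  by under eq_fun do rewrite ReN; exact: measurableT_comp.
by under eq_fun do rewrite ImN; exact: measurableT_comp.
Qed.

Lemma cmeasurable_sum I (s : seq I) (F : I -> T -> R[i]) :
  (forall i, cmeasurable D (F i)) ->
  cmeasurable D (fun x => \sum_(i <- s) F i x).
Proof.
move=> mF; elim: s => [|i s IH].
  by under eq_fun do rewrite big_nil; exact: cmeasurable_cst.
by under eq_fun do rewrite big_cons; exact: cmeasurableD.
Qed.

Lemma measurable_nc f : cmeasurable D f -> measurable_fun D (fun x => nc (f x)).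
Proof.
move=> [fr fi].
have -> : (fun x => nc (f x)) =
    (fun x => Num.sqrt (Re (f x) ^+ 2 + Im (f x) ^+ 2)).
  by apply/funext => x; rewrite -nc_sqr sqrtr_sqr ger0_norm.
apply: (measurableT_comp (f := @Num.sqrt R)).
  exact: continuous_measurable_fun (@sqrt_continuous R).
by apply: measurable_funD; exact: measurable_funX.
Qed.

Lemma eq_cmeasurable f g : {in D, f =1 g} -> cmeasurable D f -> cmeasurable D g.
Proof.
move=> fg [fr fi]; split; [move: fr|move: fi];
  by apply: eq_measurable_fun => x /fg ->.
Qed.

Lemma eq_cintegral f g : {in D, f =1 g} -> cintegral mu D f = cintegral mu D g.
Proof.
by move=> fg; congr Complex; apply: eq_Rintegral => x /fg ->.
Qed.

Lemma cintegrableRe f : cintegrable f ->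
  mu.-integrable D (EFin \o (fun x => Re (f x))).
Proof.
move=> [[fr fi] If]; apply/integrableP; split; first exact/measurable_EFinP.
apply: le_lt_trans If; apply: ge0_le_integral => //.
- by apply: measurableT_comp => //; exact/measurable_EFinP.
- by apply/measurable_EFinP; exact: measurable_nc.
- by move=> x _; rewrite lee_fin normr_Re_le.
Qed.

Lemma cintegrableIm f : cintegrable f ->
  mu.-integrable D (EFin \o (fun x => Im (f x))).
Proof.
move=> [[fr fi] If]; apply/integrableP; split; first exact/measurable_EFinP.
apply: le_lt_trans If; apply: ge0_le_integral => //.
- by apply: measurableT_comp => //; exact/measurable_EFinP.
- by apply/measurable_EFinP; exact: measurable_nc.
- by move=> x _; rewrite lee_fin normr_Im_le.
Qed.

Lemma cintegrable_nc f : cintegrable f ->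
  mu.-integrable D (EFin \o (fun x => nc (f x))).
Proof.
move=> [mf If]; apply/integrableP; split.
  by apply/measurable_EFinP; exact: measurable_nc.
by under eq_integral do rewrite /= ger0_norm//.
Qed.

Lemma le_cintegrable f (h : T -> \bar R) : cmeasurable D f ->
  measurable_fun D h -> (forall x, D x -> ((nc (f x))%:E <= h x)%E) ->
  (\int[mu]_(x in D) h x < +oo)%E -> cintegrable f.
Proof.
move=> mf mh fh Ih; split => //; apply: le_lt_trans Ih.
apply: ge0_le_integral => //.
- by move=> x _; rewrite lee_fin.
- by apply/measurable_EFinP; exact: measurable_nc.
Qed.

Lemma cintegrableD f g : cintegrable f -> cintegrable g ->
  cintegrable (fun x => f x + g x).
Proof.
move=> [mf If] [mg Ig].
have mnf := measurable_nc mf; have mng := measurable_nc mg.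
apply: (@le_cintegrable _ (fun x => (nc (f x))%:E + (nc (g x))%:E)%E).
- exact: cmeasurableD.
- by apply: emeasurable_funD; exact/measurable_EFinP.
- by move=> x _; rewrite -EFinD lee_fin le_normcD.
- rewrite ge0_integralD//; first exact: lte_add_pinfty.
  by move=> x _; rewrite lee_fin.
  by apply/measurable_EFinP.
  by move=> x _; rewrite lee_fin.
  by apply/measurable_EFinP.
Qed.

Lemma cintegrableZ (c : R[i]) f : cintegrable f ->
  cintegrable (fun x => c * f x).
Proof.
move=> [mf If].
apply: (@le_cintegrable _ (fun x => (nc c)%:E * (nc (f x))%:E)%E).
- by apply: cmeasurableM => //; exact: cmeasurable_cst.
- by apply: measurable_funeM; apply/measurable_EFinP; exact: measurable_nc.
- by move=> x _; rewrite -EFinM lee_fin Normc.normcM.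
- rewrite ge0_integralZl//; first by rewrite lte_mul_pinfty// lee_fin.
  + by apply/measurable_EFinP; exact: measurable_nc.
  + by move=> x _; rewrite lee_fin.
  + by rewrite lee_fin.
Qed.

Lemma eq_cintegrable f g : {in D, f =1 g} -> cintegrable f -> cintegrable g.
Proof.
move=> fg [mf If]; split; first exact: eq_cmeasurable mf.
by under eq_integral do rewrite -fg//.
Qed.

Lemma cintegrable0 : cintegrable (fun=> 0).
Proof.
split; first exact: cmeasurable_cst.
by under eq_integral do rewrite Normc.normc0; rewrite integral0.
Qed.

Lemma cintegral0 : cintegral mu D (fun=> 0) = 0.
Proof.
by apply: complex_ext; rewrite /= /Rintegral integral0.
Qed.

Lemma cintegralD f g : cintegrable f -> cintegrable g ->
  cintegral mu D (fun x => f x + g x) = cintegral mu D f + cintegral mu D g.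
Proof.
move=> If Ig; apply: complex_ext => /=.
  under eq_Rintegral do rewrite ReD.
  by rewrite RintegralD//; exact: cintegrableRe.
under eq_Rintegral do rewrite ImD.
by rewrite RintegralD//; exact: cintegrableIm.
Qed.

Lemma cintegralZ (c : R[i]) f : cintegrable f ->
  cintegral mu D (fun x => c * f x) = c * cintegral mu D f.
Proof.
move=> If; have Ir := cintegrableRe If; have Ii := cintegrableIm If.
have IZ (g : T -> R) k : mu.-integrable D (EFin \o g) ->
    mu.-integrable D (EFin \o (fun x => k * g x)).
  by move=> Ig; exact: (integrableZl mD k Ig).
apply: complex_ext; rewrite ?ReM ?ImM /=.
  under eq_Rintegral do rewrite ReM.
  rewrite RintegralB//; [by rewrite !RintegralZl| exact: IZ..].
under eq_Rintegral do rewrite ImM.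
rewrite RintegralD//; [by rewrite !RintegralZl| exact: IZ..].
Qed.

Lemma cintegral_conj f : cintegrable f ->
  cintegral mu D (fun x => (f x)^*%C) = (cintegral mu D f)^*%C.
Proof.
move=> If; apply: complex_ext => /=.
  by under eq_Rintegral do rewrite ReJ.
under eq_Rintegral do rewrite ImJ -mulN1r.
by rewrite RintegralZl ?mulN1r//; exact: cintegrableIm.
Qed.

(** After a rotation the integral is real, so it is the integral of the real
    part of the rotated function, which is at most the modulus. *)
Lemma nc_cintegral_le f : cintegrable f ->
  ((nc (cintegral mu D f))%:E <= \int[mu]_(x in D) (nc (f x))%:E)%E.
Proof.
move=> If; have [w w1 wE] := rotate_to_real (cintegral mu D f).
rewrite -cintegralZ// in wE.
have -> : nc (cintegral mu D f) = Re (cintegral mu D (fun x => w * f x)).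
  by rewrite wE.
have Iw := cintegrableRe (cintegrableZ w If).
rewrite /= /Rintegral fineK; last exact: integrable_fin_num.
apply: le_integral => //; first exact: cintegrable_nc.
move=> x _; rewrite lee_fin.
by apply: le_trans (Re_le_nc _) _; rewrite Normc.normcM w1 mul1r.
Qed.

Lemma ae_eq_cintegral f g : cmeasurable D f -> cmeasurable D g ->
  {ae mu, forall x, D x -> f x = g x} -> cintegral mu D f = cintegral mu D g.
Proof.
move=> [fr fi] [gr gi] fg.
by congr Complex; congr fine; apply: ae_eq_integral => //;
  (try exact/measurable_EFinP); apply: filterS fg => x fg Dx; rewrite fg.
Qed.

End complex_integrals.

(** * Hilbert spaces *)

(** Operator theory is developed over an abstract Hilbert space: in [L2] itself
    every identity between vectors is an identity between classes of functions
    that only holds almost everywhere. *)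
HB.mixin Record Lmodule_isPreHilbert (R : realType) (H : Type)
    of GRing.Lmodule R[i] H := {
  ip : H -> H -> R[i];
  ipDl : forall u v w, ip (u + v) w = ip u w + ip v w;
  ipZl : forall c u v, ip (c *: u) v = c * ip u v;
  ipC : forall u v, ip v u = (ip u v)^*%C;
  ip_ge0 : forall u, 0 <= complex.Re (ip u u);
  ip_definite : forall u, complex.Re (ip u u) = 0 -> u = 0 }.

#[short(type="preHilbertType")]
HB.structure Definition PreHilbert (R : realType) :=
  { H of Lmodule_isPreHilbert R H & GRing.Lmodule R[i] H }.

Definition hnorm (R : realType) (H : preHilbertType R) (u : H) : R :=
  Num.sqrt (Re (ip u u)).

Lemma hnorm_ge0 (R : realType) (H : preHilbertType R) (u : H) : 0 <= hnorm u.
Proof. exact: sqrtr_ge0. Qed.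
#[global] Hint Extern 0 (is_true (0 <= hnorm _)) =>
  solve [exact: hnorm_ge0] : core.

Section inner_product_algebra.
Variables (R : realType) (H : preHilbertType R).
Implicit Types (u v w : H) (c : R[i]).

Lemma ip_sqr u : ip u u = (hnorm u ^+ 2)%:C%C.
Proof.
apply: complex_ext; first by rewrite sqr_sqrtr//; exact: ip_ge0.
have := ipC u u => /(congr1 (@complex.Im R)); rewrite ImJ /= => h.
by move: h; set x := Im _; lra.
Qed.

Lemma hnorm_eq0 u : hnorm u = 0 -> u = 0.
Proof.
by move=> u0; apply: ip_definite; rewrite ip_sqr u0 expr0n.
Qed.

Lemma ip0l v : ip 0 v = 0 :> R[i].
Proof. by rewrite -(scale0r (0 : H)) ipZl mul0r. Qed.

Lemma ip0r v : ip v 0 = 0 :> R[i].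
Proof. by rewrite ipC ip0l conjc0. Qed.

Lemma ipNl u v : ip (- u) v = - ip u v.
Proof. by rewrite -scaleN1r ipZl mulN1r. Qed.

Lemma ipBl u v w : ip (u - v) w = ip u w - ip v w.
Proof. by rewrite ipDl ipNl. Qed.

Lemma ipDr u v w : ip u (v + w) = ip u v + ip u w.
Proof. by rewrite ipC ipDl conjD -!ipC. Qed.

Lemma ipNr u v : ip u (- v) = - ip u v.
Proof. by rewrite ipC ipNl conjN -ipC. Qed.

Lemma ipBr u v w : ip u (v - w) = ip u v - ip u w.
Proof. by rewrite ipDr ipNr. Qed.

Lemma ipZr c u v : ip u (c *: v) = c^*%C * ip u v.
Proof. by rewrite ipC ipZl conjM -ipC. Qed.

Lemma ip_suml I (s : seq I) (F : I -> H) v :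
  ip (\sum_(i <- s) F i) v = \sum_(i <- s) ip (F i) v.
Proof. exact: (big_morph (ip^~ v) (fun x y => ipDl x y v) (ip0l v)). Qed.

Lemma ip_sumr I (s : seq I) (F : I -> H) v :
  ip v (\sum_(i <- s) F i) = \sum_(i <- s) ip v (F i).
Proof. exact: (big_morph (ip v) (ipDr v) (ip0r v)). Qed.

Lemma ip_inj u v : (forall w, ip u w = ip v w) -> u = v.
Proof.
move=> uv; apply/eqP; rewrite -subr_eq0; apply/eqP/hnorm_eq0/eqP.
rewrite -sqrf_eq0; apply/eqP.
by have := ip_sqr (u - v); rewrite ipBl uv subrr => -[].
Qed.

Lemma Re_ip_sqr u : Re (ip u u) = hnorm u ^+ 2.
Proof. by rewrite ip_sqr. Qed.

Lemma hnorm0 : hnorm (0 : H) = 0.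
Proof.
apply/eqP; rewrite -sqrf_eq0; apply/eqP.
by have := ip_sqr (0 : H); rewrite ip0l => -[].
Qed.

Lemma hnormZ c u : hnorm (c *: u) = nc c * hnorm u.
Proof.
apply/eqP; rewrite -(eqrXn2 (n := 2))//; last exact: mulr_ge0.
rewrite exprMn -!Re_ip_sqr ipZl ipZr mulrA mulcJ ip_sqr.
by rewrite -rmorphM.
Qed.

Lemma hnormN u : hnorm (- u) = hnorm u.
Proof. by rewrite -scaleN1r hnormZ normcN Normc.normc1 mul1r. Qed.

Lemma hnormBC u v : hnorm (u - v) = hnorm (v - u).
Proof. by rewrite -hnormN opprB. Qed.

Lemma hnorm_sqrD u v :
  hnorm (u + v) ^+ 2 = hnorm u ^+ 2 + hnorm v ^+ 2 + 2 * Re (ip u v).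
Proof.
rewrite -!Re_ip_sqr ipDl !ipDr (ipC u v) !ReD ReJ; ring.
Qed.

Lemma cauchy_schwarz u v : nc (ip u v) <= hnorm u * hnorm v.
Proof.
have [w w1 wE] := rotate_to_real (ip u v).
have [v0|v0] := eqVneq (hnorm v) 0.
  by rewrite (hnorm_eq0 v0) ip0r Normc.normc0 mulr_ge0.
have vp : 0 < hnorm v by rewrite lt_neqAle eq_sym v0 hnorm_ge0.
(* expand |w u - t v|^2 >= 0 at its minimiser t = |<u, v>| / |v|^2 *)
have [t e] : exists t, t * hnorm v ^+ 2 = nc (ip u v).
  by exists (nc (ip u v) / hnorm v ^+ 2); rewrite divfK// expf_neq0.
have := sqr_ge0 (hnorm (w *: u + (- t)%:C%C *: v)).
rewrite hnorm_sqrD !hnormZ w1 nc_real ipZl ipZr conjc_real.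
rewrite mul1r mulrCA wE normrN exprMn real_normK ?num_real//.
rewrite -rmorphM /= => h.
have h2 : nc (ip u v) ^+ 2 <= (hnorm u * hnorm v) ^+ 2.
  have b0 := sqr_ge0 (hnorm v); move: h b0 e; rewrite exprMn.
  by move: (hnorm u ^+ 2) (hnorm v ^+ 2) (nc _) => a b n h b0 nE; move: h; rewrite -nE => h; nra.
by rewrite -(ler_pXn2r (n := 2))// nnegrE// mulr_ge0.
Qed.

Lemma hnormD u v : hnorm (u + v) <= hnorm u + hnorm v.
Proof.
rewrite -(ler_pXn2r (n := 2))// ?nnegrE ?addr_ge0// hnorm_sqrD sqrrD.
have := le_trans (Re_le_nc _) (cauchy_schwarz u v).
by set a := hnorm u; set b := hnorm v; lra.
Qed.

Lemma hnormB u v : hnorm (u - v) <= hnorm u + hnorm v.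
Proof. by rewrite -(hnormN v); exact: hnormD. Qed.

Lemma hnorm_le_add u v : hnorm u <= hnorm (u - v) + hnorm v.
Proof. by rewrite -{1}(subrK v u); exact: hnormD. Qed.

Lemma hnorm_triangle u v w :
  hnorm (u - w) <= hnorm (u - v) + hnorm (v - w).
Proof. by rewrite -[u - w](subrKA v); exact: hnormD. Qed.

Lemma ip_small u v (e M : R) : hnorm u <= e -> hnorm v <= M ->
  nc (ip u v) <= e * M.
Proof. by move=> ue vM; apply: le_trans (cauchy_schwarz _ _) _; exact: ler_pM. Qed.

Definition hcvg (x : nat -> H) (u : H) := forall e : R, 0 < e ->
  exists N, forall n, (N <= n)%N -> hnorm (x n - u) <= e.

Definition hcauchy (x : nat -> H) := forall e : R, 0 < e ->
  exists N, forall m n, (N <= m)%N -> (N <= n)%N -> hnorm (x m - x n) <= e.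

End inner_product_algebra.

(** Completeness is what makes adjoints, square roots and integrals exist. *)
HB.mixin Record PreHilbert_isHilbert (R : realType) (H : Type)
    of PreHilbert R H := {
  hcomplete : forall x : nat -> H, hcauchy x -> exists u, hcvg x u }.

#[short(type="hilbertType")]
HB.structure Definition Hilbert (R : realType) :=
  { H of PreHilbert_isHilbert R H & PreHilbert R H }.

(** * The Hilbert space of square integrable functions *)

Section inner_product.
Variable R : realType.
Local Notation D := (half_line R).
Local Notation mu := (half_haar R).
Local Notation mD := (measurable_half_line R).
Implicit Types (u v w : L2 R) (c : R[i]).

Lemma sq_integrable_cintegrable (f g : R -> R[i]) :
  sq_integrable f -> sq_integrable g ->
  cintegrable mu D (fun r => f r * (g r)^*%C).
Proof.
move=> [mf If] [mg Ig].
apply: (@le_cintegrable _ _ _ _ _ mD _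
    (fun r => (nc (f r) ^+ 2)%:E + (nc (g r) ^+ 2)%:E)%E).
- by apply: cmeasurableM => //; exact: cmeasurableJ.
- by apply: emeasurable_funD; exact: measurable_normc_sqr.
- move=> r _; rewrite -EFinD lee_fin Normc.normcM ncJ.
  have := nc_ge0 (f r); have := nc_ge0 (g r).
  have := sqr_ge0 (nc (f r) - nc (g r)); rewrite sqrrB.
  by set a := nc _; set b := nc _; nra.
- rewrite (ge0_integralD mu mD).
  + exact: lte_add_pinfty.
  + by move=> r _; rewrite lee_fin sqr_ge0.
  + exact: measurable_normc_sqr.
  + by move=> r _; rewrite lee_fin sqr_ge0.
  + exact: measurable_normc_sqr.
Qed.

Lemma cintegrable_inner u v :
  cintegrable mu D (fun r => L2_fun u r * (L2_fun v r)^*%C).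
Proof. by apply: sq_integrable_cintegrable; exact: L2_funP. Qed.

(** The inner product can be computed on any representatives. *)
Lemma inner_eq u v (f g : R -> R[i]) :
  sq_integrable f -> sq_integrable g ->
  ae_half_line (L2_fun u) f -> ae_half_line (L2_fun v) g ->
  inner u v = cintegral mu D (fun r => f r * (g r)^*%C).
Proof.
move=> If Ig uf vg; apply: (ae_eq_cintegral mD).
- by have [] := cintegrable_inner u v.
- by have [] := sq_integrable_cintegrable If Ig.
- by apply: filterS2 uf vg => r uf vg Dr; rewrite uf// vg.
Qed.

Lemma innerC u v : inner v u = (inner u v)^*%C.
Proof.
rewrite -(cintegral_conj mD); last exact: cintegrable_inner.
by apply: eq_cintegral => r _ /=; rewrite conjM conjcK mulrC.
Qed.

Lemma innerDl u v w : inner (u + v) w = inner u w + inner v w.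
Proof.
rewrite (inner_eq _ _ (L2_addE u v) (aeW mu (fun r _ => erefl (L2_fun w r)))).
- rewrite -(cintegralD mD); try exact: cintegrable_inner.
  by apply: eq_cintegral => r _ /=; rewrite mulrDl.
- by apply: sq_integrableD; exact: L2_funP.
- exact: L2_funP.
Qed.

Lemma innerZl c u w : inner (c *: u) w = c * inner u w.
Proof.
rewrite (inner_eq _ _ (L2_scaleE c u) (aeW mu (fun r _ => erefl (L2_fun w r)))).
- rewrite -(cintegralZ mD); last exact: cintegrable_inner.
  by apply: eq_cintegral => r _ /=; rewrite mulrA.
- by apply: sq_integrableZ; exact: L2_funP.
- exact: L2_funP.
Qed.

Lemma inner_norm2 u : inner u u =
  (fine (\int[mu]_(r in D) (nc (L2_fun u r) ^+ 2)%:E))%:C%C.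
Proof.
apply: complex_ext => /=.
  by congr fine; apply: eq_integral => r _; rewrite mulcJ.
by rewrite /Rintegral integral0_eq// => r _; rewrite mulcJ.
Qed.

Lemma L2_norm_sqr_int u :
  (L2_norm u ^+ 2)%:E = (\int[mu]_(r in D) (nc (L2_fun u r) ^+ 2)%:E)%E.
Proof.
have [mu' Iu] := L2_funP u.
have I0 : (0 <= \int[mu]_(r in D) (nc (L2_fun u r) ^+ 2)%:E)%E.
  by apply: integral_ge0 => r _; rewrite lee_fin sqr_ge0.
rewrite /L2_norm inner_norm2 /= sqr_sqrtr; last exact: fine_ge0.
by rewrite fineK// ge0_fin_numE.
Qed.

Lemma L2_norm_eq0 u : L2_norm u = 0 -> u = 0.
Proof.
move=> u0; have := L2_norm_sqr_int u; rewrite u0 expr0n /= => /esym I0.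
apply: L2_eq.
have mf : measurable_fun D (fun r => (nc (L2_fun u r) ^+ 2)%:E).
  by apply: measurable_normc_sqr; have [] := L2_funP u.
have : (\int[mu]_(r in D) `|(nc (L2_fun u r) ^+ 2)%:E|)%E = 0%E.
  rewrite -[RHS]I0; apply: eq_integral => r _.
  by rewrite gee0_abs// lee_fin sqr_ge0.
move/(ae_eq_integral_abs mu mD mf) => u_0.
apply: filterS2 u_0 (L2_zeroE R) => r u_0 z_0 Dr.
rewrite z_0//; apply: nc_eq0; apply/eqP; rewrite -sqrf_eq0; apply/eqP.
by have [] := u_0 Dr.
Qed.

Let inner_ge0 u : 0 <= complex.Re (inner u u).
Proof.
by rewrite inner_norm2 /=; apply/fine_ge0/integral_ge0 => r _; rewrite lee_fin sqr_ge0.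
Qed.

Let inner_definite u : complex.Re (inner u u) = 0 -> u = 0.
Proof. by move=> u0; apply: L2_norm_eq0; rewrite /L2_norm u0 sqrtr0. Qed.

HB.instance Definition _ := Lmodule_isPreHilbert.Build R (L2 R)
  innerDl innerZl innerC inner_ge0 inner_definite.

End inner_product.

Section riesz_fischer.
Variable R : realType.
Local Notation D := (half_line R).
Local Notation mu := (half_haar R).
Local Notation mD := (measurable_half_line R).
Implicit Types (u v : L2 R).

Lemma cmeasurable_L2_fun u : cmeasurable D (L2_fun u).
Proof. by have [] := L2_funP u. Qed.

Lemma measurable_normc_sqrB (f g : R -> R[i]) : cmeasurable D f ->
  cmeasurable D g -> measurable_fun D (fun r => (nc (f r - g r) ^+ 2)%:E).
Proof.
by move=> mf mg; apply: measurable_normc_sqr; apply: cmeasurableD => //;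
  exact: cmeasurableN.
Qed.

Lemma L2_dist_sqr u v (f g : R -> R[i]) :
  cmeasurable D f -> cmeasurable D g ->
  ae_half_line (L2_fun u) f -> ae_half_line (L2_fun v) g ->
  (hnorm (u - v) ^+ 2)%:E = (\int[mu]_(r in D) (nc (f r - g r) ^+ 2)%:E)%E.
Proof.
move=> mf mg uf vg; rewrite [LHS]L2_norm_sqr_int.
apply: ge0_ae_eq_integral.
- exact: mD.
- by apply: measurable_normc_sqr; exact: cmeasurable_L2_fun.
- exact: measurable_normc_sqrB.
- by move=> r _; rewrite lee_fin sqr_ge0.
- by move=> r _; rewrite lee_fin sqr_ge0.
near=> r => Dr.
rewrite (near (L2_addE u (- v)) r)// (near (L2_scaleE (-1) v) r)//.
by rewrite (near uf r)// (near vg r)// mulN1r.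
Unshelve. all: by end_near. Qed.

(** The increments are dominated by a geometric series. *)
Lemma cvg_geometric_steps (a : nat -> R) (C : R) :
  (forall k, `|a k.+1 - a k| <= C * 2^-1 ^+ k) -> cvgn a.
Proof.
move=> aC.
have -> : a = (fun n => a 0%N + series (telescope a) n).
  by apply/funext => n; exact: eq_sum_telescope.
apply: is_cvgD; first exact: is_cvg_cst.
apply: normed_cvg.
apply: (@series_le_cvg _ _ (geometric C 2^-1)) => [n|n|n|].
- exact: normr_ge0.
- exact: le_trans (normr_ge0 _) (aC n).
- exact: aC.
- by apply: is_cvg_geometric_series; rewrite ger0_norm// invf_lt1 ?ltr1n.
Qed.

(** The squared increments stay summable in mean after multiplication by
    [4 ^ k], so almost everywhere the increments are [O(2 ^- k)]. *)
Lemma ae_cvg_fast (f : nat -> R -> R[i]) :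
  (forall k, cmeasurable D (f k)) ->
  (forall k, (\int[mu]_(r in D) (nc (f k.+1 r - f k r) ^+ 2)%:E <=
     (4^-1 ^+ k.+1 ^+ 2)%:E)%E) ->
  {ae mu, forall r, D r -> cvgn (fun k => Re (f k r)) /\
                           cvgn (fun k => Im (f k r))}.
Proof.
move=> mf If.
pose h k r := (4 ^+ k * nc (f k.+1 r - f k r) ^+ 2)%:E.
have h0 k r : (0 <= h k r)%E.
  by rewrite lee_fin mulr_ge0 ?sqr_ge0// exprn_ge0.
have mh k : measurable_fun D (h k).
  rewrite /h; under eq_fun do rewrite EFinM.
  by apply: measurable_funeM; exact: measurable_normc_sqrB.
have Ih k : (\int[mu]_(r in D) h k r <= (1 / (2 ^ k.+1)%:R)%:E)%E.
  rewrite /h; under eq_integral do rewrite EFinM.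
  rewrite (ge0_integralZl_EFin _ mD).
  - apply: (@le_trans _ _ ((4 ^+ k)%:E * (4^-1 ^+ k.+1 ^+ 2)%:E)%E).
      by apply: lee_wpmul2l => //; rewrite lee_fin exprn_ge0.
    rewrite -EFinM lee_fin natrX div1r -exprVn.
    rewrite !exprS (_ : 4^-1 = 2^-1 * 2^-1 :> R); last by field.
    have : 0 <= (2^-1 : R) ^+ k <= 1.
      by rewrite exprn_ge0 //= exprn_ile1 // invf_le1 ?ler1n.
    have : 4 ^+ k * (2^-1 * 2^-1) ^+ k = 1 :> R.
      by rewrite -exprMn (_ : 4 * _ = 1 :> R) ?expr1n//; field.
    rewrite exprMn; move: (2^-1 ^+ k) (4 ^+ k) => x y xy /andP[x0 x1].
    rewrite expr0 mulr1 (_ : y * _ = y * (x * x) * (x * x) / 16); last by field.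
    by rewrite xy; nra.
  - by move=> r _; rewrite lee_fin sqr_ge0.
  - exact: measurable_normc_sqrB.
  - by rewrite exprn_ge0.
have mS : measurable_fun D (fun r => \sum_(0 <= k <oo) h k r)%E.
  exact: ge0_emeasurable_sum.
have IS : mu.-integrable D (fun r => \sum_(0 <= k <oo) h k r)%E.
  apply/integrableP; split => //.
  under eq_integral do rewrite gee0_abs ?nneseries_ge0//.
  rewrite (integral_nneseries _ mD)//.
  apply: (@le_lt_trans _ _ (\sum_(0 <= k <oo) (1 / (2 ^ k.+1)%:R)%:E)%E).
    by apply: lee_nneseries => [k _ _|k _]; [exact: integral_ge0|exact: Ih].
  by apply: le_lt_trans (epsilon_trick0 _ _) (ltry 1).
have := integrable_ae mD IS; apply: filterS => r Sfin Dr.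
have {}Sfin := Sfin Dr; set S := (\sum_(0 <= k <oo) h k r)%E in Sfin.
have S0 : 0 <= fine S by apply/fine_ge0/nneseries_ge0.
have step k : nc (f k.+1 r - f k r) <= Num.sqrt (fine S) * 2^-1 ^+ k.
  have q0 : 0 <= 2^-1 ^+ k :> R by rewrite exprn_ge0.
  rewrite -(ler_pXn2r (n := 2))// ?nnegrE ?mulr_ge0 ?sqrtr_ge0//.
  rewrite exprMn sqr_sqrtr// -exprM mulnC exprM.
  rewrite (_ : 2^-1 ^+ 2 = 4^-1 :> R); last by field.
  rewrite exprVn ler_pdivlMr ?exprn_gt0// mulrC -lee_fin fineK//.
  rewrite -[leLHS]/(h k r); apply: le_trans (nneseries_lim_ge k.+1 _) => //.
  by rewrite big_nat_recr//= leeDr// sume_ge0.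
split; apply: (@cvg_geometric_steps _ (Num.sqrt (fine S))) => k;
  apply: le_trans (step k).
- by rewrite -ReN -ReD normr_Re_le.
- by rewrite -ImN -ImD normr_Im_le.
Qed.

Lemma limn_einf_le (a : (\bar R)^nat) (c : \bar R) :
  (forall n, (a n <= c)%E) -> (limn_einf a <= c)%E.
Proof.
move=> ac; rewrite limn_einf_lim; apply: lime_le; first exact: is_cvg_einfs.
apply: nearW => n; apply: le_trans (ac n).
by apply: ereal_inf_lbound; exists n => //=.
Qed.

(** The limit is only controlled through Fatou's lemma, which turns the
    distances between members of the sequence into distances to the limit. *)
Lemma ae_limit_dist (f : nat -> R -> R[i]) (F g : R -> R[i]) (c : R) :
  (forall k, cmeasurable D (f k)) -> cmeasurable D F -> cmeasurable D g ->
  {ae mu, forall r, D r -> Re (f k r) @[k --> \oo] --> Re (F r) /\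
                           Im (f k r) @[k --> \oo] --> Im (F r)} ->
  (forall k, (\int[mu]_(r in D) (nc (f k r - g r) ^+ 2)%:E <= c%:E)%E) ->
  (\int[mu]_(r in D) (nc (F r - g r) ^+ 2)%:E <= c%:E)%E.
Proof.
move=> mf mF mg fF Ic.
pose h k r := (nc (f k r - g r) ^+ 2)%:E.
have mh k : measurable_fun D (h k) by exact: measurable_normc_sqrB.
have h0 k r : D r -> (0 <= h k r)%E by rewrite lee_fin sqr_ge0.
have h0' r : D r -> (0 <= limn_einf (h^~ r))%E.
  move=> Dr; rewrite limn_einf_lim; apply: lime_ge; first exact: is_cvg_einfs.
  by apply: nearW => n; apply: le_ereal_inf_tmp => _ [m _ <-]; exact: h0.
have mhi : measurable_fun D (fun r => limn_einf (h^~ r)).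
  have -> : (fun r => limn_einf (h^~ r)) =
      (fun r => - limn_esup (fun k => - h k r))%E.
    by apply/funext => r; rewrite -[in RHS](@limn_einfN R (fun k => - h k r)%E);
      congr limn_einf; apply/funext => k; rewrite /comp oppeK.
  apply: measurableT_comp => //; apply: measurable_fun_limn_esup => k.
  exact: measurableT_comp.
have <- : (\int[mu]_(r in D) limn_einf (h^~ r) =
    \int[mu]_(r in D) (nc (F r - g r) ^+ 2)%:E)%E.
  apply: ge0_ae_eq_integral => //.
  - exact: mD.
  - exact: measurable_normc_sqrB.
  - by move=> r _; rewrite lee_fin sqr_ge0.
  apply: filterS fF => r fF Dr; have [rF iF] := fF Dr.
  suff /cvg_limn_einf_sup[-> //] :
    h k r @[k --> \oo] --> (nc (F r - g r) ^+ 2)%:E.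
  apply/fine_cvgP; split; first exact: nearW.
  rewrite /comp /=; under eq_fun do rewrite nc_sqr !ReD !ImD.
  rewrite nc_sqr !ReD !ImD; apply: cvgD; rewrite expr2;
    under eq_fun do rewrite expr2; apply: cvgM; apply: cvgD => //; exact: cvg_cst.
apply: le_trans (fatou mu mD mh h0) _; exact: limn_einf_le.
Qed.

(** The Riesz-Fischer theorem: a subsequence whose increments decrease
    geometrically in norm converges almost everywhere, and its limit is also the
    limit in norm of the whole sequence. *)
Lemma L2_complete (x : nat -> L2 R) : hcauchy x -> exists u, hcvg x u.
Proof.
move=> xC; have q0 k : 0 < 4^-1 ^+ k.+1 :> R by rewrite exprn_gt0 ?invr_gt0.
have /choice[N NP] := fun k => xC _ (q0 k).
(* n_ k is at least N j for every j <= k, although N need not be monotone *)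
pose n_ k := (k + \sum_(i < k.+1) N i)%N.
have Nn k l : (k <= l)%N -> (N k <= n_ l)%N.
  by move=> kl; rewrite /n_ (bigD1 (Ordinal (kl : (k < l.+1)%N)))//= addnCA leq_addr.
pose f k := L2_fun (x (n_ k)).
have mf k : cmeasurable D (f k) by exact: cmeasurable_L2_fun.
have fE k l : (\int[mu]_(r in D) (nc (f k r - f l r) ^+ 2)%:E)%E =
    (hnorm (x (n_ k) - x (n_ l)) ^+ 2)%:E.
  by rewrite (@L2_dist_sqr _ _ (f k) (f l))//; exact/aeW.
have fd k l : (k <= l)%N ->
    (\int[mu]_(r in D) (nc (f l r - f k r) ^+ 2)%:E <= (4^-1 ^+ k.+1 ^+ 2)%:E)%E.
  move=> kl; rewrite fE lee_fin lerXn2r// ?nnegrE ?(ltW (q0 k))//.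
  by apply: NP; exact: Nn.
have fcvg := ae_cvg_fast mf (fun k => fd k k.+1 (leqnSn k)).
pose F r := (fine (limn_esup (fun k => (Re (f k r))%:E)) +i*
             fine (limn_esup (fun k => (Im (f k r))%:E)))%C.
have mF : cmeasurable D F.
  by split; apply: (measurableT_comp (@fine_measurable _ _ measurableT));
    apply: measurable_fun_limn_esup => k; apply/measurable_EFinP;
    have [] := mf k.
have limP (a : nat -> R) : cvgn a ->
    a k @[k --> \oo] --> fine (limn_esup (fun k => (a k)%:E)).
  move=> ca; have : (a k)%:E @[k --> \oo] --> (limn a)%:E.
    by apply/fine_cvgP; split; [exact: nearW|].
  by move=> /cvg_limn_einf_sup[_ ->].
have fF : {ae mu, forall r, D r -> Re (f k r) @[k --> \oo] --> Re (F r) /\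
                                   Im (f k r) @[k --> \oo] --> Im (F r)}.
  by apply: filterS fcvg => r fr Dr; have [? ?] := fr Dr; split; exact: limP.
have FfE k : (\int[mu]_(r in D) (nc (F r - f k r) ^+ 2)%:E <=
    (4^-1 ^+ k.+1 ^+ 2)%:E)%E.
  apply: (@ae_limit_dist (fun l => f (l + k)%N)) => //.
    apply: filterS fF => r fr Dr; have [? ?] := fr Dr.
    by split; [rewrite (@cvg_shiftn _ _ (fun l => Re (f l r)))|
               rewrite (@cvg_shiftn _ _ (fun l => Im (f l r)))].
  by move=> l; apply: fd; rewrite leq_addl.
have IF : sq_integrable F.
  have -> : F = (fun r => f 0%N r + (F r - f 0%N r)).
    by apply/funext => r; rewrite addrC subrK.
  apply: sq_integrableD; first exact: L2_funP.
  split; first by apply: cmeasurableD => //; exact: cmeasurableN.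
  exact: le_lt_trans (FfE 0%N) (ltry _).
exists (L2_class F) => e e0.
have uF k : hnorm (x (n_ k) - L2_class F) <= 4^-1 ^+ k.+1.
  rewrite -(ler_pXn2r (n := 2))// ?nnegrE ?(ltW (q0 k))//.
  rewrite hnormBC -lee_fin (@L2_dist_sqr _ _ F (f k))//.
    exact: L2_classK.
  exact/aeW.
have e20 : 0 < e / 2 by rewrite divr_gt0.
have [M MP] := xC _ e20.
have [K [KP MK]] : exists K, 4^-1 ^+ K.+1 <= e / 2 /\ (M <= K)%N.
  have : 4^-1 ^+ k @[k --> \oo] --> (0 : R).
    by apply: cvg_expr; rewrite ger0_norm// invf_lt1 ?ltr1n.
  move=> /cvgr0Pnorm_le/(_ _ e20)[K _ KP].
  exists (K + M)%N; split; last exact: leq_addl.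
  apply: le_trans (ler_norm _) _; apply: KP => /=.
  by rewrite -addSn; apply: leq_trans (leq_addr _ _).
exists M => n Mn; apply: le_trans (hnorm_triangle _ (x (n_ K)) _) _.
rewrite [e]splitr; apply: lerD; last exact: le_trans (uF K) _.
by apply: MP => //; apply: leq_trans MK _; exact: leq_addr.
Qed.

HB.instance Definition _ := PreHilbert_isHilbert.Build R (L2 R) L2_complete.

End riesz_fischer.

(** * Bounded operators *)

Section linear_maps.
Variables (R : realType) (H : preHilbertType R) (A : H -> H).
Hypothesis linA : linear A.
Implicit Types (u v : H) (c : R[i]).

Lemma linear_mapD u v : A (u + v) = A u + A v.
Proof. by have := linA 1 u v; rewrite !scale1r. Qed.

Lemma linear_map0 : A 0 = 0.
Proof. by apply: (addrI (A 0)); rewrite -linear_mapD !addr0. Qed.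

Lemma linear_mapZ c u : A (c *: u) = c *: A u.
Proof. by have := linA c u 0; rewrite linear_map0 !addr0. Qed.

Lemma linear_mapN u : A (- u) = - A u.
Proof. by rewrite -scaleN1r linear_mapZ scaleN1r. Qed.

Lemma linear_mapB u v : A (u - v) = A u - A v.
Proof. by rewrite linear_mapD linear_mapN. Qed.

End linear_maps.

Section bounded_operators.
Variables (R : realType) (H : hilbertType R).
Implicit Types (u v w x y z : H) (A B P Q V : H -> H) (c : R[i]).

Definition bounded A :=
  linear A /\ exists M : R, forall u, hnorm (A u) <= M * hnorm u.

Lemma bounded_pos A : bounded A ->
  exists2 M : R, 0 < M & forall u, hnorm (A u) <= M * hnorm u.
Proof.
move=> [_ [M AM]]; exists (`|M| + 1) => [|u].
  by rewrite ltr_wpDl.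
apply: le_trans (AM u) _; apply: ler_wpM2r => //.
by rewrite ler_wpDr// ler_norm.
Qed.

Lemma bounded_comp A B : bounded A -> bounded B -> bounded (A \o B).
Proof.
move=> bA bB; have [linA _] := bA; have [linB _] := bB.
have [M M0 AM] := bounded_pos bA; have [N N0 BN] := bounded_pos bB.
split=> [c u v|]; first by rewrite /= linB linA.
exists (M * N) => u /=; apply: le_trans (AM _) _.
by rewrite -mulrA; apply: ler_wpM2l; [exact: ltW|exact: BN].
Qed.

Lemma bounded_lin c A B : bounded A -> bounded B -> bounded (c *: A + B).
Proof.
move=> bA bB; have [linA _] := bA; have [linB _] := bB.
have [M M0 AM] := bounded_pos bA; have [N N0 BN] := bounded_pos bB.
split=> [d u v|].
  rewrite !fctE linA linB !scalerDr !scalerA [c * d]mulrC addrACA.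
  by rewrite -!scalerA.
exists (nc c * M + N) => u; rewrite !fctE.
apply: le_trans (hnormD _ _) _; rewrite hnormZ mulrDl -mulrA.
by apply: lerD => //; exact: ler_wpM2l.
Qed.

Lemma bounded0 : bounded 0.
Proof.
split=> [c u v|]; first by rewrite -[LHS]/0 scaler0 addr0.
by exists 0 => u; rewrite mul0r -[X in hnorm X]/0 hnorm0.
Qed.

Lemma boundedZ c A : bounded A -> bounded (c *: A).
Proof. by move=> /(bounded_lin c)/(_ bounded0); rewrite addr0. Qed.

(** The inner products with the range of [P] determine a vector only up to the
    orthogonal complement of that range; inside the closure of the range they
    determine it. *)
Lemma orthogonal_closure P w : (forall x, ip (P x) w = 0) ->
  (forall e : R, 0 < e -> exists x, hnorm (w - P x) <= e) -> w = 0.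
Proof.
move=> Pw0 wP; apply/hnorm_eq0/eqP; rewrite eq_le hnorm_ge0 andbT.
have [//|w0] := leP (hnorm w) 0.
have e0 : 0 < hnorm w / 2 by rewrite divr_gt0.
have [x xP] := wP _ e0.
have : hnorm w ^+ 2 <= hnorm w / 2 * hnorm w.
  rewrite -Re_ip_sqr; apply: le_trans (Re_le_nc _) _.
  by rewrite -{1}(subrK (P x) w) ipDl Pw0 addr0; exact: ip_small.
by rewrite expr2; nra.
Qed.

Section minimization.
Variables (P Q : H -> H) (c : R) (z : H).
Hypotheses (linP : linear P) (linQ : linear Q).
Hypothesis QP : forall x, hnorm (Q x) <= c * hnorm (P x).

(** The energy whose minimiser solves [<P x, w> = <Q x, z>] for all [x]. *)
Let J x := hnorm (P x) ^+ 2 - 2 * Re (ip (Q x) z).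

Let J_lb x : - (c * hnorm z) ^+ 2 <= J x.
Proof.
have h : Re (ip (Q x) z) <= c * hnorm (P x) * hnorm z.
  by apply: le_trans (Re_le_nc _) _; exact: ip_small.
have := sqr_ge0 (hnorm (P x) - c * hnorm z); rewrite /J.
by move: h; set a := hnorm (P x); set b := hnorm z; rewrite !expr2; nra.
Qed.

Let JD x y (t : R) : J (x + t%:C%C *: y) =
  J x + t ^+ 2 * hnorm (P y) ^+ 2
  + 2 * t * (Re (ip (P y) (P x)) - Re (ip (Q y) z)).
Proof.
rewrite /J (linear_mapD linP) (linear_mapZ linP) (linear_mapD linQ) (linear_mapZ linQ).
rewrite hnorm_sqrD hnormZ nc_real exprMn real_normK ?num_real//.
rewrite ipC ipZl ipDl ipZl ReJ ReD !ReZ; ring.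
Qed.

Let parallelogram x y :
  J x + J y - 2 * J ((2^-1)%:C%C *: (x + y)) = hnorm (P x - P y) ^+ 2 / 2.
Proof.
rewrite /J !(linear_mapZ linP) !(linear_mapD linP) !(linear_mapZ linQ) !(linear_mapD linQ).
rewrite hnormZ ipZl ipDl ReZ ReD nc_real ger0_norm ?invr_ge0//.
by rewrite exprMn !hnorm_sqrD hnormN ipNr ReN; field.
Qed.

(** The range of [P] need not be closed: a minimising sequence for
    [|P x|^2 - 2 Re <Q x, z>] has convergent images by the parallelogram
    identity, and the stationarity of the limit is the equation sought. *)
Lemma minimizer_exists : exists w, (forall x, ip (P x) w = ip (Q x) z) /\
  (forall e : R, 0 < e -> exists x, hnorm (w - P x) <= e).
Proof.
have hiJ : has_inf (range J).
  split; first by exists (J 0); exists 0.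
  by exists (- (c * hnorm z) ^+ 2) => _ [x _ <-]; exact: J_lb.
set m := inf (range J).
have mJ x : m <= J x by apply: ge_inf; [case: hiJ|exists x].
have d0 n : 0 < n.+1%:R^-1 :> R by rewrite invr_gt0.
have /choice[x xP] : forall n, exists x, J x < m + n.+1%:R^-1.
  by move=> n; have [_ [x _ <-]] := inf_adherent (d0 n) hiJ; exists x.
have dist k l : hnorm (P (x k) - P (x l)) ^+ 2 <=
    2 * (k.+1%:R^-1 + l.+1%:R^-1).
  have := parallelogram (x k) (x l); have := mJ ((2^-1)%:C%C *: (x k + x l)).
  have := xP k; have := xP l.
  move: (J _) (J (x k)) (J (x l)) (_ ^+ 2) (k.+1%:R^-1) (l.+1%:R^-1).
  by move=> *; lra.
have small (e : R) : 0 < e -> exists N, forall n, (N <= n)%N -> n.+1%:R^-1 <= e.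
  move=> e0; exists (Num.truncn e^-1) => n Nn.
  rewrite -[leRHS]invrK lef_pV2 ?posrE ?invr_gt0//.
  by rewrite (le_trans (ltW (truncnS_gt _)))// ler_nat ltnS.
have xC : hcauchy (P \o x).
  move=> e e0; have [N NP] := small (e ^+ 2 / 4) (divr_gt0 (exprn_gt0 _ e0) (ltr0n _ 4)).
  exists N => k l Nk Nl; rewrite -(ler_pXn2r (n := 2))// ?nnegrE ?(ltW e0)//.
  apply: le_trans (dist _ _) _; have := NP _ Nk; have := NP _ Nl.
  by move: (l.+1%:R^-1) (k.+1%:R^-1) (e ^+ 2) => a b f; lra.
have [w wP] := hcomplete _ xC; exists w.
(* J is nearly minimal at x n, so its first variation there is nearly 0 *)
have Re0 y : Re (ip (P y) w) = Re (ip (Q y) z).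
  have quad (t : R) : 0 <= t ^+ 2 * hnorm (P y) ^+ 2 +
      2 * t * (Re (ip (P y) w) - Re (ip (Q y) z)).
    rewrite -oppr_le0; apply/ler_addgt0Pr => e e0; rewrite add0r.
    have [N1 N1P] := small (e / 2) (divr_gt0 e0 (ltr0n _ 2)).
    have e'0 : 0 < e / 2 / (2 * `|t| * hnorm (P y) + 1).
      by rewrite !divr_gt0// ltr_wpDl// !mulr_ge0.
    have [N2 N2P] := wP _ e'0.
    pose n := maxn N1 N2.
    have h1 := N1P n (leq_maxl _ _); have h2 := N2P n (leq_maxr _ _).
    have h3 : `|2 * t * (Re (ip (P y) w) - Re (ip (P y) (P (x n))))| <= e / 2.
      rewrite -ReN -ReD -ipBr normrM normrM [`|2|]ger0_norm//.
      have : `|Re (ip (P y) (w - P (x n)))| <=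
          hnorm (P y) * (e / 2 / (2 * `|t| * hnorm (P y) + 1)).
        apply: le_trans (normr_Re_le _) _; apply: ip_small => //.
        by rewrite hnormBC.
      move=> h; apply: (@le_trans _ _ (2 * `|t| * (hnorm (P y) *
        (e / 2 / (2 * `|t| * hnorm (P y) + 1))))).
        by apply: ler_wpM2l => //; rewrite mulr_ge0.
      rewrite mulrA mulrA ler_pdivrMr ?ltr_wpDl ?mulr_ge0//.
      rewrite [leRHS]mulrDr mulr1 mulrC ler_wpDr//; lra.
    have := mJ (x n + t%:C%C *: y); rewrite JD.
    move: h3; rewrite ler_norml => /andP[+ _].
    have := xP n; move: h1.
    move: (J _) (n.+1%:R^-1) (Re _) (Re _) (Re _) => j a r1 r2 r3.
    by move: (t ^+ 2 * _) => s; nra.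
  set d := Re (ip (P y) w) - Re (ip (Q y) z).
  suff : d = 0 by move/eqP; rewrite subr_eq0 => /eqP.
  have a0 := sqr_ge0 (hnorm (P y)).
  have := quad (- d / (hnorm (P y) ^+ 2 + 1)); rewrite -/d.
  set a := hnorm (P y) ^+ 2 in a0 *.
  have a1 : 0 < a + 1 by rewrite ltr_wpDl.
  have -> : (- d / (a + 1)) ^+ 2 * a + 2 * (- d / (a + 1)) * d =
      - (d ^+ 2 * ((a + 2) / (a + 1) ^+ 2)) by field; rewrite gt_eqF.
  rewrite oppr_ge0 pmulr_lle0 ?divr_gt0 ?exprn_gt0//; last lra.
  by move=> d2; apply/eqP; rewrite -sqrf_eq0 eq_le d2 sqr_ge0.
(* the imaginary parts are the real parts at i y *)
split=> [y|e e0].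
  apply: complex_ext => //; have := Re0 ('i%C *: y).
  rewrite (linear_mapZ linP) (linear_mapZ linQ) !ipZl !ReM /= !mul0r !mul1r !sub0r.
  exact: oppr_inj.
have [N NP] := wP e e0; exists (x N).
by rewrite hnormBC; exact: NP.
Qed.

End minimization.

(** The Riesz representation theorem in a form that covers both adjoints
    ([P] the identity) and polar decompositions ([P] and [Q] of equal norm). *)
Lemma factor_exists P Q (c : R) : linear P -> linear Q -> 0 <= c ->
  (forall x, hnorm (Q x) <= c * hnorm (P x)) ->
  exists V, [/\ linear V, forall z, hnorm (V z) <= c * hnorm z,
    forall x z, ip (P x) (V z) = ip (Q x) z &
    forall z (e : R), 0 < e -> exists x, hnorm (V z - P x) <= e].
Proof.
move=> linP linQ c0 QP.
have /choice[V VP] := fun z => minimizer_exists z linP linQ QP.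
have VE z x : ip (P x) (V z) = ip (Q x) z by have [] := VP z.
have VA z (e : R) : 0 < e -> exists x, hnorm (V z - P x) <= e.
  by have [_] := VP z; apply.
exists V; split => //.
- move=> a u v; apply/eqP; rewrite -subr_eq0; apply/eqP.
  apply: (@orthogonal_closure P) => [x|e e0].
    by rewrite ipBr ipDr ipZr !VE ipDr ipZr subrr.
  have e3 : 0 < e / 3 by rewrite divr_gt0.
  have e3a : 0 < e / 3 / (nc a + 1) by rewrite divr_gt0// ltr_wpDl.
  have [x1 h1] := VA (a *: u + v) _ e3.
  have [x2 h2] := VA u _ e3a.
  have [x3 h3] := VA v _ e3.
  exists (x1 - (a *: x2 + x3)); rewrite (linear_mapB linP) linP.
  have -> : V (a *: u + v) - (a *: V u + V v) - (P x1 - (a *: P x2 + P x3)) =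
      (V (a *: u + v) - P x1) - (a *: (V u - P x2) + (V v - P x3)).
    have -> : a *: (V u - P x2) + (V v - P x3) =
        (a *: V u + V v) - (a *: P x2 + P x3).
      by rewrite scalerBr opprD addrACA.
    by rewrite !opprB addrACA [RHS]addrACA [- P x1 + _]addrC.
  apply: le_trans (hnormB _ _) _; apply: le_trans (lerD h1 (hnormD _ _)) _.
  have h4 : hnorm (a *: (V u - P x2)) <= e / 3.
    rewrite hnormZ; apply: (@le_trans _ _ (nc a * (e / 3 / (nc a + 1)))).
      exact: ler_wpM2l.
    rewrite mulrA ler_pdivrMr ?ltr_wpDl//.
    by rewrite [leRHS]mulrDr mulr1 mulrC lerDl ltW.
  by move: h3 h4; move: (hnorm _) (hnorm _) => s t; lra.
- move=> z; have [Vz0|Vz0] := leP (hnorm (V z)) 0.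
    by apply: le_trans Vz0 _; rewrite mulr_ge0.
  rewrite -(ler_pM2l Vz0) -expr2; apply/ler_addgt0Pr => e e0.
  have k0 : 0 < hnorm (V z) + c * hnorm z + 1.
    by rewrite ltr_wpDl// addr_ge0// mulr_ge0.
  have [x xP] := VA z _ (divr_gt0 e0 k0).
  have h1 : nc (ip (V z - P x) (V z)) <=
      e / (hnorm (V z) + c * hnorm z + 1) * hnorm (V z) by exact: ip_small.
  have h2 : nc (ip (P x) (V z)) <=
      c * (e / (hnorm (V z) + c * hnorm z + 1) + hnorm (V z)) * hnorm z.
    rewrite VE; apply: ip_small => //; apply: le_trans (QP x) _.
    apply: ler_wpM2l => //; apply: le_trans (hnorm_le_add _ (V z)) _.
    by rewrite hnormBC lerD2r.
  have h3 : hnorm (V z) ^+ 2 <=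
      nc (ip (V z - P x) (V z)) + nc (ip (P x) (V z)).
    rewrite -Re_ip_sqr -{1}(subrK (P x) (V z)) ipDl ReD.
    by apply: lerD; exact: Re_le_nc.
  have h4 : e / (hnorm (V z) + c * hnorm z + 1) * (hnorm (V z) + c * hnorm z)
      <= e.
    rewrite mulrAC ler_pdivrMr// ler_wpM2l ?(ltW e0)//; lra.
  apply: le_trans h3 _; apply: le_trans (lerD h1 h2) _; move: h4.
  move: (e / (hnorm (V z) + c * hnorm z + 1)) (hnorm (V z)) (hnorm z).
  by move=> k a b; nra.
Qed.

Lemma adjoint_exists A : bounded A ->
  exists2 B, bounded B & forall u v, ip (A u) v = ip u (B v).
Proof.
move=> bA; have [linA _] := bA; have [M M0 AM] := bounded_pos bA.
have [//|V [linV VM VE _]] :=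
  @factor_exists id A M (fun _ _ _ => erefl) linA (ltW M0).
by exists V => [|u v]; [split; last by exists M|rewrite VE].
Qed.

(** Polar decomposition: [V] is the adjoint of the partial isometry that maps
    [A x] to [B x] and vanishes on the complement of the range of [A]. *)
Lemma polar A B : linear A -> linear B ->
  (forall x y, ip (A x) (A y) = ip (B x) (B y)) ->
  exists V, [/\ linear V, forall z, hnorm (V z) <= hnorm z,
    forall x z, ip (A x) (V z) = ip (B x) z & forall x, V (B x) = A x].
Proof.
move=> linA linB AB.
have AB1 x : hnorm (B x) <= 1 * hnorm (A x) by rewrite mul1r /hnorm AB.
have [V [linV V1 VE VA]] := factor_exists linA linB ler01 AB1.
exists V; split => // [z|x]; first by rewrite -[leRHS]mul1r.
apply/eqP; rewrite -subr_eq0; apply/eqP.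
apply: (@orthogonal_closure A) => [y|e e0]; first by rewrite ipBr VE AB subrr.
have [y yP] := VA (B x) e e0; exists (y - x).
by rewrite (linear_mapB linA) opprB addrA subrK.
Qed.

End bounded_operators.

(** * Square roots of positive operators *)

Section limits.
Variables (R : realType) (H : preHilbertType R).
Implicit Types (u v : H) (x y : nat -> H).

Lemma hnorm_small_eq u v (k : R) :
  (forall e : R, 0 < e -> hnorm (u - v) <= k * e) -> u = v.
Proof.
move=> uv; apply/eqP; rewrite -subr_eq0; apply/eqP/hnorm_eq0/eqP.
rewrite eq_le hnorm_ge0 andbT; apply/ler_addgt0Pr => e e0; rewrite add0r.
have k0 : 0 < `|k| + 1 by rewrite ltr_wpDl.
apply: le_trans (uv _ (divr_gt0 e0 k0)) _.
apply: (@le_trans _ _ (`|k| * (e / (`|k| + 1)))).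
  by rewrite ler_wpM2r ?ler_norm// divr_ge0// ltW.
by rewrite mulrA ler_pdivrMr// mulrC ler_wpM2l ?(ltW e0)// lerDl.
Qed.

Lemma hcvg_unique x u v : hcvg x u -> hcvg x v -> u = v.
Proof.
move=> xu xv; apply: (@hnorm_small_eq _ _ 2) => e e0.
have [N NP] := xu e e0; have [M MP] := xv e e0.
apply: le_trans (hnorm_triangle _ (x (maxn N M)) _) _.
rewrite mulr_natl mulr2n lerD//; last exact: MP (leq_maxr _ _).
by rewrite hnormBC; exact: NP (leq_maxl _ _).
Qed.

Lemma hcvg_lin (a : R[i]) x y u v : hcvg x u -> hcvg y v ->
  hcvg (fun n => a *: x n + y n) (a *: u + v).
Proof.
move=> xu yv e e0.
have e2 : 0 < e / 2 / (nc a + 1) by rewrite !divr_gt0// ltr_wpDl.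
have [N NP] := xu _ e2; have [M MP] := yv _ (divr_gt0 e0 (ltr0n _ 2)).
exists (maxn N M) => n; rewrite geq_max => /andP[Nn Mn].
rewrite opprD addrACA -scalerBr [e]splitr.
apply: le_trans (hnormD _ _) _; apply: lerD; last exact: MP.
rewrite hnormZ; apply: (@le_trans _ _ (nc a * (e / 2 / (nc a + 1)))).
  by rewrite ler_wpM2l//; exact: NP.
rewrite mulrA ler_pdivrMr ?ltr_wpDl// mulrC ler_wpM2l ?lerDl//.
by rewrite divr_ge0// ltW.
Qed.

Lemma hcvg_shift x u : hcvg x u -> hcvg (fun n => x n.+1) u.
Proof.
move=> xu e e0; have [N NP] := xu e e0; exists N => n Nn.
by apply: NP; exact: leq_trans (leqnSn _).
Qed.

Lemma hcvg_ip x u v (e : R) : hcvg x u -> 0 < e ->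
  exists N, forall n, (N <= n)%N -> nc (ip (x n) v - ip u v) <= e.
Proof.
move=> xu e0; have v0 : 0 < hnorm v + 1 by rewrite ltr_wpDl.
have [N NP] := xu _ (divr_gt0 e0 v0); exists N => n Nn.
rewrite -ipBl; apply: le_trans (ip_small (NP _ Nn) (lexx _)) _.
by rewrite mulrAC ler_pdivrMr// ler_wpM2l ?(ltW e0)// lerDl.
Qed.

Lemma nc_small_eq (z w : R[i]) :
  (forall e : R, 0 < e -> nc (z - w) <= e) -> z = w.
Proof.
move=> zw; apply/eqP; rewrite -subr_eq0; apply/eqP/nc_eq0/eqP.
by rewrite eq_le nc_ge0 andbT; apply/ler_addgt0Pr => e e0; rewrite add0r zw.
Qed.

End limits.

Section square_root.
Variables (R : realType) (H : hilbertType R).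
Implicit Types (u v w x y z : H) (A B P Q T : H -> H).

Definition symmetric A := forall u v, ip (A u) v = ip u (A v).

Definition positive P := bounded P /\ forall u, 0 <= ip (P u) u.

(** Polarisation: the form [<P u, u>] is real at [u + v] and [u + i v]. *)
Lemma positive_symmetric P : positive P -> symmetric P.
Proof.
move=> [[linP _] P0] u v.
have Im0 w : Im (ip (P w) w) = 0 by exact: ger0_Im.
have h1 := Im0 (u + v); have h2 := Im0 (u + 'i%C *: v).
move: h1 h2; rewrite !(linear_mapD linP) (linear_mapZ linP) !ipDl !ipDr !ipZl !ipZr.
rewrite !ImD !Im0 add0r addr0 !ImM !ReM /= Im0.
move=> h1 h2; rewrite [RHS]ipC; apply: complex_ext; rewrite ?ReJ ?ImJ; lra.
Qed.

(** For a positive contraction [Q = 1 - T], the square root is [1 - Z] where [Z]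
    is the solution of [Z = (T + Z^2) / 2], obtained by iteration from 0. *)
Section contraction.
Variables (Q : H -> H).
Hypotheses (Q0 : positive Q) (Q1 : forall u, hnorm (Q u) <= hnorm u).

Let linQ : linear Q. Proof. by case: Q0 => -[]. Qed.
Let symQ : symmetric Q. Proof. exact: positive_symmetric. Qed.

(** [Q^2 <= Q]: positivity at [u - Q u], combined with [Q^3 <= Q^2]. *)
Lemma positive_contraction_sqr u : hnorm (Q u) ^+ 2 <= Re (ip (Q u) u).
Proof.
have := proj2 Q0 (u - Q u); rewrite lecE => /andP[_] /=.
rewrite (linear_mapB linQ) ipBl !ipBr (symQ (Q u) u) !ReB Re_ip_sqr.
have : Re (ip (Q (Q u)) (Q u)) <= hnorm (Q u) ^+ 2.
  rewrite expr2; apply: le_trans (Re_le_nc _) _.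
  by apply: ip_small => //; exact: Q1.
lra.
Qed.

Let T u := u - Q u.

Let linT : linear T.
Proof. by move=> a u v; rewrite /T linQ opprD addrACA -scalerBr. Qed.

Let symT : symmetric T.
Proof. by move=> u v; rewrite /T ipBl ipBr symQ. Qed.

Let T1 u : hnorm (T u) <= hnorm u.
Proof.
rewrite -(ler_pXn2r (n := 2))// ?nnegrE// /T hnorm_sqrD hnormN ipNr ReN ipC ReJ.
have := positive_contraction_sqr u; have := sqr_ge0 (hnorm (Q u)); lra.
Qed.

Let half : R[i] := (2^-1)%:C%C.

Let nc_half : nc half = 2^-1.
Proof. by rewrite nc_real ger0_norm// invr_ge0. Qed.

Let Y := fix Y n : H -> H :=
  if n is m.+1 then fun u => half *: (T u + Y m (Y m u)) else fun=> 0.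

(** The same iteration for the number 1 in place of [T]; it dominates the
    increments of [Y]. *)
Let y := fix y n : R := if n is m.+1 then 2^-1 * (1 + y m ^+ 2) else 0.

Let YS n u : Y n.+1 u = half *: (T u + Y n (Y n u)). Proof. by []. Qed.
Let yS n : y n.+1 = 2^-1 * (1 + y n ^+ 2). Proof. by []. Qed.

Let linY n : linear (Y n).
Proof.
elim: n => [|n IH] a u v; first by rewrite /= scaler0 addr0.
rewrite !YS linT !IH addrACA -[a *: _ + a *: _]scalerDr [LHS]scalerDr.
by rewrite !scalerA mulrC.
Qed.

Let symY n : symmetric (Y n).
Proof.
elim: n => [|n IH] u v; first by rewrite /= ip0l ip0r.
by rewrite !YS ipZl ipZr ipDl ipDr symT !IH conjc_real.
Qed.

Let y01 n : 0 <= y n <= 1.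
Proof.
elim: n => [|n IH]; first by rewrite /= lexx ler01.
by rewrite yS; move/andP: IH => [? ?]; apply/andP; split; rewrite expr2; nra.
Qed.

Let y_mono n : y n <= y n.+1.
Proof. by have /andP[? ?] := y01 n; rewrite yS expr2; nra. Qed.

Let Y_le n u : hnorm (Y n u) <= y n * hnorm u.
Proof.
elim: n u => [|n IH] u; first by rewrite /= hnorm0 mul0r.
rewrite YS hnormZ nc_half yS -mulrA ler_wpM2l ?invr_ge0// mulrDl mul1r.
apply: le_trans (hnormD _ _) _; apply: lerD => //.
apply: le_trans (IH _) _; rewrite expr2 -mulrA ler_wpM2l//.
by have /andP[] := y01 n.
Qed.

Let comm_Y (C : H -> H) : linear C -> (forall u, C (T u) = T (C u)) ->
  forall n u, C (Y n u) = Y n (C u).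
Proof.
move=> linC CT; elim=> [|n IH] u; first exact: linear_map0.
by rewrite !YS (linear_mapZ linC) (linear_mapD linC) CT !IH.
Qed.

Let comm_YY n m u : Y n (Y m u) = Y m (Y n u).
Proof. by apply: comm_Y => // v; apply/esym/comm_Y. Qed.

(** [Y (n + 2) - Y (n + 1)] is half of [Y (n + 1)^2 - Y n^2], which factors
    because the iterates commute. *)
Let Y_step n u : hnorm (Y n.+1 u - Y n u) <= (y n.+1 - y n) * hnorm u.
Proof.
elim: n u => [|n IH] u.
  rewrite YS -[Y 0 (Y 0 u)]/(0 : H) -[Y 0 u]/(0 : H) yS -[y 0]/(0 : R).
  by rewrite addr0 !subr0 hnormZ nc_half expr0n addr0 mulr1 ler_wpM2l ?invr_ge0.
rewrite YS [Y n.+1 u in X in hnorm X]YS -scalerBr opprD addrACA subrr add0r.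
have -> : Y n.+1 (Y n.+1 u) - Y n (Y n u) =
    (Y n.+1 (Y n.+1 u + Y n u)) - Y n (Y n.+1 u + Y n u).
  rewrite !(linear_mapD (linY _)) [Y n (Y n.+1 u)]comm_YY opprD addrACA.
  by rewrite addrA subrK.
rewrite hnormZ nc_half.
have h := IH (Y n.+1 u + Y n u).
have h2 : hnorm (Y n.+1 u + Y n u) <= (y n.+1 + y n) * hnorm u.
  by apply: le_trans (hnormD _ _) _; rewrite mulrDl lerD// Y_le.
have h3 : (y n.+1 - y n) * hnorm (Y n.+1 u + Y n u) <=
    (y n.+1 - y n) * ((y n.+1 + y n) * hnorm u).
  by rewrite ler_wpM2l// subr_ge0.
have -> : (y n.+2 - y n.+1) * hnorm u =
    2^-1 * ((y n.+1 - y n) * ((y n.+1 + y n) * hnorm u)).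
  by rewrite yS {2}yS; ring.
by rewrite ler_wpM2l ?invr_ge0//; exact: le_trans h _.
Qed.

Let Y_dist n m u : (n <= m)%N -> hnorm (Y m u - Y n u) <= (y m - y n) * hnorm u.
Proof.
elim: m => [|m IH]; first by rewrite leqn0 => /eqP->; rewrite !subrr hnorm0 mul0r.
rewrite leq_eqVlt => /predU1P[->|]; first by rewrite !subrr hnorm0 mul0r.
rewrite ltnS => /IH h; apply: le_trans (hnorm_triangle _ (Y m u) _) _.
apply: le_trans (lerD (Y_step m u) h) _.
by rewrite -mulrDl addrA subrK.
Qed.

Let Y_cvg u : exists Yu, hcvg (Y^~ u) Yu.
Proof.
apply: hcomplete => e e0.
have ynd : {homo y : n m / (n <= m)%N >-> n <= m}.
  by apply: homo_leq => [//|a b c|n]; [exact: le_trans|exact: y_mono].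
have yub : has_ubound (range y).
  by exists 1 => _ [n _ <-]; have /andP[] := y01 n.
have ycvg := nondecreasing_cvgn ynd yub.
have d0 : 0 < e / (hnorm u + 1) by rewrite divr_gt0// ltr_wpDl.
have [N _ NP] := (cvgrPdist_le _ _).1 ycvg _ d0.
have yl n : y n <= sup (range y) by apply: ub_le_sup => //; exists n.
have main m n : (N <= n <= m)%N -> hnorm (Y m u - Y n u) <= e.
  move=> /andP[Nn nm]; apply: le_trans (Y_dist _ nm) _.
  have := NP n Nn; rewrite ger0_norm ?subr_ge0// => h.
  have h2 : (y m - y n) * hnorm u <= e / (hnorm u + 1) * hnorm u.
    by rewrite ler_wpM2r//; have := yl m; move: h; lra.
  apply: le_trans h2 _; rewrite mulrAC ler_pdivrMr ?ltr_wpDl//.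
  by rewrite ler_wpM2l ?(ltW e0)// lerDl.
exists N => m n Nm Nn; have [nm|mn] := leqP n m; first by apply: main; rewrite Nn.
by rewrite hnormBC; apply: main; rewrite Nm ltnW.
Qed.

(** The fixed point equation [Z = (T + Z^2) / 2] says [(1 - Z)^2 = 1 - T]. *)
Lemma sqrt_contraction : exists B, [/\ linear B, symmetric B,
  forall u, hnorm (u - B u) <= hnorm u & forall u, B (B u) = Q u].
Proof.
have /choice[Z ZP] := Y_cvg.
have Zdist u : hnorm (Z u) <= hnorm u.
  apply/ler_addgt0Pr => e e0; have [N /(_ N (leqnn _)) h] := ZP u e e0.
  apply: le_trans (hnorm_le_add _ (Y N u)) _; rewrite addrC lerD//.
    apply: le_trans (Y_le _ _) _; rewrite ler_piMl//.
    by have /andP[] := y01 N.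
  by rewrite hnormBC.
have linZ : linear Z.
  move=> a u v; apply: (hcvg_unique (ZP _)).
  have -> : Y^~ (a *: u + v) = (fun n => a *: Y n u + Y n v).
    by apply/funext => n; exact: linY.
  exact: hcvg_lin.
have symZ : symmetric Z.
  move=> u v; apply: nc_small_eq => e e0.
  have e2 : 0 < e / 2 by rewrite divr_gt0.
  have [N NP] := hcvg_ip v (ZP u) e2; have [M MP] := hcvg_ip u (ZP v) e2.
  have := NP _ (leq_maxl N M); have := MP _ (leq_maxr N M).
  rewrite -(ncJ (_ - _)) conjB -!ipC -symY => h1 h2.
  rewrite -[ip (Z u) v - _](subrKA (ip (Y (maxn N M) u) v)) [e]splitr.
  by apply: le_trans (le_normcD _ _) _; rewrite lerD// ncBC.
have ZZE u : Z u = half *: (T u + Z (Z u)).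
  apply: (hcvg_unique (hcvg_shift (ZP u))).
  have -> : (fun n => Y n.+1 u) = (fun n => half *: Y n (Y n u) + half *: T u).
    by apply/funext => n; rewrite YS scalerDr addrC.
  rewrite [half *: (T u + _)]scalerDr [half *: T u + _]addrC.
  apply: hcvg_lin => e e0; last first.
    by exists 0%N => n _; rewrite subrr hnorm0 ltW.
  have e2 : 0 < e / 2 by rewrite divr_gt0.
  have [N NP] := ZP u _ e2; have [M MP] := ZP (Z u) _ e2.
  exists (maxn N M) => n; rewrite geq_max => /andP[Nn Mn].
  apply: le_trans (hnorm_triangle _ (Y n (Z u)) _) _.
  rewrite [e]splitr lerD ?MP// -(linear_mapB (linY n)).
  apply: le_trans (Y_le _ _) _; apply: le_trans (NP _ Nn).
  by rewrite ler_piMl//; have /andP[] := y01 n.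
have lin1Z : linear (fun u => u - Z u).
  by move=> a u v; rewrite linZ opprD addrACA -scalerBr.
exists (fun u => u - Z u); split => // [u v|u|u].
- by rewrite ipBl ipBr symZ.
- by rewrite opprB addrC subrK.
rewrite (linear_mapB linZ).
have -> : Z (Z u) = 2%:R *: Z u - T u.
  rewrite [in RHS]ZZE scalerA.
  have -> : 2%:R * half = 1.
    by apply: complex_ext; rewrite /half ?ReM ?ImM /=; field.
  by rewrite scale1r [T u + _]addrC addrK.
rewrite /T scaler_nat mulr2n; set z := Z u; set q := Q u.
have -> : z - (z + z - (u - q)) = (u - q) - z.
  by rewrite opprB addrCA opprD [z + _]addrA subrr add0r.
by rewrite opprB addrA subrK subKr.
Qed.

End contraction.

(** Rescaling reduces the general case to a contraction. *)
Lemma sqrt_exists P : positive P ->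
  exists B, [/\ positive B, symmetric B & forall u, B (B u) = P u].
Proof.
move=> P0; have [bP _] := P0; have [linP _] := bP.
have [M M0 PM] := bounded_pos bP.
pose Q u := (M^-1)%:C%C *: P u.
have nM : nc (M^-1)%:C%C = M^-1 by rewrite nc_real ger0_norm// invr_ge0 ltW.
have Q0 : positive Q.
  split=> [|u]; first exact: (boundedZ (M^-1)%:C%C bP).
  rewrite ipZl mulr_ge0 ?(proj2 P0)// ler0c invr_ge0 ltW//.
have Q1 u : hnorm (Q u) <= hnorm u.
  by rewrite hnormZ nM ler_pdivrMl.
have [B [linB symB B1 BB]] := sqrt_contraction Q0 Q1.
pose s : R[i] := (Num.sqrt M)%:C%C.
have ss : s * s = M%:C%C by rewrite -rmorphM /= -expr2 sqr_sqrtr// ltW.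
have s0 : 0 <= s by rewrite ler0c sqrtr_ge0.
exists (fun u => s *: B u); split.
- split=> [|u].
    split=> [a u v|]; first by rewrite linB scalerDr !scalerA mulrC.
    exists (nc s * 2) => u; rewrite hnormZ -mulrA ler_wpM2l//.
    rewrite -[B u](subKr u) mulr_natl mulr2n.
    by apply: le_trans (hnormB _ _) _; rewrite lerD.
  rewrite ipZl mulr_ge0//.
  have h : Im (ip (B u) u) = 0.
    by have := congr1 (@complex.Im R) (symB u u); rewrite [ip u _]ipC ImJ; lra.
  rewrite lecE /= h eqxx /=.
  rewrite -[B u](subKr u) ipBl ReB Re_ip_sqr subr_ge0 expr2.
  by apply: le_trans (Re_le_nc _) _; exact: ip_small.
- by move=> u v; rewrite ipZl ipZr symB conjc_real.
- move=> u; rewrite (linear_mapZ linB) scalerA ss BB scalerA -rmorphM /=.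
  by rewrite mulfV ?scale1r// gt_eqF.
Qed.

(** [C] is the absolute value [(A^* A)^(1/2)]. *)
Lemma abs_exists A B : bounded A -> bounded B ->
  (forall u v, ip (A u) v = ip u (B v)) ->
  exists C, positive C /\ forall u, C (C u) = B (A u).
Proof.
move=> bA bB AB.
have P0 : positive (B \o A).
  split=> [|u /=]; first exact: bounded_comp.
  by rewrite ipC -AB ip_sqr conjc_real ler0c sqr_ge0.
by have [C [C0 _ CC]] := sqrt_exists P0; exists C.
Qed.

End square_root.

(** * Trace-class operators *)

Section real_sums.
Variable R : realType.

Lemma tail_small (a : nat -> R) (M e : R) : (forall k, 0 <= a k) ->
  (forall n, \sum_(k < n) a k <= M) -> 0 < e ->
  exists n, forall m, \sum_(n <= k < m) a k <= e.
Proof.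
move=> a0 aM e0; pose S := range (fun n => \sum_(k < n) a k).
have hsS : has_sup S.
  by split; [exists (\sum_(k < 0) a k); exists 0%N|exists M => _ [n _ <-]].
have [_ [n _ <-] nP] := sup_adherent e0 hsS; exists n => m.
have [mn|nm] := leqP m n; first by rewrite big_geq// ltW.
have : \sum_(k < m) a k <= sup S by apply: ub_le_sup; [case: hsS|exists m].
rewrite -(big_mkord xpredT a) (big_cat_nat (n := n))//=; last exact: ltnW.
by move: nP; rewrite -(big_mkord xpredT a); lra.
Qed.

(** The bounds [a], [b] may vanish, so the weighted inequality
    [2 p q <= s t (p^2 / s^2 + q^2 / t^2)] is used with [s], [t] slightly larger. *)
Lemma sum_cauchy_schwarz n (p q : nat -> R) (a b : R) : 0 <= a -> 0 <= b ->
  \sum_(i < n) p i ^+ 2 <= a ^+ 2 -> \sum_(i < n) q i ^+ 2 <= b ^+ 2 ->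
  \sum_(i < n) `|p i * q i| <= a * b.
Proof.
move=> a0 b0 pa qb.
have weighted (s t : R) : 0 < s -> 0 < t ->
    \sum_(i < n) `|p i * q i| <= (s * t) / 2 * (a ^+ 2 / s ^+ 2 + b ^+ 2 / t ^+ 2).
  move=> s0 t0.
  apply: (@le_trans _ _ (\sum_(i < n)
      (s * t) / 2 * (p i ^+ 2 / s ^+ 2 + q i ^+ 2 / t ^+ 2))).
    apply: ler_sum => i _; rewrite normrM.
    have := sqr_ge0 (`|p i| / s - `|q i| / t).
    rewrite sqrrB !exprMn !exprVn !real_normK ?num_real// => h.
    have st0 : 0 < s * t by rewrite mulr_gt0.
    have -> : `|p i| * `|q i| = (s * t) * (`|p i| / s * (`|q i| / t)).
      by field; rewrite !gt_eqF.
    rewrite -[leRHS]mulrA ler_wpM2l ?(ltW st0)//.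
    by move: h; rewrite mulr2n; move: (_ / s) (`|q i| / t) => x y; lra.
  rewrite -mulr_sumr ler_wpM2l ?divr_ge0 ?mulr_ge0 ?(ltW s0) ?(ltW t0)//.
  by rewrite big_split/= -!mulr_suml lerD// ler_wpM2r// invr_ge0 sqr_ge0.
apply/ler_addgt0Pr => e e0.
(* perturb a and b to make them positive *)
have ab0 : 0 < a + b + 1 by rewrite ltr_wpDl// addr_ge0.
pose k := Num.min 1 (e / (a + b + 1)).
have k0 : 0 < k by rewrite lt_min ltr01 divr_gt0.
have k1 : k <= 1 by rewrite ge_min lexx.
have ke : k * (a + b + 1) <= e by rewrite -ler_pdivlMr// ge_min lexx orbT.
have ak : 0 < a + k by rewrite ltr_wpDl.
have bk : 0 < b + k by rewrite ltr_wpDl.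
apply: le_trans (weighted _ _ ak bk) _.
apply: (@le_trans _ _ ((a + k) * (b + k) / 2 * (1 + 1))).
  rewrite ler_wpM2l ?divr_ge0 ?mulr_ge0 ?(ltW ak) ?(ltW bk)//.
  rewrite lerD// ler_pdivrMr ?exprn_gt0// mul1r lerXn2r ?nnegrE ?(ltW ak) ?(ltW bk)//;
    by rewrite lerDl ltW.
by nra.
Qed.

End real_sums.

Section complex_limits.
Variable R : realType.
Implicit Types (z : nat -> R[i]) (l : R[i]).

Definition ccvg z l := Re (z n) @[n --> \oo] --> Re l /\
                       Im (z n) @[n --> \oo] --> Im l.

Lemma ccvg_unique z l l' : ccvg z l -> ccvg z l' -> l = l'.
Proof.
move=> [zr zi] [zr' zi']; apply: complex_ext.
  exact: (cvg_unique (@Rhausdorff R) zr zr').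
exact: (cvg_unique (@Rhausdorff R) zi zi').
Qed.

Lemma ccvg_lin (c : R[i]) z w l m : ccvg z l -> ccvg w m ->
  ccvg (fun n => c * z n + w n) (c * l + m).
Proof.
move=> [zr zi] [wr wi]; split.
  under eq_fun do rewrite ReD ReM; rewrite ReD ReM.
  by apply: cvgD => //; apply: cvgB; apply: cvgMr.
under eq_fun do rewrite ImD ImM; rewrite ImD ImM.
by apply: cvgD => //; apply: cvgD; apply: cvgMr.
Qed.

Lemma eq_ccvg z w l : z =1 w -> ccvg z l -> ccvg w l.
Proof. by move=> /funext->. Qed.

Lemma ccvg_cst l : ccvg (fun=> l) l.
Proof. by split; exact: cvg_cst. Qed.

Lemma ccvgP z l : (forall e : R, 0 < e -> exists N, forall n, (N <= n)%N ->
  nc (z n - l) <= e) -> ccvg z l.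
Proof.
by move=> zl; split; apply/cvgrPdist_le => e e0;
  have [N NP] := zl e e0; exists N => // n /= /NP h;
  rewrite distrC (le_trans _ h)// -?ReB -?ImB ?normr_Re_le ?normr_Im_le.
Qed.

Lemma ccvg_le z l (M : R) : ccvg z l ->
  (exists N, forall n, (N <= n)%N -> nc (z n) <= M) -> nc l <= M.
Proof.
move=> [zr zi] [N zM].
have M0 : 0 <= M := le_trans (nc_ge0 _) (zM N (leqnn _)).
rewrite -(ler_pXn2r (n := 2))// ?nnegrE// nc_sqr.
have h : Re (z n) ^+ 2 + Im (z n) ^+ 2 @[n --> \oo] --> Re l ^+ 2 + Im l ^+ 2.
  by apply: cvgD; under eq_fun do rewrite expr2; rewrite expr2; exact: cvgM.
apply: (ler_cvg_to h (cvg_cst (M ^+ 2))); exists N => // n /= Nn.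
by rewrite -nc_sqr lerXn2r ?nnegrE// zM.
Qed.

End complex_limits.

Section bessel_systems.
Variables (R : realType) (H : hilbertType R).
Implicit Types (u v : nat -> H) (x y : H) (A B V W : H -> H).

(** Such systems are the images of the standard basis of [C^n] under
    contractions; unlike orthonormal systems, they are stable under
    contractions. *)
Definition bessel n u :=
  forall x, \sum_(i < n) nc (ip (u i) x) ^+ 2 <= hnorm x ^+ 2.

Lemma contraction_adjoint V W : (forall x y, ip (V x) y = ip x (W y)) ->
  (forall x, hnorm (V x) <= hnorm x) -> forall x, hnorm (W x) <= hnorm x.
Proof.
move=> VW V1 x; have [|W0] := leP (hnorm (W x)) 0; first by move/le_trans; apply.
rewrite -(ler_pM2l W0) -expr2 -Re_ip_sqr -VW.
by apply: le_trans (Re_le_nc _) _; exact: ip_small.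
Qed.

Lemma bessel_map n u V W : (forall x y, ip (V x) y = ip x (W y)) ->
  (forall x, hnorm (W x) <= hnorm x) -> bessel n u -> bessel n (V \o u).
Proof.
move=> VW W1 bu x /=; under eq_bigr do rewrite VW.
by apply: le_trans (bu _) _; rewrite lerXn2r// nnegrE.
Qed.

(** Phases turn a sum of moduli into the modulus of a sum. *)
Lemma bessel_phase n u (c : nat -> R[i]) : (forall i, nc (c i) = 1) ->
  bessel n u -> bessel n (fun i => c i *: u i).
Proof.
by move=> c1 bu x; under eq_bigr do rewrite ipZl Normc.normcM c1 mul1r.
Qed.

Lemma bessel1 x : hnorm x <= 1 -> bessel 1 (fun=> x).
Proof.
move=> x1 y; rewrite big_ord1 lerXn2r ?nnegrE//.
by rewrite -[leRHS]mul1r; exact: ip_small.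
Qed.

(** [trace_bound A M] says that the trace norm of [A] is at most [M]; in this
    form the triangle inequality, unitary invariance and lower semicontinuity
    of the trace norm are immediate. *)
Definition trace_bound A (M : R) := forall n u v, bessel n u -> bessel n v ->
  nc (\sum_(i < n) ip (A (u i)) (v i)) <= M.

Lemma trace_bound_ge0 A M : trace_bound A M -> 0 <= M.
Proof.
move=> AM; have b0 : bessel 0 (fun=> 0 : H) by move=> x; rewrite big_ord0 sqr_ge0.
by have := AM _ _ _ b0 b0; rewrite big_ord0 Normc.normc0.
Qed.

Lemma trace_bound_le A (M N : R) : M <= N -> trace_bound A M -> trace_bound A N.
Proof. by move=> MN AM n u v bu bv; apply: le_trans (AM _ _ _ bu bv) MN. Qed.

Lemma trace_bound0 : trace_bound 0 0.
Proof.
move=> n u v _ _; rewrite big1 ?Normc.normc0// => i _; exact: ip0l.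
Qed.

Lemma trace_bound_lin (c : R[i]) A B M N : trace_bound A M -> trace_bound B N ->
  trace_bound (c *: A + B) (nc c * M + N).
Proof.
move=> AM BN n u v bu bv; rewrite !fctE.
under eq_bigr do rewrite ipDl ipZl; rewrite big_split/= -mulr_sumr.
apply: le_trans (le_normcD _ _) _; rewrite Normc.normcM.
by rewrite lerD ?ler_wpM2l ?AM ?BN.
Qed.

Lemma trace_boundD A B M N : trace_bound A M -> trace_bound B N ->
  trace_bound (A + B) (M + N).
Proof.
move=> AM BN; have := trace_bound_lin 1 AM BN.
by rewrite scale1r Normc.normc1 mul1r.
Qed.

Lemma trace_boundZ (c : R[i]) A M : trace_bound A M ->
  trace_bound (c *: A) (nc c * M).
Proof. by move=> AM; have := trace_bound_lin c AM trace_bound0; rewrite !addr0. Qed.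

Lemma trace_boundB A B M N : trace_bound A M -> trace_bound B N ->
  trace_bound (A - B) (M + N).
Proof.
move=> AM BN; rewrite -scaleN1r; apply: trace_boundD => //.
by have := trace_boundZ (-1) BN; rewrite normcN Normc.normc1 mul1r.
Qed.

Lemma trace_bound_form A M x y : linear A -> trace_bound A M ->
  nc (ip (A x) y) <= M * hnorm x * hnorm y.
Proof.
move=> linA AM; have M0 := trace_bound_ge0 AM.
have [x0|x0] := leP (hnorm x) 0.
  have -> : x = 0 by apply/hnorm_eq0/le_anti; rewrite x0 hnorm_ge0.
  by rewrite (linear_map0 linA) ip0l Normc.normc0 !mulr_ge0.
have [y0|y0] := leP (hnorm y) 0.
  have -> : y = 0 by apply/hnorm_eq0/le_anti; rewrite y0 hnorm_ge0.
  by rewrite ip0r Normc.normc0 !mulr_ge0.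
have unit (z : H) : 0 < hnorm z -> hnorm ((hnorm z)^-1%:C%C *: z) <= 1.
  by move=> z0; rewrite hnormZ nc_real ger0_norm ?invr_ge0// mulVf// gt_eqF.
have := AM _ _ _ (bessel1 (unit _ x0)) (bessel1 (unit _ y0)).
rewrite big_ord1 (linear_mapZ linA) ipZl ipZr conjc_real !Normc.normcM !nc_real.
rewrite !ger0_norm ?invr_ge0// ler_pdivrMl// ler_pdivrMl//.
by rewrite [hnorm y * _]mulrC [hnorm x * M]mulrC.
Qed.

Lemma trace_bound_norm A M x : linear A -> trace_bound A M ->
  hnorm (A x) <= M * hnorm x.
Proof.
move=> linA AM; have := trace_bound_form x (A x) linA AM.
rewrite ip_sqr nc_real ger0_norm ?sqr_ge0// expr2 => h.
have [A0|A0] := leP (hnorm (A x)) 0; last by rewrite -(ler_pM2r A0).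
by apply: le_trans A0 _; rewrite mulr_ge0// (trace_bound_ge0 AM).
Qed.

(** Scaling reduces bounded operators to contractions. *)
Lemma bessel_scale n u V W (c : R) : 0 < c ->
  (forall x y, ip (V x) y = ip x (W y)) ->
  (forall x, hnorm (W x) <= c * hnorm x) -> bessel n u ->
  bessel n (fun i => c^-1%:C%C *: V (u i)).
Proof.
move=> c0 VW Wc bu.
have nV : nc c^-1%:C%C = c^-1 by rewrite nc_real ger0_norm// invr_ge0 ltW.
apply: (@bessel_map _ _ (fun x => c^-1%:C%C *: V x) (fun x => c^-1%:C%C *: W x)) bu.
  by move=> x y; rewrite ipZl ipZr conjc_real VW.
by move=> x; rewrite hnormZ nV ler_pdivrMl.
Qed.

Lemma trace_bound_compr A C W (c M : R) : linear A -> 0 < c ->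
  (forall x y, ip (C x) y = ip x (W y)) ->
  (forall x, hnorm (W x) <= c * hnorm x) ->
  trace_bound A M -> trace_bound (A \o C) (c * M).
Proof.
move=> linA c0 CW Wc AM n u v bu bv.
have := AM _ _ _ (bessel_scale c0 CW Wc bu) bv.
under eq_bigr do rewrite (linear_mapZ linA) ipZl; rewrite -mulr_sumr Normc.normcM.
by rewrite nc_real ger0_norm ?invr_ge0 ?(ltW c0)// ler_pdivrMl.
Qed.

Lemma trace_bound_compl A C W (c M : R) : 0 < c ->
  (forall x y, ip (W x) y = ip x (C y)) ->
  (forall x, hnorm (W x) <= c * hnorm x) ->
  trace_bound A M -> trace_bound (W \o A) (c * M).
Proof.
move=> c0 WC Wc AM n u v bu bv /=.
have CW x y : ip (C x) y = ip x (W y) by rewrite ipC -WC -ipC.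
have := AM _ _ _ bu (bessel_scale c0 CW Wc bv).
under [X in nc X <= M -> _]eq_bigr do rewrite ipZr conjc_real -WC; rewrite -mulr_sumr Normc.normcM.
by rewrite nc_real ger0_norm ?invr_ge0 ?(ltW c0)// ler_pdivrMl.
Qed.

(** Only finitely many vectors occur in each condition, so convergence at every
    vector suffices. *)
Lemma trace_bound_limit (A_ : nat -> H -> H) A (M : R) :
  (forall x, hcvg (A_^~ x) (A x)) ->
  (exists N, forall n, (N <= n)%N -> trace_bound (A_ n) M) -> trace_bound A M.
Proof.
move=> A_A [N NM] n u v bu bv.
apply: (@ccvg_le _ (fun k => \sum_(i < n) ip (A_ k (u i)) (v i))).
  have H0 : forall m, ccvg (fun k => \sum_(i < m) ip (A_ k (u i)) (v i))
      (\sum_(i < m) ip (A (u i)) (v i)).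
    elim=> [|m IH].
      by under eq_fun do rewrite big_ord0; rewrite big_ord0; exact: ccvg_cst.
    under eq_fun do rewrite big_ord_recr/= -[X in X + _]mul1r.
    rewrite big_ord_recr/= -[X in X + _]mul1r; apply: ccvg_lin => //.
    by apply: ccvgP => e e0; exact: hcvg_ip.
  exact: H0.
by exists N => k /NM; apply.
Qed.

Definition rank1 (a b : H) : H -> H := fun x => ip x a *: b.

Lemma bounded_rank1 a b : bounded (rank1 a b).
Proof.
split=> [c x y|]; first by rewrite /rank1 ipDl ipZl scalerDl scalerA.
exists (hnorm a * hnorm b) => x; rewrite hnormZ mulrAC ler_wpM2r//.
by rewrite mulrC; exact: cauchy_schwarz.
Qed.

Lemma trace_bound_rank1 a b : trace_bound (rank1 a b) (hnorm a * hnorm b).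
Proof.
move=> n u v bu bv; apply: le_trans (nc_le_sum _ _) _.
under eq_bigr do rewrite ipZl [ip b _]ipC Normc.normcM ncJ -[_ * _]ger0_norm ?mulr_ge0//.
exact: (sum_cauchy_schwarz (p := fun i => nc (ip (u i) a))
  (q := fun i => nc (ip (v i) b))).
Qed.

End bessel_systems.

Section orthonormal_bases.
Variables (R : realType) (H : hilbertType R) (e : nat -> H).
Implicit Types (u v : nat -> H) (x y a b : H) (A B C D V W : H -> H).

Definition is_onb := (forall i j, ip (e i) (e j) = (i == j)%:R) /\
  (forall x, (forall n, ip x (e n) = 0) -> x = 0).

Hypothesis onb_e : is_onb.

Let ip_e i j : ip (e i) (e j) = (i == j)%:R. Proof. exact: (proj1 onb_e). Qed.

Let ip_partial x n k :
  ip (\sum_(i < n) ip x (e i) *: e i) (e k) = if (k < n)%N then ip x (e k) else 0.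
Proof.
rewrite ip_suml; case: ifP => kn.
  rewrite (bigD1 (Ordinal kn))//= ipZl ip_e eqxx mulr1 big1 ?addr0// => i ik.
  by rewrite ipZl ip_e -[_ == k]/(i == Ordinal kn) (negbTE ik) mulr0.
rewrite big1// => i _; rewrite ipZl ip_e; case: eqP => [ik|_]; last by rewrite mulr0.
by rewrite -ik ltn_ord in kn.
Qed.

Let hnorm_block (c : nat -> R[i]) m n :
  hnorm (\sum_(m <= i < n) c i *: e i) ^+ 2 = \sum_(m <= i < n) nc (c i) ^+ 2.
Proof.
elim: n => [|n IH]; first by rewrite !big_geq// hnorm0 expr0n.
have [mn|nm] := leqP m n; last by rewrite !big_geq// hnorm0 expr0n.
rewrite !big_nat_recr//= hnorm_sqrD IH hnormZ exprMn -Re_ip_sqr ip_e eqxx mulr1.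
rewrite ip_suml [X in Re X]big_nat_cond [X in Re X]big1.
  by rewrite /= mulr0 addr0.
move=> i /andP[/andP[_ ik] _].
by rewrite ipZl ipZr ip_e lt_eqF// !mulr0.
Qed.

Lemma onb_residual x n :
  hnorm (x - \sum_(i < n) ip x (e i) *: e i) ^+ 2 =
  hnorm x ^+ 2 - \sum_(i < n) nc (ip x (e i)) ^+ 2.
Proof.
set p := \sum_(i < n) _.
have pn : hnorm p ^+ 2 = \sum_(i < n) nc (ip x (e i)) ^+ 2.
  rewrite /p -(big_mkord xpredT (fun i => ip x (e i) *: e i)) hnorm_block.
  by rewrite big_mkord.
have px : Re (ip x p) = hnorm p ^+ 2.
  rewrite pn /p ip_sumr Re_sum; apply: eq_bigr => i _.
  by rewrite ipZr mulrC mulcJ.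
by rewrite hnorm_sqrD hnormN ipNr ReN px pn; lra.
Qed.

Lemma bessel_onb n : bessel n e.
Proof.
move=> x; have := sqr_ge0 (hnorm (x - \sum_(i < n) ip x (e i) *: e i)).
rewrite onb_residual subr_ge0.
by under eq_bigr do rewrite ipC ncJ.
Qed.

Lemma hnorm_proj_le x n : hnorm (\sum_(i < n) ip x (e i) *: e i) <= hnorm x.
Proof.
rewrite -(ler_pXn2r (n := 2))// ?nnegrE//.
rewrite -(big_mkord xpredT (fun i => ip x (e i) *: e i)) hnorm_block big_mkord.
by have := bessel_onb n x; under eq_bigr do rewrite ipC ncJ.
Qed.

(** The partial sums are Cauchy by Bessel's inequality, and their limit has the
    same coefficients as [x]. *)
Lemma onb_expansion x : hcvg (fun n => \sum_(i < n) ip x (e i) *: e i) x.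
Proof.
pose p n := \sum_(i < n) ip x (e i) *: e i.
have pE n : p n = \sum_(0 <= i < n) ip x (e i) *: e i by rewrite big_mkord.
have pC : hcauchy p.
  move=> d d0.
  have := @tail_small _ (fun i => nc (ip x (e i)) ^+ 2) (hnorm x ^+ 2) (d ^+ 2).
  case=> [k|n|//|N NP].
  - exact: sqr_ge0.
  - by under eq_bigr do rewrite ipC ncJ; exact: bessel_onb.
  - by rewrite exprn_gt0.
  have main m n : (N <= n)%N -> (n <= m)%N -> hnorm (p m - p n) <= d.
    move=> Nn nm; rewrite !pE (big_cat_nat (n := n))//= addrAC subrr add0r.
    rewrite -(ler_pXn2r (n := 2))// ?nnegrE ?(ltW d0)// hnorm_block.
    apply: le_trans (NP m); rewrite [leRHS](big_cat_nat (n := n))//=.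
    by rewrite lerDr sumr_ge0// => i _; exact: sqr_ge0.
  exists N => m n Nm Nn; have [nm|mn] := leqP n m; first exact: main.
  by rewrite hnormBC; apply: main => //; exact: ltnW.
have [y py] := hcomplete _ pC.
suff xy : x = y by rewrite [X in hcvg _ X]xy.
apply/eqP; rewrite -subr_eq0; apply/eqP/(proj2 onb_e) => k.
rewrite ipBl; apply/eqP; rewrite subr_eq0; apply/eqP/esym/nc_small_eq => d d0.
have [N NP] := hcvg_ip (e k) py d0.
have := NP (maxn N k.+1) (leq_maxl _ _).
by rewrite ip_partial leq_maxr ncBC.
Qed.

Lemma parseval x y : ccvg (fun n => \sum_(i < n) ip x (e i) * ip (e i) y) (ip x y).
Proof.
apply: ccvgP => d d0; have [N NP] := hcvg_ip y (onb_expansion x) d0.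
exists N => n /NP; rewrite ip_suml.
by under eq_bigr do rewrite ipZl.
Qed.

Lemma ccvg_sum m (f : 'I_m -> nat -> R[i]) (l : 'I_m -> R[i]) :
  (forall i, ccvg (f i) (l i)) ->
  ccvg (fun n => \sum_(i < m) f i n) (\sum_(i < m) l i).
Proof.
elim: m f l => [|m IH] f l fl.
  by under eq_fun do rewrite big_ord0; rewrite big_ord0; exact: ccvg_cst.
under eq_fun do rewrite big_ord_recr/= -[X in X + _]mul1r.
rewrite big_ord_recr/= -[X in X + _]mul1r; apply: ccvg_lin; last exact: fl.
by apply: IH => i; exact: fl.
Qed.

(** Remainders of the expansion of [V D D] along the basis: both factors of
    [<D u, D W v>] are Hilbert-Schmidt. *)
Lemma trace_bound_tail V W D (tau : R) n :
  (forall x y, ip (V x) y = ip x (W y)) -> (forall x, hnorm (V x) <= hnorm x) ->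
  symmetric D ->
  (forall m, \sum_(n <= k < m) hnorm (D (e k)) ^+ 2 <= tau) ->
  trace_bound ((V \o D \o D) - \sum_(k < n) rank1 (D (e k)) (V (D (e k)))) tau.
Proof.
move=> VW V1 symD Dtau N u v bu bv.
pose x i := D (u i); pose y i := D (W (v i)).
have termE i : ip (((V \o D \o D) - \sum_(k < n) rank1 (D (e k)) (V (D (e k)))) (u i)) (v i)
    = ip (x i) (y i) - \sum_(k < n) ip (x i) (e k) * ip (e k) (y i).
  rewrite !fctE ipBl /= VW symD fct_sumE ip_suml; congr (_ - _).
  by apply: eq_bigr => k _; rewrite ipZl VW /x /y !symD.
under eq_bigr do rewrite termE.
pose f i m := (-1) * \sum_(k < n) ip (x i) (e k) * ip (e k) (y i)
  + 1 * \sum_(k < m) ip (x i) (e k) * ip (e k) (y i).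
have fE i m : (n <= m)%N -> f i m = \sum_(n <= k < m) ip (x i) (e k) * ip (e k) (y i).
  move=> nm; rewrite /f mul1r mulN1r
    -[X in - X + _](big_mkord xpredT (fun k => ip (x i) (e k) * ip (e k) (y i)))
    -[X in _ + X](big_mkord xpredT (fun k => ip (x i) (e k) * ip (e k) (y i))).
  by rewrite [X in _ + X](big_cat_nat (n := n))//= addKr.
apply: (@ccvg_le _ (fun m => \sum_(i < N) f i m)).
  apply: (@ccvg_sum _ f) => i.
  rewrite addrC -[- _]mulN1r -[ip (x i) (y i)]mul1r.
  apply: (@ccvg_lin _ (-1) (fun=> _)).
    exact: ccvg_cst.
  have := ccvg_lin 1 (parseval (x i) (y i)) (ccvg_cst 0).
  by rewrite addr0; under eq_fun do rewrite addr0.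
exists n => m nm; under eq_bigr do rewrite fE//.
rewrite exchange_big/=; apply: le_trans (Dtau m).
apply: le_trans (nc_le_sum _ _) _; apply: ler_sum => k _.
apply: le_trans (nc_le_sum _ _) _; rewrite expr2.
have termk i : nc (ip (x i) (e k) * ip (e k) (y i)) =
    `|nc (ip (u i) (D (e k))) * nc (ip ((W \o v) i) (D (e k)))|.
  rewrite Normc.normcM ger0_norm ?mulr_ge0// /x /y symD -(symD (e k)).
  by rewrite [ip (D (e k)) _]ipC ncJ.
under eq_bigr do rewrite termk.
apply: (sum_cauchy_schwarz (p := fun i => nc (ip (u i) (D (e k))))
  (q := fun i => nc (ip ((W \o v) i) (D (e k))))) => //.
have WV a b : ip (W a) b = ip a (V b) by rewrite ipC -VW -ipC.
exact: (@bessel_map _ _ N v W V WV V1 bv).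
Qed.

(** The trace norm is computed by any positive square root of [A^* A], along
    any orthonormal basis. *)
Lemma trace_bound_abs A C (M : R) : bounded A -> positive C ->
  (forall x y, ip (A x) (A y) = ip (C x) (C y)) ->
  trace_bound A M <-> forall n, \sum_(k < n) Re (ip (C (e k)) (e k)) <= M.
Proof.
move=> [linA _] C0 AC; have linC : linear C by case: C0 => -[].
have [V [linV V1 AV VC]] := polar linA linC AC.
have bV : bounded V by split => //; exists 1 => x; rewrite mul1r.
have [W bW VW] := adjoint_exists bV.
have W1 := contraction_adjoint VW V1.
split=> [AM n|CM].
  have := AM n _ _ (bessel_onb n) (bessel_map VW W1 (bessel_onb n)).
  under [X in nc X <= _]eq_bigr do rewrite /= AV.
  by apply: le_trans; rewrite -Re_sum; exact: Re_le_nc.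
have [D [D0 symD DD]] := sqrt_exists C0.
have DC k : hnorm (D (e k)) ^+ 2 = Re (ip (C (e k)) (e k)).
  by rewrite -Re_ip_sqr symD DD ipC ReJ.
have := @trace_bound_tail V W D M 0 VW V1 symD.
rewrite big_ord0 subr0 (_ : (V \o D) \o D = A); last first.
  by apply/funext => x /=; rewrite DD.
apply=> m; rewrite big_mkord; under eq_bigr do rewrite DC.
exact: CM.
Qed.

(** Rank-one terms suffice: they span the finite-rank operators. *)
Definition finite_rank_approx A (d : R) := exists n (a b : nat -> H),
  trace_bound (A - \sum_(k < n) rank1 (a k) (b k)) d.

(** With [A = V D D] and [D^2 = C], the partial sums of the expansion of the
    middle identity along the basis have finite rank; [trace_bound_tail]
    controls what is left. *)
Lemma finite_rank_dense A C (M d : R) : bounded A -> positive C ->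
  (forall x y, ip (A x) (A y) = ip (C x) (C y)) ->
  trace_bound A M -> 0 < d -> finite_rank_approx A d.
Proof.
move=> bA C0 AC AM d0; have CM := (trace_bound_abs M bA C0 AC).1 AM.
have [linA _] := bA; have linC : linear C by case: C0 => -[].
have [V [linV V1 AV VC]] := polar linA linC AC.
have bV : bounded V by split => //; exists 1 => x; rewrite mul1r.
have [W bW VW] := adjoint_exists bV.
have [D [D0 symD DD]] := sqrt_exists C0.
have DC k : hnorm (D (e k)) ^+ 2 = Re (ip (C (e k)) (e k)).
  by rewrite -Re_ip_sqr symD DD ipC ReJ.
have [||n nP] := @tail_small _ (fun k => hnorm (D (e k)) ^+ 2) M d _ _ d0.
- by move=> k; exact: sqr_ge0.
- by move=> n; under eq_bigr do rewrite DC; exact: CM.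
exists n, (D \o e), (V \o D \o e).
have := @trace_bound_tail V W D d n VW V1 symD nP.
by rewrite (_ : (V \o D) \o D = A)//; apply/funext => x /=; rewrite DD.
Qed.

(** ** The trace *)

Definition tr A : R[i] :=
  (limn (series (fun n => Re (ip (A (e n)) (e n)))) +i*
   limn (series (fun n => Im (ip (A (e n)) (e n)))))%C.

Lemma trace_bound_normed A M n (c : nat -> R[i]) : trace_bound A M ->
  (forall i, nc (c i) = 1) ->
  nc (\sum_(i < n) c i * ip (A (e i)) (e i)) <= M.
Proof.
move=> AM c1; have c1' i : nc ((c i)^*%C) = 1 by rewrite ncJ.
have := AM n _ _ (bessel_onb n) (bessel_phase c1' (bessel_onb n)).
by under [X in nc X <= _]eq_bigr do rewrite ipZr conjcK.
Qed.

Lemma abs_summable_cvg (a : nat -> R) M :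
  (forall n, \sum_(i < n) `|a i| <= M) -> cvgn (series a).
Proof.
move=> aM; apply: normed_cvg; apply: nondecreasing_is_cvgn.
  by apply: nondecreasing_series => i _ _ /=.
by exists M => _ [n _ <-]; rewrite /= /series /= big_mkord; exact: aM.
Qed.

(** The diagonal coefficients are absolutely summable: multiply each one by the
    sign that makes its real, or imaginary, part nonnegative. *)
Lemma tr_cvg A M : trace_bound A M ->
  ccvg (fun n => \sum_(i < n) ip (A (e i)) (e i)) (tr A).
Proof.
move=> AM.
pose c (z : R[i]) : R[i] := if 0 <= Re z then 1 else -1.
pose d (z : R[i]) : R[i] := if 0 <= Im z then - 'i%C else 'i%C.
have c1 z : nc (c z) = 1.
  by rewrite /c; case: ifP => _; rewrite ?normcN Normc.normc1.
have d1 z : nc (d z) = 1.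
  by rewrite /d; case: ifP => _; rewrite ?normcN /= expr0n /= add0r expr1n sqrtr1.
have cz z : `|Re z| = Re (c z * z).
  rewrite /c; have [z0|z0] := lerP 0 (Re z); first by rewrite mul1r ger0_norm.
  by rewrite mulN1r ReN ltr0_norm.
have dz z : `|Im z| = Re (d z * z).
  rewrite /d ReM; have [z0|z0] := lerP 0 (Im z); rewrite /= ?oppr0 mul0r sub0r.
    by rewrite ger0_norm// mulN1r opprK.
  by rewrite ltr0_norm// mul1r.
pose t i := ip (A (e i)) (e i).
have sr : cvgn (series (fun n => Re (t n))).
  apply: (@abs_summable_cvg _ M) => n; under eq_bigr do rewrite cz.
  rewrite -Re_sum; apply: le_trans (Re_le_nc _) _.
  exact: (@trace_bound_normed A M n (fun i => c (t i))).
have si : cvgn (series (fun n => Im (t n))).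
  apply: (@abs_summable_cvg _ M) => n; under eq_bigr do rewrite dz.
  rewrite -Re_sum; apply: le_trans (Re_le_nc _) _.
  exact: (@trace_bound_normed A M n (fun i => d (t i))).
split.
  under eq_fun do rewrite Re_sum -(big_mkord xpredT (fun i => Re (t i))).
  exact: sr.
under eq_fun do rewrite Im_sum -(big_mkord xpredT (fun i => Im (t i))).
exact: si.
Qed.

Lemma tr_le A M : trace_bound A M -> nc (tr A) <= M.
Proof.
move=> AM; apply: (ccvg_le (tr_cvg AM)); exists 0%N => n _.
exact: AM (bessel_onb n) (bessel_onb n).
Qed.

Lemma tr_lin (c : R[i]) A B M N : trace_bound A M -> trace_bound B N ->
  tr (c *: A + B) = c * tr A + tr B.
Proof.
move=> AM BN; apply: (ccvg_unique (tr_cvg (trace_bound_lin c AM BN))).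
have := ccvg_lin c (tr_cvg AM) (tr_cvg BN).
apply: eq_ccvg => n; rewrite mulr_sumr -big_split/=; apply: eq_bigr => i _.
by rewrite !fctE ipDl ipZl.
Qed.

(** Parseval's identity. *)
Lemma tr_rank1 a b C W : (forall x y, ip (C x) y = ip x (W y)) ->
  (exists M, trace_bound (rank1 a b \o C) M) ->
  tr (rank1 a b \o C) = ip (C b) a.
Proof.
move=> CW [M bM]; apply: (ccvg_unique (tr_cvg bM)); rewrite CW.
have := parseval b (W a).
apply: eq_ccvg => n.
by apply: eq_bigr => i _; rewrite /= ipZl CW mulrC.
Qed.

Definition tclass A := bounded A /\ exists M, trace_bound A M.

(** Linear functionals that are bounded by [c] times the trace norm. *)
Definition trace_continuous (phi : (H -> H) -> R[i]) (c : R) :=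
  (forall (a : R[i]) A B, tclass A -> tclass B ->
     phi (a *: A + B) = a * phi A + phi B) /\
  (forall A M, bounded A -> trace_bound A M -> nc (phi A) <= c * M).

Lemma tclass_lin (a : R[i]) A B : tclass A -> tclass B -> tclass (a *: A + B).
Proof.
move=> [bA [M AM]] [bB [N BN]]; split; first exact: bounded_lin.
by exists (nc a * M + N); exact: trace_bound_lin.
Qed.

Lemma tclass0 : tclass 0.
Proof. by split; [exact: bounded0|exists 0; exact: trace_bound0]. Qed.

Lemma tclassZ (a : R[i]) A : tclass A -> tclass (a *: A).
Proof. by move=> /(tclass_lin a)/(_ tclass0); rewrite addr0. Qed.

Lemma tclassD A B : tclass A -> tclass B -> tclass (A + B).
Proof. by move=> /(tclass_lin 1); rewrite scale1r; apply. Qed.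

Lemma tclassB A B : tclass A -> tclass B -> tclass (A - B).
Proof. by move=> tA tB; rewrite addrC -scaleN1r; exact: tclass_lin. Qed.

Lemma tclass_rank1 a b : tclass (rank1 a b).
Proof.
by split; [exact: bounded_rank1|exists (hnorm a * hnorm b); exact: trace_bound_rank1].
Qed.

Lemma tclass_sum I (s : seq I) (F : I -> H -> H) :
  (forall i, tclass (F i)) -> tclass (\sum_(i <- s) F i).
Proof. by move=> tF; elim/big_ind: _ => // *; [exact: tclass0|exact: tclassD]. Qed.

Section trace_continuous_lemmas.
Variables (phi : (H -> H) -> R[i]) (c : R).
Hypothesis phi_c : trace_continuous phi c.

Lemma trace_continuous0 : phi 0 = 0.
Proof.
have := proj1 phi_c 1 0 0 tclass0 tclass0.
rewrite scale1r addr0 mul1r => h; apply: (addrI (phi 0)).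
by rewrite addr0 -h.
Qed.

Lemma trace_continuousZ (a : R[i]) A : tclass A -> phi (a *: A) = a * phi A.
Proof.
move=> tA; have := proj1 phi_c a A 0 tA tclass0.
by rewrite !addr0 trace_continuous0 addr0.
Qed.

Lemma trace_continuousB A B : tclass A -> tclass B -> phi (A - B) = phi A - phi B.
Proof.
move=> tA tB; rewrite addrC -scaleN1r (proj1 phi_c)// mulN1r addrC //.
Qed.

Lemma trace_continuous_sum I (s : seq I) (F : I -> H -> H) :
  (forall i, tclass (F i)) -> phi (\sum_(i <- s) F i) = \sum_(i <- s) phi (F i).
Proof.
move=> tF; elim: s => [|i s IH]; first by rewrite !big_nil trace_continuous0.
rewrite !big_cons -[F i]scale1r (proj1 phi_c)//; last exact: tclass_sum.
by rewrite mul1r scale1r IH.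
Qed.

End trace_continuous_lemmas.

(** Rank one operators span a dense subspace for the trace norm. *)
Lemma trace_continuous_eq phi psi (c d : R) A :
  trace_continuous phi c -> trace_continuous psi d ->
  (forall a b, phi (rank1 a b) = psi (rank1 a b)) ->
  tclass A -> (forall r, 0 < r -> finite_rank_approx A r) -> phi A = psi A.
Proof.
move=> phi_c psi_d phipsi tA approxA; apply: nc_small_eq => r r0.
pose k := `|c| + `|d| + 1.
have k0 : 0 < k by rewrite ltr_wpDl// addr_ge0.
have [n [a [b Fr]]] := approxA _ (divr_gt0 r0 k0).
set F := \sum_(k < n) _ in Fr.
have tF : tclass F by apply: tclass_sum => i; exact: tclass_rank1.
have tAF := tclassB tA tF.
have -> : phi A - psi A = phi (A - F) - psi (A - F).
  rewrite (trace_continuousB phi_c)// (trace_continuousB psi_d)//.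
  suff -> : phi F = psi F by rewrite opprB addrA subrK.
  rewrite (trace_continuous_sum phi_c); last by move=> i; exact: tclass_rank1.
  rewrite (trace_continuous_sum psi_d); last by move=> i; exact: tclass_rank1.
  exact: eq_bigr.
apply: le_trans (le_normcD _ _) _; rewrite normcN.
apply: le_trans (lerD (proj2 phi_c _ _ (proj1 tAF) Fr) (proj2 psi_d _ _ (proj1 tAF) Fr)) _.
have rk0 : 0 <= r / k by rewrite divr_ge0 ?ltW.
rewrite -mulrDl mulrCA ler_piMr ?(ltW r0)// ler_pdivrMr// mul1r /k.
by have := ler_norm c; have := ler_norm d; lra.
Qed.

Lemma ip_trace_continuous x y :
  trace_continuous (fun A => ip (A x) y) (hnorm x * hnorm y).
Proof.
split=> [a A B _ _|A M [linA _] AM]; first by rewrite !fctE ipDl ipZl.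
by rewrite mulrC mulrA; exact: trace_bound_form.
Qed.

Lemma tr_comp_trace_continuous C W (c : R) : 0 < c ->
  (forall x y, ip (C x) y = ip x (W y)) ->
  (forall x, hnorm (W x) <= c * hnorm x) ->
  trace_continuous (fun A => tr (A \o C)) c.
Proof.
move=> c0 CW Wc; split=> [a A B [[linA _] [M AM]] [[linB _] [N BN]]|A M [linA _] AM].
  exact: (tr_lin a (trace_bound_compr linA c0 CW Wc AM)
    (trace_bound_compr linB c0 CW Wc BN)).
by apply: tr_le; exact: (trace_bound_compr _ c0 CW).
Qed.

Lemma tclass_conj U W A : (forall x y, ip (U x) y = ip x (W y)) ->
  bounded U -> bounded W -> (forall x, hnorm (U x) <= hnorm x) ->
  (forall x, hnorm (W x) <= hnorm x) ->
  tclass A -> tclass (W \o A \o U) /\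
  (forall M, trace_bound A M -> trace_bound (W \o A \o U) M).
Proof.
move=> UW bU bW U1 W1 [bA AM].
have U1' x : hnorm (U x) <= 1 * hnorm x by rewrite mul1r.
have W1' x : hnorm (W x) <= 1 * hnorm x by rewrite mul1r.
have WU x y : ip (W x) y = ip x (U y) by rewrite ipC -UW -ipC.
have main M : trace_bound A M -> trace_bound (W \o A \o U) M.
  move=> {}AM; rewrite -[M]mul1r; apply: (trace_bound_compr _ ltr01 UW W1').
    by have [] := bounded_comp bW bA.
  rewrite -[M]mul1r; exact: (trace_bound_compl ltr01 WU W1').
split=> //; split; first by apply: bounded_comp => //; exact: bounded_comp.
by have [M {}AM] := AM; exists M; exact: main.
Qed.

(** Both sides are continuous in [A] for the trace norm, and on rank-one
    operators they are matrix coefficients of [C] by [tr_rank1]. *)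
Lemma tr_conj U W A C : (forall x y, ip (U x) y = ip x (W y)) ->
  bounded U -> bounded W -> (forall x, hnorm (U x) <= hnorm x) ->
  (forall x, hnorm (W x) <= hnorm x) -> bounded C ->
  tclass A -> (forall r, 0 < r -> finite_rank_approx A r) ->
  tr ((W \o A \o U) \o C) = tr (A \o (U \o C \o W)).
Proof.
move=> UW bU bW U1 W1 bC tA approxA.
have [C' bC' CC'] := adjoint_exists bC; have [c c0 C'c] := bounded_pos bC'.
have WU x y : ip (W x) y = ip x (U y) by rewrite ipC -UW -ipC.
have t1 : trace_continuous (fun A => tr ((W \o A \o U) \o C)) c.
  have [t1 t2] := tr_comp_trace_continuous c0 CC' C'c; have [linW _] := bW.
  split=> [a A1 A2 tA1 tA2|A1 M bA1 AM].
    rewrite (_ : W \o (a *: A1 + A2) \o U =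
        a *: (W \o A1 \o U) + (W \o A2 \o U)).
      by apply: t1; [have [] := tclass_conj UW bU bW U1 W1 tA1|
                     have [] := tclass_conj UW bU bW U1 W1 tA2].
    by apply/funext => x; rewrite !fctE /= linW.
  have tA1 : tclass A1 by split => //; exists M.
  have [[b1 _] /(_ _ AM) h] := tclass_conj UW bU bW U1 W1 tA1.
  exact: t2.
have UCW' x y : ip ((U \o C \o W) x) y = ip x ((U \o C' \o W) y).
  by rewrite /= UW CC' WU.
have UCWc x : hnorm ((U \o C' \o W) x) <= c * hnorm x.
  apply: le_trans (U1 _) _; apply: le_trans (C'c _) _.
  by rewrite ler_wpM2l// ltW.
have t2 := tr_comp_trace_continuous c0 UCW' UCWc.
apply: (trace_continuous_eq t1 t2) => // a b.
have -> : W \o rank1 a b \o U = rank1 (W a) (W b).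
  apply/funext => x; have [linW _] := bW.
  by rewrite /rank1 /= (linear_mapZ linW) UW.
rewrite (tr_rank1 CC'); last first.
  have [linr _] := bounded_rank1 (W a) (W b).
  eexists; exact: (trace_bound_compr linr c0 CC' C'c (trace_bound_rank1 _ _)).
rewrite (tr_rank1 UCW').
  by rewrite /= UW.
have [linr _] := bounded_rank1 a b.
eexists; exact: (trace_bound_compr linr c0 UCW' UCWc (trace_bound_rank1 _ _)).
Qed.

End orthonormal_bases.

(** * Bochner integrals of operator-valued functions *)

Section integral_monotone.
Local Open Scope ereal_scope.
Context d (T : measurableType d) (R : realType).
Variables (mu : {measure set T -> \bar R}) (D : set T).

(** The integral is a supremum over simple functions, so it is monotone even on
    functions that are not measurable, such as the trace norm of an arbitrary
    operator-valued function. *)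
Lemma ge0_le_integral_nomeas (f g : T -> \bar R) :
  (forall x, D x -> 0 <= f x) -> (forall x, D x -> f x <= g x) ->
  \int[mu]_(x in D) f x <= \int[mu]_(x in D) g x.
Proof.
move=> f0 fg.
have g0 x : D x -> 0 <= g x by move=> Dx; exact: le_trans (f0 _ Dx) (fg _ Dx).
rewrite !ge0_integralE//; apply: le_ereal_sup => _ [h hf <-]; exists h => // x.
by apply: le_trans (hf x) _; exact: lee_restrict.
Qed.

Lemma cvge_fin_le (a : nat -> \bar R) (c : R) : a n @[n --> \oo] --> 0 ->
  (0 < c)%R -> exists2 N, True & forall n, (N <= n)%N -> a n <= c%:E.
Proof.
move=> /fine_cvgP[[N1 _ fin1] /cvgrPdist_le/(_ c) a0] /a0[N2 _ N2P].
exists (maxn N1 N2) => // n; rewrite geq_max => /andP[/fin1 an /N2P].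
by rewrite sub0r normrN -[X in X <= _](fineK an) lee_fin => /(le_trans (ler_norm _)).
Qed.

End integral_monotone.

Section bochner.
Context d (T : measurableType d) (R : realType) (H : hilbertType R).
Variables (mu : {measure set T -> \bar R}) (D : set T) (mD : measurable D).
Implicit Types (F G : T -> H -> H) (s : seq (set T * (H -> H))).

(** The simple functions of the Bochner integral, over any Hilbert space and
    with values that are trace class in the sense of [trace_bound]. *)
Definition is_simple s := {in s, forall p, [/\ measurable p.1, p.1 `<=` D,
  (mu p.1 < +oo)%E & tclass p.2]}.

Definition sval s (x : T) : H -> H :=
  \sum_(p <- s) (\1_(p.1) x : R)%:C%C *: p.2.

Definition sint s : H -> H := \sum_(p <- s) (fine (mu p.1))%:C%C *: p.2.

Lemma is_simple_cat s s' : is_simple s -> is_simple s' -> is_simple (s ++ s').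
Proof. by move=> hs hs' p; rewrite mem_cat => /orP[/hs|/hs']. Qed.

Lemma is_simple_cons p s : is_simple (p :: s) ->
  [/\ measurable p.1, p.1 `<=` D, (mu p.1 < +oo)%E & tclass p.2] /\ is_simple s.
Proof.
move=> hs; split; first by apply: hs; rewrite mem_head.
by move=> q qs; apply: hs; rewrite inE qs orbT.
Qed.

Definition sopp s := [seq (p.1, - p.2) | p <- s].

Lemma is_simple_opp s : is_simple s -> is_simple (sopp s).
Proof.
move=> hs _ /mapP[p /hs[m1 m2 m3 m4] ->]; split => //=.
by rewrite -scaleN1r; exact: tclassZ.
Qed.

Lemma sval_opp s x : sval (sopp s) x = - sval s x.
Proof.
rewrite /sval big_map -sumrN; apply: eq_bigr => p _ /=; exact: scalerN.
Qed.

Lemma sint_opp s : sint (sopp s) = - sint s.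
Proof.
rewrite /sint big_map -sumrN; apply: eq_bigr => p _ /=; exact: scalerN.
Qed.

Lemma sval_cat s s' x : sval (s ++ s') x = sval s x + sval s' x.
Proof. exact: big_cat. Qed.

Lemma sint_cat s s' : sint (s ++ s') = sint s + sint s'.
Proof. exact: big_cat. Qed.

Lemma tclass_sval s x : is_simple s -> tclass (sval s x).
Proof.
elim: s => [|p s IH] hs; first by rewrite /sval big_nil; exact: tclass0.
have [[_ _ _ tp] {}hs] := is_simple_cons hs.
by rewrite /sval big_cons; apply: tclass_lin => //; exact: IH.
Qed.

Lemma tclass_sint s : is_simple s -> tclass (sint s).
Proof.
elim: s => [|p s IH] hs; first by rewrite /sint big_nil; exact: tclass0.
have [[_ _ _ tp] {}hs] := is_simple_cons hs.
by rewrite /sint big_cons; apply: tclass_lin => //; exact: IH.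
Qed.

Lemma cintegral_indic E : measurable E -> E `<=` D -> (mu E < +oo)%E ->
  cintegrable mu D (fun x => (\1_E x : R)%:C%C) /\
  cintegral mu D (fun x => (\1_E x : R)%:C%C) = (fine (mu E))%:C%C.
Proof.
move=> mE ED Ey; have mI : measurable_fun D (\1_E : T -> R) by exact: measurable_indic.
have IE : (\int[mu]_(x in D) (\1_E x)%:E = mu E)%E.
  by rewrite integral_indic// setIidl.
split.
  split; first by split => //=; exact: measurable_cst.
  by under eq_integral do rewrite nc_real ger0_norm//; rewrite IE.
by apply: complex_ext; rewrite /= /Rintegral ?IE// integral0.
Qed.

Section functional.
Variables (phi : (H -> H) -> R[i]) (c : R).
Hypothesis phi_c : trace_continuous phi c.

Lemma functional_simple s : is_simple s ->
  cintegrable mu D (fun x => phi (sval s x)) /\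
  cintegral mu D (fun x => phi (sval s x)) = phi (sint s).
Proof.
elim: s => [|p s IH] hs.
  rewrite /sint big_nil (_ : (fun x => _) = (fun=> phi 0)); last first.
    by apply/funext => x; rewrite /sval big_nil.
  rewrite (trace_continuous0 phi_c) cintegral0.
  by split => //; exact: cintegrable0.
have [[mp pD py tp] {}hs] := is_simple_cons hs.
have [IH1 IH2] := IH hs; have [Ip Ep] := cintegral_indic mp pD py.
have e x : phi (sval (p :: s) x) =
    phi p.2 * (\1_(p.1) x : R)%:C%C + phi (sval s x).
  by rewrite /sval big_cons (proj1 phi_c)//; [rewrite mulrC|exact: tclass_sval].
under eq_fun do rewrite e.
have IZ := cintegrableZ mD (phi p.2) Ip.
split; first exact: cintegrableD.
rewrite (cintegralD mD)// (cintegralZ mD)// Ep IH2.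
by rewrite /sint big_cons (proj1 phi_c)//; [rewrite mulrC|exact: tclass_sint].
Qed.

End functional.

(** The functionals in the definition of [trace_bound]. *)
Lemma form_sum_trace_continuous n (u v : nat -> H) :
  bessel n u -> bessel n v ->
  trace_continuous (fun A => \sum_(i < n) ip (A (u i)) (v i)) 1.
Proof.
move=> bu bv; split=> [a A B _ _|A M _ AM]; last by rewrite mul1r; exact: AM.
rewrite mulr_sumr -big_split/=; apply: eq_bigr => i _.
by rewrite !fctE ipDl ipZl.
Qed.

(** The norm of the integral is at most the integral of the norm: test with the
    functionals that define [trace_bound]. *)
Lemma trace_bound_sint s (h : T -> R) (M : R) : is_simple s ->
  measurable_fun D h -> (forall x, D x -> trace_bound (sval s x) (h x)) ->
  (\int[mu]_(x in D) (h x)%:E <= M%:E)%E -> trace_bound (sint s) M.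
Proof.
move=> hs mh sh hM n u v bu bv.
have phi1 := form_sum_trace_continuous bu bv.
have [I1 E1] := functional_simple phi1 hs.
rewrite -E1 -lee_fin; apply: le_trans (nc_cintegral_le mD I1) _.
apply: le_trans hM; apply: ge0_le_integral => //.
- by move=> x _; rewrite lee_fin.
- by apply/measurable_EFinP; apply: measurable_nc; have [] := I1.
- exact/measurable_EFinP.
- by move=> x Dx; rewrite lee_fin; exact: (sh x Dx).
Qed.

(** Strong integrability, with a measurable majorant [h] of the error in place
    of the trace norm of [F x - sval s x], whose measurability is not known. *)
Definition approximable F := forall r : R, 0 < r -> exists s (h : T -> R),
  [/\ is_simple s, measurable_fun D h,
      forall x, D x -> trace_bound (F x - sval s x) (h x) &
      (\int[mu]_(x in D) (h x)%:E <= r%:E)%E].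

(** The class is closed under approximation in mean, so it can be built up from
    simple functions in several steps. *)
Lemma approximable_close F :
  (forall r : R, 0 < r -> exists G (h : T -> R),
    [/\ approximable G, measurable_fun D h,
        forall x, D x -> trace_bound (F x - G x) (h x) &
        (\int[mu]_(x in D) (h x)%:E <= r%:E)%E]) -> approximable F.
Proof.
move=> FG r r0; have r2 : 0 < r / 2 by rewrite divr_gt0.
have [G [h [aG mh FGh Ih]]] := FG _ r2.
have [s [k [ss mk Gsk Ik]]] := aG _ r2.
exists s, (h \+ k); split => //.
- exact: measurable_funD.
- move=> x Dx; rewrite -(subrK (G x) (F x)) -addrA.
  by apply: trace_boundD; [exact: FGh|exact: Gsk].
- under eq_integral do rewrite EFinD.
  rewrite ge0_integralD//.
  + by rewrite [r]splitr EFinD; exact: leeD.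
  + by move=> x /FGh/trace_bound_ge0; rewrite lee_fin.
  + exact/measurable_EFinP.
  + by move=> x /Gsk/trace_bound_ge0; rewrite lee_fin.
  + exact/measurable_EFinP.
Qed.

Lemma approximableD F G : approximable F -> approximable G ->
  approximable (fun x => F x + G x).
Proof.
move=> aF aG r r0; have r2 : 0 < r / 2 by rewrite divr_gt0.
have [s [h [ss mh Fsh Ih]]] := aF _ r2.
have [t [k [st mk Gtk Ik]]] := aG _ r2.
exists (s ++ t), (h \+ k); split => //.
- exact: is_simple_cat.
- exact: measurable_funD.
- move=> x Dx; rewrite sval_cat opprD addrACA.
  by apply: trace_boundD; [exact: Fsh|exact: Gtk].
- under eq_integral do rewrite EFinD.
  rewrite ge0_integralD//.
  + by rewrite [r]splitr EFinD; exact: leeD.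
  + by move=> x /Fsh/trace_bound_ge0; rewrite lee_fin.
  + exact/measurable_EFinP.
  + by move=> x /Gtk/trace_bound_ge0; rewrite lee_fin.
  + exact/measurable_EFinP.
Qed.

Lemma eq_approximable F G : (forall x, D x -> F x = G x) ->
  approximable F -> approximable G.
Proof.
move=> FG aF r r0; have [s [h [ss mh Fsh Ih]]] := aF _ r0.
by exists s, h; split => // x Dx; rewrite -FG//; exact: Fsh.
Qed.

Lemma approximable0 : approximable (fun=> 0).
Proof.
move=> r r0; exists [::], (fun=> 0); split.
- by [].
- exact: measurable_cst.
- by move=> x _; rewrite /sval big_nil subr0; exact: trace_bound0.
- by rewrite integral0 lee_fin ltW.
Qed.

Lemma approximable_sum I (s : seq I) (F : I -> T -> H -> H) :
  (forall i, approximable (F i)) ->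
  approximable (fun x => \sum_(i <- s) F i x).
Proof.
move=> aF; elim: s => [|i s IH].
  by apply: eq_approximable approximable0 => x _; rewrite big_nil.
apply: eq_approximable (approximableD (aF i) IH) => x _.
by rewrite big_cons.
Qed.

Lemma approximable_indic E A : measurable E -> (mu (E `&` D) < +oo)%E ->
  tclass A -> approximable (fun x => (\1_E x : R)%:C%C *: A).
Proof.
move=> mE Ey tA r r0; exists [:: (E `&` D, A)], (fun=> 0); split.
- by move=> _ /[!inE] /eqP ->; split => //=; exact: measurableI.
- exact: measurable_cst.
- move=> x Dx; rewrite /sval big_seq1 /= !indicE in_setI.
  by rewrite [x \in D]mem_set// andbT subrr; exact: trace_bound0.
- by rewrite integral0 lee_fin ltW.
Qed.

Import HBSimple.

Lemma approximable_sfun (g : {sfun T >-> R}) A :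
  mu.-integrable D (EFin \o g) -> tclass A ->
  approximable (fun x => (g x)%:C%C *: A).
Proof.
move=> Ig tA.
have [s gs] : exists s : seq R, forall x,
    g x = \sum_(y <- s) y * \1_(g @^-1` [set y]) x.
  by eexists => x; rewrite {1}fimfunE fsbig_finite.
apply: (@eq_approximable (fun x => \sum_(y <- s)
    (\1_(g @^-1` [set y]) x : R)%:C%C *: (y%:C%C *: A))) => [x _|].
  rewrite gs rmorph_sum/= scaler_suml.
  by apply: eq_bigr => y _; rewrite rmorphM scalerA mulrC.
apply: approximable_sum => y.
have [->|y0] := eqVneq y 0.
  by apply: eq_approximable approximable0 => x _; rewrite scale0r scaler0.
apply: approximable_indic; last exact: tclassZ.
  exact: measurable_sfunP.
have mE : measurable (g @^-1` [set y]) by exact: measurable_sfunP.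
have [mg ig] := integrableP _ _ _ Ig.
have : (`|y|%:E * mu (g @^-1` [set y] `&` D) < +oo)%E.
  rewrite -(integral_indic mu mD mE) -ge0_integralZl//.
  - apply: le_lt_trans ig; apply: ge0_le_integral => //.
    + apply: measurable_funeM; apply/measurable_EFinP; exact: measurable_indic.
    + exact: measurableT_comp.
    + move=> x _; rewrite /= -EFinM lee_fin indicE.
      case: (boolP (x \in _)) => [/set_mem/= ->|_]; rewrite ?mulr1// mulr0//.
  - by apply/measurable_EFinP; exact: measurable_indic.
rewrite [in X in _ -> X]ltey => h; apply/eqP => m; move: h.
by rewrite m gt0_muley ?ltxx// lte_fin normr_gt0.
Qed.

Lemma approximable_scale (f : T -> R) A : mu.-integrable D (EFin \o f) ->
  tclass A -> approximable (fun x => (f x)%:C%C *: A).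
Proof.
move=> If tA; have [bA [M AM]] := tA; have M0 := trace_bound_ge0 AM.
have [g [Ig _ gf]] := approximation_sfun_integrable mD If.
have mf : measurable_fun D f by apply/measurable_EFinP; case/integrableP: If.
have mg n : measurable_fun D (g n) by exact: measurable_funTS.
apply: approximable_close => r r0.
have rM : 0 < r / (M + 1) by rewrite divr_gt0// ltr_wpDl.
have [N NP] : exists N, (\int[mu]_(x in D) (`|f x - g N x|)%:E <= (r / (M + 1))%:E)%E.
  have [N _ NP] := cvge_fin_le gf rM; exists N; exact: NP.
exists (fun x => (g N x)%:C%C *: A), (fun x => `|f x - g N x| * M); split.
- exact: approximable_sfun.
- by apply: measurable_funM => //; apply: measurableT_comp => //; exact: measurable_funB.
- move=> x _; rewrite -scalerBl -rmorphB -nc_real; exact: trace_boundZ.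
- under eq_integral do rewrite mulrC EFinM.
  rewrite ge0_integralZl//.
  + apply: le_trans (lee_wpmul2l _ NP) _; first by rewrite lee_fin.
    rewrite -EFinM lee_fin mulrA ler_pdivrMr ?ltr_wpDl//.
    by rewrite mulrC ler_wpM2l ?(ltW r0)// lerDl.
  + by apply/measurable_EFinP; apply: measurableT_comp => //; exact: measurable_funB.
Qed.

Lemma approximable_cscale (f : T -> R[i]) A : cintegrable mu D f ->
  tclass A -> approximable (fun x => f x *: A).
Proof.
move=> If tA.
have fE x : f x *: A = (Re (f x))%:C%C *: A + (Im (f x))%:C%C *: ('i%C *: A).
  rewrite scalerA -scalerDl [in LHS](complexE (f x)); congr (_ *: _).
  by rewrite [in RHS]mulrC.
apply: (@eq_approximable (fun x =>
    (Re (f x))%:C%C *: A + (Im (f x))%:C%C *: ('i%C *: A))) => [x _|].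
  by rewrite fE.
apply: approximableD; apply: approximable_scale => //.
- exact: cintegrableRe.
- exact: cintegrableIm.
- exact: tclassZ.
Qed.

(** Summability of the errors makes them vanish almost everywhere. *)
Lemma ae_summable_cvg0 (h : nat -> T -> R) :
  (forall k, measurable_fun D (h k)) -> (forall k x, D x -> 0 <= h k x) ->
  (forall k, (\int[mu]_(x in D) (h k x)%:E <= (1 / (2 ^ k.+1)%:R)%:E)%E) ->
  {ae mu, forall x, D x -> h k x @[k --> \oo] --> 0}.
Proof.
move=> mh h0 Ih.
have mhE k : measurable_fun D (fun x => (h k x)%:E) by exact/measurable_EFinP.
have h0E k x : D x -> (0 <= (h k x)%:E)%E by move=> /h0; rewrite lee_fin.
have mS : measurable_fun D (fun x => \sum_(0 <= k <oo) (h k x)%:E)%E.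
  by apply: ge0_emeasurable_sum => // k x Dx _; exact: h0E.
have IS : mu.-integrable D (fun x => \sum_(0 <= k <oo) (h k x)%:E)%E.
  apply/integrableP; split => //.
  have -> : (\int[mu]_(x in D) `|\sum_(0 <= k <oo) (h k x)%:E| =
      \int[mu]_(x in D) \sum_(0 <= k <oo) (h k x)%:E)%E.
    apply: eq_integral => x /set_mem Dx.
    by rewrite gee0_abs// nneseries_ge0// => k _ _; exact: h0E.
  rewrite (integral_nneseries _ mD)//.
  apply: (@le_lt_trans _ _ (\sum_(0 <= k <oo) (1 / (2 ^ k.+1)%:R)%:E)%E).
    by apply: lee_nneseries => [k _ _|k _]; [apply: integral_ge0; exact: h0E|exact: Ih].
  by apply: le_lt_trans (epsilon_trick0 _ _) (ltry 1).
have := integrable_ae mD IS; apply: filterS => x Sfin Dx.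
have {}Sfin := Sfin Dx; set S := (\sum_(0 <= k <oo) (h k x)%:E)%E in Sfin.
have hS n : \sum_(k < n) h k x <= fine S.
  rewrite -lee_fin fineK// -sumEFin -(big_mkord xpredT (fun k => (h k x)%:E)).
  by apply: nneseries_lim_ge => k _ _; exact: h0E.
apply/cvgrPdist_le => e e0.
have [n nP] := tail_small (fun k => h0 k x Dx) hS e0.
exists n => // k /= nk; rewrite sub0r normrN ger0_norm; last exact: h0.
apply: le_trans (nP k.+1); rewrite big_nat_recr//= lerDr sumr_ge0// => i _.
exact: h0.
Qed.

(** The integrals of simple approximations with summable errors are Cauchy for
    the trace norm. They converge at every vector because the trace norm
    dominates the operator norm, and the limit is also a limit for the trace
    norm by [trace_bound_limit]. *)
Lemma approximable_integral F : approximable F ->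
  exists A (s : nat -> seq (set T * (H -> H))) (h : nat -> T -> R),
  [/\ tclass A, forall k, is_simple (s k), forall k, measurable_fun D (h k) &
    forall k x, D x -> trace_bound (F x - sval (s k) x) (h k x)] /\
  [/\ forall k, (\int[mu]_(x in D) (h k x)%:E <= (1 / (2 ^ k.+1)%:R)%:E)%E,
    {ae mu, forall x, D x -> h k x @[k --> \oo] --> 0} &
    forall k, trace_bound (A - sint (s k)) (1 / (2 ^ k)%:R)].
Proof.
move=> aF.
have e0 k : 0 < 1 / (2 ^ k.+1)%:R :> R by rewrite divr_gt0// ltr0n expn_gt0.
have /choice[sh shP] : forall k, exists sh : seq (set T * (H -> H)) * (T -> R),
    [/\ is_simple sh.1, measurable_fun D sh.2,
      forall x, D x -> trace_bound (F x - sval sh.1 x) (sh.2 x) &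
      (\int[mu]_(x in D) (sh.2 x)%:E <= (1 / (2 ^ k.+1)%:R)%:E)%E].
  by move=> k; have [s [h shP]] := aF _ (e0 k); exists (s, h).
pose s k := (sh k).1; pose h k := (sh k).2.
have ss k : is_simple (s k) by have [] := shP k.
have mh k : measurable_fun D (h k) by have [] := shP k.
have Fs k x : D x -> trace_bound (F x - sval (s k) x) (h k x).
  by have [_ _ + _] := shP k; apply.
have Ih k : (\int[mu]_(x in D) (h k x)%:E <= (1 / (2 ^ k.+1)%:R)%:E)%E.
  by have [] := shP k.
have h0 k x : D x -> 0 <= h k x by move=> /(Fs k)/trace_bound_ge0.
have half k : 1 / (2 ^ k.+1)%:R + 1 / (2 ^ k.+1)%:R = 1 / (2 ^ k)%:R :> R.
  by rewrite expnS natrM; field; rewrite natrX expf_neq0.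
have mono k l : (k <= l)%N -> 1 / (2 ^ l)%:R <= 1 / (2 ^ k)%:R :> R.
  move=> kl; rewrite !div1r lef_pV2 ?posrE ?ltr0n ?expn_gt0//.
  by rewrite ler_nat leq_exp2l.
have Idiff k l : (k <= l)%N ->
    trace_bound (sint (s l) - sint (s k)) (1 / (2 ^ k)%:R).
  move=> kl; rewrite -sint_opp -sint_cat.
  apply: (@trace_bound_sint _ (h l \+ h k)) => //.
  - by apply: is_simple_cat => //; exact: is_simple_opp.
  - exact: measurable_funD.
  - move=> x Dx; rewrite sval_cat sval_opp.
    have -> : sval (s l) x - sval (s k) x =
        (F x - sval (s k) x) - (F x - sval (s l) x).
      by rewrite opprB [RHS]addrC addrA subrK.
    rewrite (_ : (h l \+ h k) x = h k x + h l x); last by rewrite /= addrC.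
    by apply: trace_boundB; exact: Fs.
  - under eq_integral do rewrite EFinD.
    rewrite ge0_integralD//; try by move=> x Dx; rewrite lee_fin; exact: h0.
    + rewrite -half EFinD leeD//; apply: le_trans (Ih l) _.
      by rewrite lee_fin mono.
    + exact/measurable_EFinP.
    + exact/measurable_EFinP.
have lins k : linear (sint (s k)) by have [[]] := tclass_sint (ss k).
have Idist k l u : (k <= l)%N ->
    hnorm (sint (s l) u - sint (s k) u) <= 1 / (2 ^ k)%:R * hnorm u.
  move=> kl; set X := sint (s l) - sint (s k).
  have linX : linear X.
    by have [[]] := tclassB (tclass_sint (ss l)) (tclass_sint (ss k)).
  exact: trace_bound_norm u linX (Idiff _ _ kl).
have small (r : R) : 0 < r -> exists k, 1 / (2 ^ k)%:R <= r.
  move=> r0; exists (Num.truncn r^-1).+1.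
  rewrite div1r -[leRHS]invrK lef_pV2 ?posrE ?invr_gt0// ?ltr0n ?expn_gt0//.
  apply: le_trans (ltW (truncnS_gt _)) _.
  by rewrite ler_nat ltnW// ltn_expl.
have /choice[A AP] : forall u, exists v, hcvg (fun k => sint (s k) u) v.
  move=> u; apply: hcomplete => r r0.
  have u1 : 0 < hnorm u + 1 by rewrite ltr_wpDl.
  have [N NP] := small _ (divr_gt0 r0 u1).
  have main k l : (N <= k)%N -> (k <= l)%N ->
      hnorm (sint (s l) u - sint (s k) u) <= r.
    move=> Nk kl; apply: le_trans (Idist _ _ _ kl) _.
    apply: (@le_trans _ _ (r / (hnorm u + 1) * hnorm u)).
      by rewrite ler_wpM2r//; exact: le_trans (mono _ _ Nk) _.
    by rewrite mulrAC ler_pdivrMr// ler_wpM2l ?(ltW r0)// lerDl.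
  exists N => k l Nk Nl; have [kl|lk] := leqP k l; last by apply: main => //; exact: ltnW.
  by rewrite hnormBC; exact: main.
have linA : linear A.
  move=> c u v; apply: (hcvg_unique (AP _)).
  rewrite (_ : (fun k => _) = (fun k => c *: sint (s k) u + sint (s k) v)).
    exact: hcvg_lin.
  by apply/funext => k; exact: lins.
have AI k : trace_bound (A - sint (s k)) (1 / (2 ^ k)%:R).
  apply: (@trace_bound_limit _ _ (fun l => sint (s l) - sint (s k))) => [u|].
    have cst : hcvg (fun=> - sint (s k) u) (- sint (s k) u).
      by move=> r r0; exists 0%N => n _; rewrite subrr hnorm0 ltW.
    have := hcvg_lin 1 (AP u) cst; rewrite scale1r.
    rewrite (_ : (fun n => 1 *: _ + _) = (fun l => (sint (s l) - sint (s k)) u))//.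
    by apply/funext => l; rewrite scale1r.
  by exists k => l; exact: Idiff.
exists A, s, h; split; split => //; last exact: ae_summable_cvg0.
have [b0 [M sM]] := tclass_sint (ss 0%N).
have AM : trace_bound A (1 / (2 ^ 0)%:R + M).
  rewrite -(subrK (sint (s 0%N)) A); exact: trace_boundD.
split; last by exists (1 / (2 ^ 0)%:R + M).
by split => //; exists (1 / (2 ^ 0)%:R + M) => u; exact: trace_bound_norm.
Qed.

(** A functional that is continuous for the trace norm commutes with the
    Bochner integral, for any extended-valued majorant [N] of the trace norm. *)
Lemma functional_bochner (phi : (H -> H) -> R[i]) (c : R) F A
    (N : (H -> H) -> \bar R) (s : nat -> seq (set T * (H -> H))) : 0 < c ->
  trace_continuous phi c ->
  (forall X, (0 <= N X)%E) ->
  (forall X (M : R), bounded X -> (N X <= M%:E)%E -> trace_bound X M) ->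
  tclass A -> (forall x, D x -> tclass (F x)) -> (forall k, is_simple (s k)) ->
  cmeasurable D (fun x => phi (F x)) ->
  (\int[mu]_(x in D) N (F x - sval (s k) x)%R)%E @[k --> \oo] --> 0%E ->
  N (A - sint (s k)) @[k --> \oo] --> 0%E ->
  phi A = cintegral mu D (fun x => phi (F x)).
Proof.
move=> c0 phi_c N0 NM tA tF ss mphi Ncvg Acvg.
have mdiff k : cmeasurable D (fun x => phi (F x) - phi (sval (s k) x)).
  apply: cmeasurableD => //; apply: cmeasurableN.
  by have [[]] := functional_simple phi_c (ss k).
have pointwise k x : D x ->
    ((c^-1)%:E * (nc (phi (F x) - phi (sval (s k) x)))%:E <= N (F x - sval (s k) x)%R)%E.
  move=> Dx; have ts := tclass_sval x (ss k).
  have tFs := tclassB (tF x Dx) ts.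
  rewrite -(trace_continuousB phi_c)//; last exact: tF.
  case: (N (F x - sval (s k) x)%R) (N0 (F x - sval (s k) x))
      (NM (F x - sval (s k) x)) => [M _ h|_ _|//]; last by rewrite leey.
  rewrite -EFinM lee_fin ler_pdivrMl//; apply: (proj2 phi_c) => //.
    by have [] := tFs.
  by apply: h; [have [] := tFs|].
have Idiff k : ((c^-1)%:E * \int[mu]_(x in D) (nc (phi (F x) - phi (sval (s k) x)))%:E
    <= \int[mu]_(x in D) N (F x - sval (s k) x)%R)%E.
  rewrite -ge0_integralZl//.
  - apply: ge0_le_integral_nomeas => x Dx; last exact: pointwise.
    by rewrite mule_ge0// lee_fin// invr_ge0 ltW.
  - by apply/measurable_EFinP; exact: measurable_nc.
  - by move=> x _; rewrite lee_fin.
  - by rewrite lee_fin invr_ge0 ltW.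
have bound (r : R) : 0 < r -> exists k,
    (\int[mu]_(x in D) (nc (phi (F x) - phi (sval (s k) x)))%:E <= (c * r)%:E)%E /\
    trace_bound (A - sint (s k)) r.
  move=> r0; have [K1 _ K1P] := cvge_fin_le Ncvg r0.
  have [K2 _ K2P] := cvge_fin_le Acvg r0.
  exists (maxn K1 K2); split; last first.
    apply: NM; last by apply: K2P; exact: leq_maxr.
    by have [] := tclassB tA (tclass_sint (ss (maxn K1 K2))).
  rewrite EFinM -lee_pdivrMl//; apply: le_trans (Idiff _) _.
  by apply: K1P; exact: leq_maxl.
have Iphi : cintegrable mu D (fun x => phi (F x)).
  have [k [Ik _]] := bound 1 ltr01.
  have h : cintegrable mu D (fun x => phi (F x) - phi (sval (s k) x)).
    by split => //; exact: le_lt_trans Ik (ltry _).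
  have := cintegrableD mD h (proj1 (functional_simple phi_c (ss k))).
  by apply: eq_cintegrable => x _; rewrite subrK.
apply: nc_small_eq => r r0.
have r2 : 0 < r / 2 / c by rewrite !divr_gt0.
have [k [Ik Ak]] := bound _ r2.
have [Is Es] := functional_simple phi_c (ss k).
rewrite -[phi A - _](subrKA (phi (sint (s k)))) [r]splitr.
apply: le_trans (le_normcD _ _) _; apply: lerD.
  rewrite -(trace_continuousB phi_c)//; last exact: tclass_sint.
  have := proj2 phi_c _ _ (proj1 (tclassB tA (tclass_sint (ss k)))) Ak.
  by rewrite mulrC divfK// gt_eqF.
have IN := cintegrableZ mD (-1) Is.
have -> : phi (sint (s k)) - cintegral mu D (fun x => phi (F x)) =
    - cintegral mu D (fun x => phi (F x) - phi (sval (s k) x)).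
  under [in RHS]eq_fun do rewrite -mulN1r.
  by rewrite (cintegralD mD)// (cintegralZ mD)// Es mulN1r opprB.
rewrite normcN -lee_fin.
have If : cintegrable mu D (fun x => phi (F x) - phi (sval (s k) x)).
  by split => //; exact: le_lt_trans Ik (ltry _).
apply: le_trans (nc_cintegral_le mD If) _; apply: le_trans Ik _.
by rewrite lee_fin mulrC divfK// gt_eqF.
Qed.

End bochner.

(** * Integrable families of rank-one operators *)

Section rank_one_algebra.
Variables (R : realType) (H : hilbertType R).
Implicit Types a b : H.

Lemma rank1_suml n (c : 'I_n -> R[i]) (a : 'I_n -> H) b :
  rank1 (\sum_i c i *: a i) b = \sum_i (c i)^*%C *: rank1 (a i) b.
Proof.
apply/funext => x; rewrite fct_sumE /rank1 ip_sumr scaler_suml.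
by apply: eq_bigr => i _; rewrite ipZr !fctE scalerA.
Qed.

Lemma rank1_sumr n (c : 'I_n -> R[i]) a (b : 'I_n -> H) :
  rank1 a (\sum_i c i *: b i) = \sum_i c i *: rank1 a (b i).
Proof.
apply/funext => x; rewrite fct_sumE /rank1 scaler_sumr.
by apply: eq_bigr => i _; rewrite !fctE !scalerA mulrC.
Qed.

Lemma rank1B a a' b b' :
  rank1 a b - rank1 a' b' = rank1 (a - a') b + rank1 a' (b - b').
Proof.
apply/funext => x; rewrite !fctE /rank1 ipBr scalerBl scalerBr.
by rewrite addrA subrK.
Qed.

End rank_one_algebra.

Section weakly_measurable.
Context d (T : measurableType d) (R : realType) (H : hilbertType R).
Variables (mu : {measure set T -> \bar R}) (D : set T) (mD : measurable D).
Variables (e : nat -> H) (onb_e : is_onb e).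
Implicit Types a b : T -> H.

Definition weakly_measurable a :=
  forall k, cmeasurable D (fun x => ip (a x) (e k)).

Let P n (y : H) := \sum_(i < n) ip y (e i) *: e i.

(** By Pythagoras' theorem the distance of [a x] to its projection depends only
    on the norm and on finitely many coefficients of [a x]. *)
Lemma measurable_residual a (alpha : R) n :
  (forall x, D x -> hnorm (a x) = alpha) -> weakly_measurable a ->
  measurable_fun D (fun x => hnorm (a x - P n (a x))).
Proof.
move=> aa ma.
apply: (eq_measurable_fun (fun x => Num.sqrt (alpha ^+ 2 -
    \sum_(i < n) nc (ip (a x) (e i)) ^+ 2))) => [x /set_mem Dx|].
  by rewrite -(aa x Dx) -onb_residual// sqrtr_sqr ger0_norm.
apply: (measurableT_comp (f := @Num.sqrt R)).
  exact: continuous_measurable_fun (@sqrt_continuous R).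
apply: measurable_funB; first exact: measurable_cst.
apply: measurable_sum => i; apply: measurable_funX.
exact: measurable_nc.
Qed.

(** A finite combination of fixed rank-one operators with integrable
    coefficients. *)
Lemma approximable_rank1_proj (f : T -> R[i]) a b (alpha beta : R) n :
  0 <= alpha -> 0 <= beta -> cintegrable mu D f ->
  (forall x, D x -> hnorm (a x) = alpha) -> weakly_measurable a ->
  (forall x, D x -> hnorm (b x) = beta) -> weakly_measurable b ->
  approximable mu D (fun x => f x *: rank1 (P n (a x)) (P n (b x))).
Proof.
move=> alpha0 beta0 If aa ma bb mb; have [mf fI] := If.
pose c i j x := f x * ((ip (a x) (e i))^*%C * ip (b x) (e j)).
have cI i j : cintegrable mu D (c i j).
  have e1 k : hnorm (e k) = 1.
    apply/eqP; rewrite -(eqrXn2 (n := 2))// expr1n -Re_ip_sqr.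
    by rewrite (proj1 onb_e) eqxx.
  apply: (le_cintegrable mD (h := fun x => (alpha * beta)%:E * (nc (f x))%:E)%E).
  - by apply: cmeasurableM => //; apply: cmeasurableM => //; exact: cmeasurableJ.
  - by apply: measurable_funeM; apply/measurable_EFinP; exact: measurable_nc.
  - move=> x Dx; rewrite -EFinM lee_fin !Normc.normcM ncJ mulrC ler_wpM2r//.
    apply: ler_pM => //.
      by have := cauchy_schwarz (a x) (e i); rewrite e1 mulr1 aa.
    by have := cauchy_schwarz (b x) (e j); rewrite e1 mulr1 bb.
  - rewrite ge0_integralZl//.
    + by rewrite lte_mul_pinfty// lee_fin mulr_ge0.
    + by apply/measurable_EFinP; exact: measurable_nc.
    + by move=> y _; rewrite lee_fin.
    + by rewrite lee_fin mulr_ge0.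
apply: (@eq_approximable _ _ _ _ mu D
  (fun x => \sum_(i < n) \sum_(j < n) c i j x *: rank1 (e i) (e j))) => [x _|].
  rewrite /P rank1_suml scaler_sumr; apply: eq_bigr => i _.
  rewrite rank1_sumr scaler_sumr scaler_sumr; apply: eq_bigr => j _.
  by rewrite !scalerA /c mulrA.
apply: approximable_sum => // i; apply: approximable_sum => // j.
by apply: approximable_cscale => //; exact: tclass_rank1.
Qed.

(** The projections of [a x] and [b x] on the first basis vectors converge, and
    the constant norms provide a dominating function. *)
Lemma approximable_rank1 (f : T -> R[i]) a b (alpha beta : R) :
  0 <= alpha -> 0 <= beta -> cintegrable mu D f ->
  (forall x, D x -> hnorm (a x) = alpha) -> weakly_measurable a ->
  (forall x, D x -> hnorm (b x) = beta) -> weakly_measurable b ->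
  approximable mu D (fun x => f x *: rank1 (a x) (b x)).
Proof.
move=> alpha0 beta0 If aa ma bb mb; have [mf fI] := If.
pose h n x := nc (f x) * (hnorm (a x - P n (a x)) * beta
                          + alpha * hnorm (b x - P n (b x))).
have mh n : measurable_fun D (h n).
  apply: measurable_funM; first exact: measurable_nc.
  apply: measurable_funD; apply: measurable_funM; try exact: measurable_cst.
    exact: measurable_residual aa ma.
  exact: measurable_residual bb mb.
have res_le (y : H) n : hnorm (y - P n y) <= 2 * hnorm y.
  apply: le_trans (hnormB _ _) _; rewrite mulr_natl mulr2n lerD//.
  exact: hnorm_proj_le.
have h0 n x : 0 <= h n x by rewrite mulr_ge0// addr_ge0// mulr_ge0.
have hcvg0 x : h n x @[n --> \oo] --> 0.
  have res0 (y : H) : hnorm (y - P n y) @[n --> \oo] --> 0.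
    apply/cvgrPdist_le => r r0; have [N NP] := onb_expansion onb_e y r0.
    by exists N => // n /= Nn; rewrite sub0r normrN ger0_norm// hnormBC; exact: NP.
  rewrite -[X in _ --> X](mulr0 (nc (f x))); apply: cvgM; first exact: cvg_cst.
  rewrite -[X in _ --> X]addr0; apply: cvgD.
    rewrite -[X in _ --> X](mul0r beta); apply: cvgM => //; exact: cvg_cst.
  rewrite -[X in _ --> X](mulr0 alpha); apply: cvgM => //; exact: cvg_cst.
have h_int : (\int[mu]_(x in D) (h n x)%:E)%E @[n --> \oo] --> 0%E.
  rewrite -[X in _ --> X](integral0 mu D).
  have [] := @dominated_convergence _ _ _ mu D mD (fun n x => (h n x)%:E) (cst 0%E)
    (fun x => (4 * alpha * beta)%:E * (nc (f x))%:E)%E => //.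
  - by move=> n; exact/measurable_EFinP.
  - apply: aeW => x Dx; apply/fine_cvgP; split; [exact: nearW|exact: hcvg0].
  - by apply: integrableZl => //; exact: cintegrable_nc.
  - apply: aeW => x n Dx; rewrite /= ger0_norm// -EFinM lee_fin /h mulrC.
    rewrite ler_wpM2r//; have := res_le (a x) n; have := res_le (b x) n.
    rewrite aa// bb//; move: (hnorm _) (hnorm _) => u v; nra.
apply: approximable_close => // r r0.
have [N _ /(_ N (leqnn _)) NP] := cvge_fin_le h_int r0.
exists (fun x => f x *: rank1 (P N (a x)) (P N (b x))), (h N); split => //.
  exact: (approximable_rank1_proj _ alpha0 beta0).
move=> x Dx; rewrite -scalerBr rank1B; apply: trace_boundZ.
apply: trace_boundD.
  by rewrite -(bb x Dx); exact: trace_bound_rank1.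
apply: trace_bound_le (trace_bound_rank1 _ _).
by rewrite -(aa x Dx) ler_wpM2r//; exact: hnorm_proj_le.
Qed.

End weakly_measurable.

(** * Invariance of the Haar measures *)

Section haar.
Variable R : realType.
Local Notation D := (half_line R).
Local Notation mu := (half_haar R).
Local Notation leb := (@lebesgue_measure R).
Local Notation mR := (measurableTypeR R).

Definition dil (a : R) : mR -> mR := fun r => (a * r : R).
Definition trans (c : R) : mR -> mR := fun r => (c + r : R).

Lemma measurable_dil a : measurable_fun setT (dil a).
Proof. exact: measurable_funM. Qed.

Lemma measurable_trans c : measurable_fun setT (trans c).
Proof. exact: measurable_funD. Qed.

Lemma dil_half_line (a : R) : 0 < a -> dil a @^-1` D = D.
Proof.
move=> a0; apply/seteqP; split => r /=; rewrite /preimage /= !half_lineP /dil;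
  by rewrite pmulr_rgt0.
Qed.

HB.instance Definition _ a := isMeasurableFun.Build _ _ _ _ (dil a) (measurable_dil a).
HB.instance Definition _ c := isMeasurableFun.Build _ _ _ _ (trans c) (measurable_trans c).

Lemma lebesgue_trans (c : R) (A : set mR) : measurable A ->
  pushforward leb (trans c) A = leb A.
Proof.
move=> mA; apply/esym/lebesgue_measure_unique => //= _ [[s t]] _ <-.
rewrite /pushforward.
have -> : trans c @^-1` `]s, t] = `]s - c, t - c]%classic.
  by apply/seteqP; split => r /=; rewrite !in_itv /= /trans ltrBlDl lerBrDl.
by rewrite !lebesgue_measure_itv/= !lte_fin ltrD2r; case: ifP => // _;
  rewrite -!EFinB; congr EFin; ring.
Qed.

Lemma lebesgue_dil (a : R) (A : set mR) : 0 < a -> measurable A ->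
  (a%:E * pushforward leb (dil a) A = leb A)%E.
Proof.
move=> a0 mA; pose na : {nonneg R} := NngNum (ltW a0).
apply/esym/(@lebesgue_measure_unique _ (mscale na (pushforward leb (dil a)))) => //.
move=> _ [[s t]] _ <-; rewrite /= /mscale /= /pushforward.
have -> : dil a @^-1` `]s, t] = `]s / a, t / a]%classic.
  apply/seteqP; split => r /=; rewrite !in_itv /= /dil;
    by rewrite ltr_pdivrMr// ler_pdivlMr// mulrC.
rewrite !lebesgue_measure_itv/= !lte_fin ltr_pM2r ?invr_gt0//.
case: ifP => // _; last by rewrite mule0.
by rewrite -!EFinB -EFinM; congr EFin; field; rewrite gt_eqF.
Qed.

(** The density [1 / r] compensates the factor by which dilations change the
    Lebesgue measure. *)
Lemma half_haar_dil (a : R) (E : set mR) : 0 < a -> measurable E ->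
  pushforward mu (dil a) E = mu E.
Proof.
move=> a0 mE; rewrite /pushforward /= /half_haar.
have mED : measurable (E `&` D) by apply: measurableI => //; exact: measurable_half_line.
have -> : dil a @^-1` E `&` D = dil a @^-1` (E `&` D).
  by rewrite preimage_setI dil_half_line.
have mV : measurable_fun (E `&` D) (fun r : mR => (r^-1)%:E).
  apply: measurable_funS (@measurable_half_line_inv R) => //.
  exact: measurable_half_line.
pose na : {nonneg R} := NngNum (ltW a0).
transitivity (\int[pushforward leb (dil a)]_(r in E `&` D) (a%:E * (r^-1)%:E))%E.
  rewrite (ge0_integral_pushforward (measurable_dil a))//; last 2 first.
  - exact: measurable_funeM.
  - move=> r /set_mem[_ Dr].
    by apply: mule_ge0; [rewrite lee_fin ltW|exact: half_line_inv_ge0].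
  apply: eq_integral => r; rewrite inE /= => -[_]; rewrite half_lineP /dil => ar.
  have r0 : 0 < r by rewrite -(pmulr_rgt0 _ a0).
  by rewrite -EFinM; congr EFin; field; rewrite !gt_eqF.
rewrite ge0_integralZl//; last 2 first.
- by move=> r [_]; exact: half_line_inv_ge0.
- by rewrite lee_fin ltW.
rewrite -(ge0_integral_mscale _ _ na)//; last first.
  by move=> r [_]; exact: half_line_inv_ge0.
apply: eq_measure_integral => B mB _; exact: lebesgue_dil.
Qed.

Lemma ge0_integral_dil (a : R) (f : R -> \bar R) : 0 < a ->
  measurable_fun D f -> (forall r, D r -> (0 <= f r)%E) ->
  (\int[mu]_(r in D) f (a * r)%R = \int[mu]_(r in D) f r)%E.
Proof.
move=> a0 mf f0; have mD := measurable_half_line R.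
transitivity (\int[pushforward mu (dil a)]_(r in D) f r)%E.
  rewrite (ge0_integral_pushforward (measurable_dil a))//.
    by rewrite dil_half_line.
  by move=> r /set_mem; exact: f0.
by apply: eq_measure_integral => B mB _; exact: half_haar_dil.
Qed.

Lemma ae_dil (a : R) (P : mR -> Prop) : 0 < a ->
  {ae mu, forall r, P r} -> {ae mu, forall r, P (dil a r)}.
Proof.
move=> a0 [A [mA A0 PA]]; exists (dil a @^-1` A); split.
- by rewrite -[_ @^-1` _]setTI; exact: measurable_dil.
- by have := half_haar_dil a0 mA; rewrite A0.
- by move=> r Pr; apply: PA.
Qed.

(** Right multiplication [(x, a) (y, b) = (a y + x, a b)] translates the first
    coordinate, for fixed [a], and dilates the second one. *)
Lemma ge0_integral_aff_mul (q : plane R) (h : plane R -> \bar R) : 0 < q.2 ->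
  measurable_fun setT h -> (forall p, (0 <= h p)%E) ->
  (\int[aff_haar R]_p h (aff_mul p q) = \int[aff_haar R]_p h p)%E.
Proof.
move=> q0 mh h0.
have m1 : measurable_fun setT (@fst mR mR) by exact: measurable_fst.
have m2 : measurable_fun setT (@snd mR mR) by exact: measurable_snd.
have mm : measurable_fun setT (fun p : plane R => aff_mul p q).
  apply/measurable_fun_pairP; split => /=.
    by apply: measurable_funD => //; apply: measurable_funM.
  exact: measurable_funM.
rewrite (fubini_tonelli2 (fun p => h (aff_mul p q)))//; last exact: measurableT_comp.
rewrite [RHS](fubini_tonelli2 h)//; rewrite /fubini_G.
pose G (y : R) := (\int[leb]_x h (x, y))%E.
have mG : measurable_fun setT (G : mR -> _) by exact: measurable_fun_fubini_tonelli_G.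
transitivity (\int[mu]_y G (dil q.2 y))%E.
  apply: eq_integral => y _; rewrite /aff_mul /=.
  transitivity (\int[pushforward leb (trans (y * q.1))]_x h (x, (y * q.2)%R))%E.
    rewrite (ge0_integral_pushforward (measurable_trans _))//.
    exact: measurableT_comp.
  rewrite /G /dil [q.2 * y]mulrC.
  by apply: eq_measure_integral => B mB _; exact: lebesgue_trans.
transitivity (\int[pushforward mu (dil q.2)]_y G y)%E.
  rewrite (ge0_integral_pushforward (measurable_dil _))//.
  by move=> y _; exact: integral_ge0.
by apply: eq_measure_integral => B mB _; exact: half_haar_dil.
Qed.

End haar.

(** * The unitary representation of the affine group *)

Section isometries.
Variables (R : realType) (H : preHilbertType R) (A : H -> H).
Hypotheses (linA : linear A) (isoA : forall u, hnorm (A u) = hnorm u).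

(** Polarisation. *)
Lemma isometry_ip u v : ip (A u) (A v) = ip u v.
Proof.
have Re_eq x y : Re (ip (A x) (A y)) = Re (ip x y).
  have := hnorm_sqrD (A x) (A y); rewrite -(linear_mapD linA) !isoA hnorm_sqrD; lra.
apply: complex_ext => //; have := Re_eq ('i%C *: u) v.
rewrite (linear_mapZ linA) !ipZl !ReM /= !mul0r !mul1r !sub0r; exact: oppr_inj.
Qed.

End isometries.

Section representation.
Variable R : realType.
Local Notation D := (half_line R).
Local Notation mu := (half_haar R).
Local Notation mR := (measurableTypeR R).
Implicit Types (u v : L2 R) (x y a b : R).

Lemma nc_expi (t : R) : nc (expi t) = 1.
Proof. by rewrite /expi /= cos2Dsin2 sqrtr1. Qed.

Lemma expiD (s t : R) : expi (s + t) = expi s * expi t.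
Proof.
by rewrite /expi cosD sinD; apply: complex_ext; rewrite ?ReM ?ImM /= // addrC.
Qed.

Lemma expi0 : expi 0 = 1 :> R[i].
Proof. by rewrite /expi cos0 sin0. Qed.

Definition rep_fun x a u : R -> R[i] :=
  fun r => expi (2 * pi * x * r) * L2_fun u (a * r).

Lemma cmeasurable_expi d (T : measurableType d) (E : set T) (f : T -> R) :
  measurable_fun E f -> cmeasurable E (fun t => expi (f t)).
Proof.
move=> mf; split => /=.
  apply: measurableT_comp => //; exact: continuous_measurable_fun (@continuous_cos R).
apply: measurableT_comp => //; exact: continuous_measurable_fun (@continuous_sin R).
Qed.

Lemma sq_integrable_rep x a u : 0 < a -> sq_integrable (rep_fun x a u).
Proof.
move=> a0; have [[mr mi] Iu] := L2_funP u; have mD := measurable_half_line R.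
have mdil (f : mR -> R) : measurable_fun D f -> measurable_fun D (fun r => f (dil a r)).
  move=> mf; apply: (measurable_comp (F := D)) => //.
    by move=> _ [r Dr <-]; rewrite -[D (dil a r)]/((dil a @^-1` D) r) dil_half_line.
  exact: measurable_funS (measurable_dil a).
split.
  apply: cmeasurableM; last first.
    by split; [exact: (mdil _ mr)|exact: (mdil _ mi)].
  apply: cmeasurable_expi; exact: measurable_funM.
under eq_integral do rewrite Normc.normcM nc_expi mul1r.
rewrite (ge0_integral_dil (f := fun r => (nc (L2_fun u r) ^+ 2)%:E))//.
  exact: measurable_normc_sqr.
by move=> r _; rewrite lee_fin sqr_ge0.
Qed.

Lemma aff_repE x a u : 0 < a -> ae_half_line (L2_fun (aff_rep x a u)) (rep_fun x a u).
Proof. by move=> a0; apply: L2_classK; exact: sq_integrable_rep. Qed.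

Lemma ae_half_line_dil a (f g : R -> R[i]) : 0 < a -> ae_half_line f g ->
  ae_half_line (fun r => f (a * r)) (fun r => g (a * r)).
Proof.
move=> a0 fg; apply: filterS (@ae_dil R a _ a0 fg) => r h Dr; apply: h.
by move: Dr; rewrite !half_lineP => r0; rewrite mulr_gt0.
Qed.

Lemma hnorm_aff_rep x a u : 0 < a -> hnorm (aff_rep x a u) = hnorm u.
Proof.
move=> a0; have mD := measurable_half_line R.
apply/eqP; rewrite -(eqrXn2 (n := 2))//; apply/eqP; apply: EFin_inj.
rewrite [LHS]L2_norm_sqr_int [RHS]L2_norm_sqr_int.
have [mu' _] := L2_funP u.
rewrite -(ge0_integral_dil a0 (f := fun r => (nc (L2_fun u r) ^+ 2)%:E))//; last first.
- by move=> r _; rewrite lee_fin sqr_ge0.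
- exact: measurable_normc_sqr.
apply: ge0_ae_eq_integral => //.
- by apply: measurable_normc_sqr; exact: cmeasurable_L2_fun.
- have -> : (fun r => (nc (L2_fun u (a * r)) ^+ 2)%:E) =
      (fun r => (nc (rep_fun 0 a u r) ^+ 2)%:E).
    by apply/funext => r; rewrite /rep_fun Normc.normcM nc_expi mul1r.
  by apply: measurable_normc_sqr; have [] := sq_integrable_rep 0 u a0.
- by move=> r _; rewrite lee_fin sqr_ge0.
- by move=> r _; rewrite lee_fin sqr_ge0.
apply: filterS (aff_repE x u a0) => r h Dr.
by rewrite h// /rep_fun Normc.normcM nc_expi mul1r.
Qed.

Lemma linear_aff_rep x a : 0 < a -> linear (aff_rep x a : L2 R -> L2 R).
Proof.
move=> a0 c u v; apply: L2_eq; near=> r => Dr.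
rewrite (near (aff_repE x (c *: u + v) a0) r)//.
rewrite (near (L2_addE (c *: aff_rep x a u) (aff_rep x a v)) r)//.
rewrite (near (L2_scaleE c (aff_rep x a u)) r)//.
rewrite (near (aff_repE x u a0) r)// (near (aff_repE x v a0) r)//.
rewrite /rep_fun (near (ae_half_line_dil a0 (L2_addE (c *: u) v)) r)//.
rewrite (near (ae_half_line_dil a0 (L2_scaleE c u)) r)//.
by rewrite mulrDr mulrCA.
Unshelve. all: by end_near. Qed.

Lemma aff_rep_comp x y a b u : 0 < a -> 0 < b ->
  aff_rep x a (aff_rep y b u) = aff_rep (x + a * y) (a * b) u.
Proof.
move=> a0 b0; apply: L2_eq; have ab0 : 0 < a * b by rewrite mulr_gt0.
near=> r => Dr.
rewrite (near (aff_repE x (aff_rep y b u) a0) r)//.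
rewrite (near (aff_repE (x + a * y) u ab0) r)//.
rewrite /rep_fun (near (ae_half_line_dil a0 (aff_repE y u b0)) r)//.
rewrite /rep_fun mulrA -expiD; congr (expi _ * L2_fun u _); ring.
Unshelve. all: by end_near. Qed.

Lemma aff_rep1 u : aff_rep 0 1 u = u.
Proof.
apply: L2_eq; apply: filterS (aff_repE 0 u ltr01) => r h Dr.
by rewrite h// /rep_fun mulr0 mul0r expi0 !mul1r.
Qed.

(** The sign makes [W] a homomorphism for [aff_mul]. *)
Definition W (p : plane R) : L2 R -> L2 R := aff_rep (- p.1 : R) p.2.

Lemma aff_mul_gt0 (p q : plane R) : aff R p -> aff R q -> aff R (aff_mul p q).
Proof. by rewrite /aff /=; exact: mulr_gt0. Qed.

Lemma aff_inv_gt0 (p : plane R) : aff R p -> aff R (aff_inv p).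
Proof. by rewrite /aff /= invr_gt0. Qed.

Lemma W_mul (p q : plane R) u : aff R p -> aff R q ->
  W p (W q u) = W (aff_mul p q) u.
Proof.
move=> p0 q0; rewrite /W aff_rep_comp//; congr (aff_rep _ _ u) => /=; ring.
Qed.

Lemma WVK (p : plane R) : aff R p -> cancel (W (aff_inv p)) (W p).
Proof.
move=> p0 u; rewrite W_mul//; last exact: aff_inv_gt0.
have pn0 : (p.2 : R) != 0 by rewrite gt_eqF.
rewrite /W /aff_mul /aff_inv /= mulfV// mulrN mulrC divfK// addNr oppr0.
exact: aff_rep1.
Qed.

Lemma hnorm_W (p : plane R) u : aff R p -> hnorm (W p u) = hnorm u.
Proof. by move=> p0; exact: hnorm_aff_rep. Qed.

Lemma linear_W (p : plane R) : aff R p -> linear (W p).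
Proof. by move=> p0; exact: linear_aff_rep. Qed.

Lemma bounded_W (p : plane R) : aff R p -> bounded (W p).
Proof.
by move=> p0; split; [exact: linear_W|exists 1 => u; rewrite mul1r hnorm_W].
Qed.

Lemma W_adjoint (p : plane R) u v : aff R p ->
  ip (W p u) v = ip u (W (aff_inv p) v).
Proof.
move=> p0; rewrite -[in LHS](WVK p0 v) isometry_ip//; first exact: linear_W.
by move=> w; exact: hnorm_W.
Qed.

(** The inner products determine [adjoint A], so it agrees with every operator
    that satisfies its defining property. *)
Lemma adjoint_eq (A B : L2 R -> L2 R) :
  (forall u v, ip (A u) v = ip u (B v)) -> adjoint A = B.
Proof.
move=> AB; apply/funext => v; apply: ip_inj => u.
have AA : forall u v, ip (A u) v = ip u (adjoint A v).
  have : exists C : L2 R -> L2 R,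
    [set C | forall u v, inner (A u) v = inner u (C v)] C by exists B.
  by move/(xgetPex 0).
by rewrite ipC -AA AB -ipC.
Qed.

Lemma aff_shiftE (p : plane R) (A : L2 R -> L2 R) : aff R p ->
  aff_shift p A = W (aff_inv p) \o A \o W p.
Proof.
by move=> p0; rewrite /aff_shift (@adjoint_eq _ (W (aff_inv p)))// => u v;
  rewrite W_adjoint.
Qed.

End representation.

(** * Fubini's theorem for complex functions *)

Section zero_extension.
Context d (T : measurableType d) (R : realType).
Variables (mu : {measure set T -> \bar R}) (E : set T) (mE : measurable E).
Implicit Types f : T -> R[i].

(** Fubini's theorem concerns the whole product space, so functions on a subset
    are extended by 0. *)
Definition zext f : T -> R[i] := fun x => if x \in E then f x else 0.

Lemma zextE f x : E x -> zext f x = f x.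
Proof. by move=> Ex; rewrite /zext mem_set. Qed.

Lemma zext_out f x : ~ E x -> zext f x = 0.
Proof. by move=> Ex; rewrite /zext memNset. Qed.

Let zextRe f : (fun x => Re (zext f x)) = (fun x => Re (f x)) \_ E.
Proof. by apply/funext => x; rewrite /zext /patch; case: ifP. Qed.

Let zextIm f : (fun x => Im (zext f x)) = (fun x => Im (f x)) \_ E.
Proof. by apply/funext => x; rewrite /zext /patch; case: ifP. Qed.

Lemma cmeasurable_zext f : cmeasurable E f -> cmeasurable setT (zext f).
Proof.
move=> [fr fi]; split; [rewrite zextRe|rewrite zextIm];
  by apply/(measurable_restrictT _ mE).1.
Qed.

Lemma cintegral_zext f : cintegral mu E f = cintegral mu setT (zext f).
Proof.
by apply: complex_ext; rewrite /= Rintegral_mkcond ?zextRe ?zextIm.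
Qed.

Lemma integral_nc_zext f :
  (\int[mu]_(x in E) (nc (f x))%:E = \int[mu]_x (nc (zext f x))%:E)%E.
Proof.
rewrite integral_mkcond; apply: eq_integral => x _.
by rewrite /zext /patch; case: ifP => // _; rewrite Normc.normc0.
Qed.

End zero_extension.

Section complex_integral_bound.
Context d (T : measurableType d) (R : realType).
Variables (mu : {measure set T -> \bar R}) (E : set T) (mE : measurable E).

(** If the right-hand side is infinite there is nothing to prove; otherwise [f]
    is integrable. *)
Lemma nc_cintegral_le_meas (f : T -> R[i]) : cmeasurable E f ->
  ((nc (cintegral mu E f))%:E <= \int[mu]_(x in E) (nc (f x))%:E)%E.
Proof.
move=> mf.
have [If|] := ltP (\int[mu]_(x in E) (nc (f x))%:E)%E +oo%E.
  exact: nc_cintegral_le.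
by rewrite leye_eq => /eqP->; rewrite leey.
Qed.

End complex_integral_bound.

Section cmeasurable_composition.
Context d1 d2 (T1 : measurableType d1) (T2 : measurableType d2) (R : realType).

Lemma cmeasurable_comp (f : T2 -> R[i]) (g : T1 -> T2) :
  cmeasurable setT f -> measurable_fun setT g -> cmeasurable setT (f \o g).
Proof.
by move=> [fr fi] mg; split;
  [exact: (measurableT_comp fr mg)|exact: (measurableT_comp fi mg)].
Qed.

Lemma cmeasurableS (E F : set T1) (f : T1 -> R[i]) : measurable F ->
  E `<=` F -> cmeasurable F f -> cmeasurable E f.
Proof.
by move=> mF EF [fr fi]; split; [exact: measurable_funS fr|exact: measurable_funS fi].
Qed.

End cmeasurable_composition.

Section complex_fubini.
Context d1 d2 (T1 : measurableType d1) (T2 : measurableType d2) (R : realType).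
Variables (m1 : {sigma_finite_measure set T1 -> \bar R})
  (m2 : {sigma_finite_measure set T2 -> \bar R}).
Implicit Types (f : T1 * T2 -> R) (k : T1 * T2 -> R[i]).

Lemma measurable_Rintegral1 f : measurable_fun setT f ->
  measurable_fun setT (fun x => \int[m2]_y f (x, y)).
Proof.
move=> mf; apply: (measurableT_comp (@fine_measurable _ _ measurableT)).
have mF : measurable_fun setT (EFin \o f) by exact/measurable_EFinP.
have -> : (fun x => \int[m2]_y (f (x, y))%:E)%E =
    (fun x => \int[m2]_y (EFin \o f)^\+ (x, y) - \int[m2]_y (EFin \o f)^\- (x, y))%E.
  apply/funext => x; rewrite [LHS]integralE.
  by congr (_ - _)%E; apply: eq_integral => y _; rewrite ?funeposE ?funenegE.
apply: emeasurable_funB.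
  by apply: measurable_fun_fubini_tonelli_F => //; exact: measurable_funepos.
by apply: measurable_fun_fubini_tonelli_F => //; exact: measurable_funeneg.
Qed.

Lemma cmeasurable_cintegral1 k : cmeasurable setT k ->
  cmeasurable setT (fun x => cintegral m2 setT (fun y => k (x, y))).
Proof.
by move=> [kr ki]; split;
  [exact: (measurable_Rintegral1 kr)|exact: (measurable_Rintegral1 ki)].
Qed.

Lemma Rintegral_fubini12 f : (m1 \x m2)%E.-integrable setT (EFin \o f) ->
  \int[m1]_x \int[m2]_y f (x, y) = \int[(m1 \x m2)%E]_z f z.
Proof.
move=> If; rewrite [RHS]/Rintegral -(integral12_prod_meas1 If).
congr fine; apply: ae_eq_integral => //.
- apply/measurable_EFinP; apply: measurable_Rintegral1.
  by apply/measurable_EFinP; exact: measurable_int If.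
- exact: (measurable_fubini_F If).
apply: filterS (ae_integrable1 If) => x Ix _.
by rewrite /Rintegral fineK//; exact: integrable_fin_num.
Qed.

Lemma measurable_Rintegral2 f : measurable_fun setT f ->
  measurable_fun setT (fun y => \int[m1]_x f (x, y)).
Proof.
move=> mf; apply: (measurableT_comp (@fine_measurable _ _ measurableT)).
have mF : measurable_fun setT (EFin \o f) by exact/measurable_EFinP.
have -> : (fun y => \int[m1]_x (f (x, y))%:E)%E =
    (fun y => \int[m1]_x (EFin \o f)^\+ (x, y) - \int[m1]_x (EFin \o f)^\- (x, y))%E.
  apply/funext => y; rewrite [LHS]integralE.
  by congr (_ - _)%E; apply: eq_integral => x _; rewrite ?funeposE ?funenegE.
apply: emeasurable_funB.
  by apply: measurable_fun_fubini_tonelli_G => //; exact: measurable_funepos.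
by apply: measurable_fun_fubini_tonelli_G => //; exact: measurable_funeneg.
Qed.

Lemma cmeasurable_cintegral2 k : cmeasurable setT k ->
  cmeasurable setT (fun y => cintegral m1 setT (fun x => k (x, y))).
Proof.
by move=> [kr ki]; split;
  [exact: (measurable_Rintegral2 kr)|exact: (measurable_Rintegral2 ki)].
Qed.

Lemma Rintegral_fubini21 f : (m1 \x m2)%E.-integrable setT (EFin \o f) ->
  \int[m2]_y \int[m1]_x f (x, y) = \int[(m1 \x m2)%E]_z f z.
Proof.
move=> If; rewrite [RHS]/Rintegral -(integral21_prod_meas1 If).
congr fine; apply: ae_eq_integral => //.
- apply/measurable_EFinP; apply: measurable_Rintegral2.
  by apply/measurable_EFinP; exact: measurable_int If.
- exact: (measurable_fubini_G If).
apply: filterS (ae_integrable2 If) => y Iy _.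
by rewrite /Rintegral fineK//; exact: integrable_fin_num.
Qed.

Lemma cfubini k : cintegrable (m1 \x m2)%E setT k ->
  cintegral m1 setT (fun x => cintegral m2 setT (fun y => k (x, y))) =
  cintegral m2 setT (fun y => cintegral m1 setT (fun x => k (x, y))).
Proof.
move=> Ik; have Ir := cintegrableRe measurableT Ik.
have Ii := cintegrableIm measurableT Ik.
apply: complex_ext => /=.
  by rewrite (Rintegral_fubini12 Ir) (Rintegral_fubini21 Ir).
by rewrite (Rintegral_fubini12 Ii) (Rintegral_fubini21 Ii).
Qed.

Lemma ae_cintegrable2 k : cintegrable (m1 \x m2)%E setT k ->
  {ae m2, forall y, cintegrable m1 setT (fun x => k (x, y))}.
Proof.
move=> Ik; have In := cintegrable_nc Ik.
apply: filterS (ae_integrable2 In) => y Iy; split.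
  have [[kr ki] _] := Ik.
  by split; [exact: measurable_fun_pair1 kr|exact: measurable_fun_pair1 ki].
have [_] := integrableP _ _ _ Iy; apply: le_lt_trans; rewrite le_eqVlt.
by apply/orP; left; apply/eqP/eq_integral => x _; rewrite gee0_abs// lee_fin nc_ge0.
Qed.

End complex_fubini.

(** * Convolution and right-invariant measures *)

(** Only the right translations by elements of [A] matter: they are invertible
    and they preserve both [A] and [nu]. *)
Section measured_group.
Context d (T : measurableType d) (R : realType).
Variables (nu : {sigma_finite_measure set T -> \bar R}) (A : set T).
Variables (mul : T -> T -> T) (inv : T -> T).
Hypotheses (mA : measurable A)
  (mmul : measurable_fun setT (fun z : T * T => mul z.1 z.2))
  (minv : measurable_fun setT inv)
  (mulK : forall p q, A q -> mul (mul p q) (inv q) = p)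
  (mulA : forall p q, A q -> A (mul p q) <-> A p)
  (invA : forall q, A q -> A (inv q))
  (nu_mul : forall q (h : T -> \bar R), A q -> measurable_fun setT h ->
     (forall p, (0 <= h p)%E) -> (\int[nu]_p h (mul p q) = \int[nu]_p h p)%E).

Let mmulr q : measurable_fun setT (mul^~ q).
Proof. exact: measurable_fun_pair1 mmul. Qed.

Lemma cintegral_mul q (h : T -> R[i]) : A q -> cmeasurable setT h ->
  cintegral nu setT (fun p => h (mul p q)) = cintegral nu setT h.
Proof.
have real (u : T -> R) : A q -> measurable_fun setT u ->
    \int[nu]_p u (mul p q) = \int[nu]_p u p.
  move=> q0 mu; rewrite /Rintegral; congr fine.
  have mF : measurable_fun setT (EFin \o u) by exact/measurable_EFinP.
  rewrite integralE [RHS]integralE.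
  rewrite -(nu_mul q0 (measurable_funepos mF)); last exact: funepos_ge0.
  rewrite -(nu_mul q0 (measurable_funeneg mF)); last exact: funeneg_ge0.
  by congr (_ - _)%E; apply: eq_integral => p _; rewrite ?funeposE ?funenegE.
by move=> q0 [hr hi]; apply: complex_ext; [exact: (real _ q0 hr)|exact: (real _ q0 hi)].
Qed.

Variables f g : T -> R[i].
Hypotheses (If : cintegrable nu A f) (Ig : cintegrable nu A g).

Definition conv p := cintegral nu A (fun q => f q * g (mul p (inv q))).

Let k (z : T * T) := zext A f z.1 * zext A g (mul z.2 (inv z.1)).

Let mf : cmeasurable setT (zext A f).
Proof. by apply: cmeasurable_zext; case: If. Qed.

Let mg : cmeasurable setT (zext A g).
Proof. by apply: cmeasurable_zext; case: Ig. Qed.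

Let mk : cmeasurable setT k.
Proof.
apply: cmeasurableM; first exact: (cmeasurable_comp mf measurable_fst).
have mp : measurable_fun setT (fun z : T * T => (z.2, inv z.1)).
  by apply: measurable_fun_pair => //; exact: measurableT_comp.
exact: (cmeasurable_comp mg (measurableT_comp mmul mp)).
Qed.

(** Tonelli's theorem: integrate first in [p], where invariance replaces
    [p q^-1] by [p]. *)
Lemma conv_kernel_integrable : cintegrable (nu \x nu)%E setT k.
Proof.
split; first exact: mk.
have mnk : measurable_fun setT (fun z => (nc (k z))%:E).
  by apply/measurable_EFinP; exact: (measurable_nc mk).
have k0 z : (0 <= (nc (k z))%:E)%E by rewrite lee_fin nc_ge0.
have mng : measurable_fun setT (fun p => (nc (zext A g p))%:E).
  by apply/measurable_EFinP; exact: measurable_nc.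
have mnf : measurable_fun setT (fun p => (nc (zext A f p))%:E).
  by apply/measurable_EFinP; exact: measurable_nc.
have If' : (\int[nu]_p (nc (zext A f p))%:E < +oo)%E.
  by rewrite -integral_nc_zext; case: If.
have Ig' : (\int[nu]_p (nc (zext A g p))%:E < +oo)%E.
  by rewrite -integral_nc_zext; case: Ig.
rewrite (fubini_tonelli1 (fun z => (nc (k z))%:E))// /fubini_F /=.
pose G := (\int[nu]_p (nc (zext A g p))%:E)%E.
have G0 : (0 <= G)%E by apply: integral_ge0 => p _; rewrite lee_fin nc_ge0.
have -> : (\int[nu]_q \int[nu]_p (nc (k (q, p)))%:E)%E =
    (\int[nu]_q ((nc (zext A f q))%:E * G))%E.
  apply: eq_integral => q _; rewrite /k /=.
  have [q0|q0] := pselect (A q); last first.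
    rewrite zext_out// Normc.normc0 mul0e.
    by apply: integral0_eq => p _; rewrite mul0r Normc.normc0.
  under eq_integral do rewrite Normc.normcM EFinM.
  have mq : measurable_fun setT (fun p => mul p (inv q)).
    exact: mmulr.
  rewrite ge0_integralZl//; last 3 first.
  - exact: (measurableT_comp mng mq).
  - by move=> p _; rewrite lee_fin nc_ge0.
  - by rewrite lee_fin nc_ge0.
  rewrite (@nu_mul _ (fun p => (nc (zext A g p))%:E))//.
    exact: invA.
  by move=> p; rewrite lee_fin nc_ge0.
rewrite ge0_integralZr//; last by move=> p _; rewrite lee_fin nc_ge0.
rewrite lte_mul_pinfty//.
  by apply: integral_ge0 => p _; rewrite lee_fin nc_ge0.
by rewrite ge0_fin_numE// integral_ge0// => p _; rewrite lee_fin nc_ge0.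
Qed.

Lemma zext_conv p :
  zext A (conv) p = cintegral nu setT (fun q => k (q, p)).
Proof.
have [p0|p0] := pselect (A p).
  rewrite zextE// /conv cintegral_zext.
  apply: eq_cintegral => q _; rewrite /k /zext /=.
  case: ifPn => qA; last by rewrite mul0r.
  rewrite mem_set//; apply/mulA => //.
  by apply: invA; apply: set_mem.
rewrite zext_out//; transitivity (cintegral nu setT (fun=> 0 : R[i])).
  by rewrite cintegral0.
apply: eq_cintegral => q _; rewrite /k /=.
have [q0|q0] := pselect (A q); last by rewrite zext_out ?mul0r.
rewrite [X in _ * X]zext_out ?mulr0// mulA//; exact: invA.
Qed.

Lemma conv_integrable : cintegrable nu A (conv).
Proof.
have mC : cmeasurable setT (zext A (conv)).
  have -> : zext A (conv) =
      (fun p => cintegral nu setT (fun q => k (q, p))).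
    by apply/funext => p; rewrite zext_conv.
  exact: (cmeasurable_cintegral2 _ mk).
split.
  apply: (@eq_cmeasurable _ _ _ _ (zext A (conv))).
    by move=> p /set_mem pA; rewrite zextE.
  exact: cmeasurableS mC.
rewrite integral_nc_zext.
have [_] := conv_kernel_integrable; apply: le_lt_trans.
rewrite (fubini_tonelli2 (fun z => (nc (k z))%:E))//; last first.
- by move=> z; rewrite lee_fin nc_ge0.
- by apply/measurable_EFinP; exact: (measurable_nc mk).
apply: ge0_le_integral_nomeas => p _; first by rewrite lee_fin nc_ge0.
rewrite zext_conv; apply: nc_cintegral_le_meas => //.
have [kr ki] := mk.
by split; [exact: measurable_fun_pair1 kr|exact: measurable_fun_pair1 ki].
Qed.

(** Fubini's theorem, followed by the substitution of [p q] for [p]. *)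
Lemma conv_pairing (s : T -> R[i]) (M : R) : 0 <= M -> cmeasurable A s ->
  (forall p, A p -> nc (s p) <= M) ->
  cintegral nu A (fun p => conv p * s p) =
  cintegral nu A (fun q => f q * cintegral nu A (fun p => g p * s (mul p q))).
Proof.
move=> M0 ms sM.
have ms' : cmeasurable setT (zext A s) by exact: cmeasurable_zext.
have sM' p : nc (zext A s p) <= M.
  have [pA|pA] := pselect (A p); first by rewrite zextE// sM.
  by rewrite zext_out// Normc.normc0.
pose k' z := zext A s z.2 * k z.
have mk' : cmeasurable setT k'.
  apply: cmeasurableM mk; exact: (cmeasurable_comp ms' measurable_snd).
have Ik' : cintegrable (nu \x nu)%E setT k'.
  have [_ kfin] := conv_kernel_integrable.
  have mnk : measurable_fun setT (fun z => (nc (k z))%:E).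
    by apply/measurable_EFinP; exact: (measurable_nc mk).
  apply: (@le_cintegrable _ _ _ _ _ _ k' (fun z => M%:E * (nc (k z))%:E)%E) => //.
  - exact: measurable_funeM.
  - by move=> z _; rewrite /k' Normc.normcM -EFinM lee_fin ler_wpM2r ?nc_ge0.
  rewrite ge0_integralZl//; last by move=> z _; rewrite lee_fin nc_ge0.
  by rewrite lte_mul_pinfty// integral_ge0// => z _; rewrite lee_fin nc_ge0.
have msec2 (h : T * T -> R[i]) p : cmeasurable setT h ->
    cmeasurable setT (fun q => h (q, p)).
  by move=> [hr hi]; split; [exact: measurable_fun_pair1 hr|exact: measurable_fun_pair1 hi].
rewrite cintegral_zext [RHS]cintegral_zext.
transitivity (cintegral nu setT (fun p => cintegral nu setT (fun q => k' (q, p)))).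
  apply: ae_eq_cintegral => //.
  - apply: cmeasurable_zext; first exact: mA.
    by apply: cmeasurableM => //; case: conv_integrable.
  - exact: cmeasurable_cintegral2.
  apply: filterS (ae_cintegrable2 conv_kernel_integrable) => p Ip _.
  rewrite /k' /= (cintegralZ measurableT (zext A s p) Ip) -zext_conv.
  have [pA|pA] := pselect (A p); first by rewrite !zextE// mulrC.
  by rewrite !zext_out// mul0r.
rewrite -cfubini//; apply: eq_cintegral => q _.
have [qA|qA] := pselect (A q); last first.
  rewrite [RHS]zext_out// -[RHS](cintegral0 nu setT).
  by apply: eq_cintegral => p _; rewrite /k' /k /= [X in _ * (X * _)]zext_out// mul0r mulr0.
rewrite [RHS]zextE//.
pose h p := zext A g (mul p (inv q)) * zext A s p.
have mq (r : T) : measurable_fun setT (fun p => mul p r).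
  exact: mmulr.
have mgq : cmeasurable setT (fun p => zext A g (mul p (inv q))).
  exact: (cmeasurable_comp mg (mq _)).
have mh : cmeasurable setT h by exact: cmeasurableM.
have mngq : measurable_fun setT
    (fun p => (nc (zext A g (mul p (inv q))))%:E).
  by apply/measurable_EFinP; exact: measurable_nc.
have Ih : cintegrable nu setT h.
  apply: (@le_cintegrable _ _ _ _ _ _ h
    (fun p => M%:E * (nc (zext A g (mul p (inv q))))%:E)%E) => //.
  - exact: measurable_funeM.
  - by move=> p _; rewrite /h Normc.normcM mulrC -EFinM lee_fin ler_wpM2r ?nc_ge0.
  rewrite ge0_integralZl//; last by move=> z _; rewrite lee_fin nc_ge0.
  rewrite (@nu_mul _ (fun p => (nc (zext A g p))%:E)); last 3 first.
  - exact: invA.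
  - by apply/measurable_EFinP; exact: measurable_nc.
  - by move=> p; rewrite lee_fin nc_ge0.
  rewrite lte_mul_pinfty// ?lee_fin//.
  by rewrite -integral_nc_zext; case: Ig.
transitivity (f q * cintegral nu setT h).
  rewrite -cintegralZ//; apply: eq_cintegral => p _.
  by rewrite /k' /k /h /= (zextE _ qA) mulrCA [zext A s p * _]mulrC.
congr (_ * _); rewrite -(cintegral_mul qA mh) [RHS]cintegral_zext.
apply: eq_cintegral => p _; rewrite /h mulK//.
have [pA|pA] := pselect (A p); last by rewrite !(zext_out _ pA) mul0r.
by rewrite !zextE//; exact/mulA.
Qed.

End measured_group.

(** * Measurability on the affine group *)

Section affine_measurability.
Variable R : realType.
Local Notation A := (aff R).
Local Notation mR := (measurableTypeR R).

Lemma measurable_inv : measurable_fun setT (fun r : mR => r^-1 : mR).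
Proof.
have m0 : measurable ([set 0] : set mR) by exact: measurable_set1.
rewrite -(setUv [set 0]); apply/measurable_funU => //; first exact: measurableC.
split; first exact: measurable_fun_set1.
apply: open_continuous_measurable_fun.
  by apply: closed_openC; exact: (@closed_eq R 0).
by move=> r /set_mem /= r0; apply: inv_continuous; apply/eqP.
Qed.

Lemma measurable_aff : measurable A.
Proof.
have -> : A = snd @^-1` half_line R.
  by apply/seteqP; split => p; rewrite /= half_lineP.
rewrite -[_ @^-1` _]setTI; apply: measurable_snd => //.
exact: measurable_half_line.
Qed.

Lemma measurable_aff_mul d (T : measurableType d) (f g : T -> plane R) :
  measurable_fun setT f -> measurable_fun setT g ->
  measurable_fun setT (fun x => aff_mul (f x) (g x)).
Proof.
move=> /measurable_fun_pairP[f1 f2] /measurable_fun_pairP[g1 g2].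
apply/measurable_fun_pairP; split => /=.
  by apply: measurable_funD => //; exact: measurable_funM.
exact: measurable_funM.
Qed.

Lemma measurable_aff_inv d (T : measurableType d) (f : T -> plane R) :
  measurable_fun setT f -> measurable_fun setT (fun x => aff_inv (f x)).
Proof.
move=> /measurable_fun_pairP[f1 f2].
have mi : measurable_fun setT (fun x => (f x).2^-1 : mR).
  exact: (measurableT_comp measurable_inv f2).
apply/measurable_fun_pairP; split => //=.
exact: measurableT_comp (measurable_funM f1 mi).
Qed.

Lemma aff_mulK (p q : plane R) : A q -> aff_mul (aff_mul p q) (aff_inv q) = p.
Proof.
move=> q0; have qn0 : (q.2 : R) != 0 by rewrite gt_eqF.
case: p => x a; rewrite /aff_mul /aff_inv /=; congr pair; by field.
Qed.

Lemma aff_mul_affE (p q : plane R) : A q -> A (aff_mul p q) = A p.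
Proof. by move=> q0; rewrite /aff /= pmulr_lgt0. Qed.

End affine_measurability.

(** * Measurability of the matrix coefficients *)

Section limits.
Context d (T : measurableType d) (R : realType) (E : set T) (mE : measurable E).

Lemma cmeasurable_cvg (f : nat -> T -> R[i]) (g : T -> R[i]) :
  (forall n, cmeasurable E (f n)) -> (forall x, E x -> ccvg (f^~ x) (g x)) ->
  cmeasurable E g.
Proof.
move=> mf fg; split.
  apply: (measurable_fun_cvg (h := fun n x => Re (f n x))) => [n|x Ex].
    by case: (mf n).
  by have [] := fg x Ex.
apply: (measurable_fun_cvg (h := fun n x => Im (f n x))) => [n|x Ex].
  by case: (mf n).
by have [] := fg x Ex.
Qed.

End limits.

Section matrix_coefficients.
Variable R : realType.
Local Notation A := (aff R).
Local Notation nu := (aff_haar R).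
Local Notation D := (half_line R).
Local Notation mR := (measurableTypeR R).
Implicit Types (u v : L2 R) (p q : plane R) (S T : L2 R -> L2 R).

(** The coefficient is an integral over [r] of a jointly measurable function of
    [p] and [r], on which Fubini's theorem gives measurability in [p]. *)
Lemma cmeasurable_coef u v : cmeasurable A (fun p => ip (W p u) v).
Proof.
pose k (z : plane R * mR) : R[i] :=
  expi (2 * pi * (- z.1.1) * z.2) * zext D (L2_fun u) (z.1.2 * z.2) *
  (zext D (L2_fun v) z.2)^*%C.
have mz w : cmeasurable setT (zext D (L2_fun w)).
  apply: cmeasurable_zext; first exact: measurable_half_line.
  exact: cmeasurable_L2_fun.
have m1 : measurable_fun setT (fun z : plane R * mR => z.1) by exact: measurable_fst.
have m2 : measurable_fun setT (fun z : plane R * mR => z.2) by exact: measurable_snd.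
have m11 : measurable_fun setT (fun z : plane R * mR => z.1.1).
  exact: measurableT_comp measurable_fst m1.
have m12 : measurable_fun setT (fun z : plane R * mR => z.1.2).
  exact: measurableT_comp measurable_snd m1.
have mk : cmeasurable setT k.
  apply: cmeasurableM; last exact: (cmeasurableJ (cmeasurable_comp (mz v) m2)).
  apply: cmeasurableM; last exact: (cmeasurable_comp (mz u) (measurable_funM m12 m2)).
  apply: cmeasurable_expi; apply: measurable_funM => //.
  by apply: measurable_funM => //; exact: measurableT_comp.
apply: (@eq_cmeasurable _ _ _ _ (fun p => cintegral (half_haar R) setT (fun r => k (p, r)))).
  move=> p /set_mem p0.
  rewrite [RHS](@inner_eq _ _ _ (rep_fun (- p.1) p.2 u) (L2_fun v)).
  - rewrite [RHS]cintegral_zext; apply: eq_cintegral => r _; rewrite /k /=.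
    have [r0|r0] := pselect (D r); last by rewrite !(zext_out _ r0) conjc0 mulr0.
    rewrite !(zextE _ r0) /rep_fun zextE//.
    by move: r0; rewrite !half_lineP => r0; rewrite mulr_gt0.
  - exact: sq_integrable_rep.
  - exact: L2_funP.
  - exact: aff_repE.
  - exact: aeW.
have mall := cmeasurable_cintegral1 (half_haar R) mk.
exact: cmeasurableS mall.
Qed.

Variable e : nat -> L2 R.
Hypothesis onb_e : is_onb e.

(** Parseval's identity writes the form as a limit of sums of products of
    coefficients of [W]. *)
Lemma cmeasurable_form S u v : bounded S ->
  cmeasurable A (fun p => ip (S (W p u)) (W p v)).
Proof.
move=> bS; have [S' _ SS'] := adjoint_exists bS.
apply: (@cmeasurable_cvg _ _ _ _ (fun n p =>
  \sum_(k < n) ip (S (W p u)) (e k) * ip (e k) (W p v))) => [n|p _].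
  apply: cmeasurable_sum => k; apply: cmeasurableM.
    apply: (@eq_cmeasurable _ _ _ _ (fun p => ip (W p u) (S' (e k)))).
      by move=> p _; rewrite SS'.
    exact: cmeasurable_coef.
  apply: (@eq_cmeasurable _ _ _ _ (fun p => (ip (W p v) (e k))^*%C)).
    by move=> p _; rewrite -ipC.
  by apply: cmeasurableJ; exact: cmeasurable_coef.
exact: parseval.
Qed.

Lemma shift_form p S u v : A p ->
  ip (aff_shift p S u) v = ip (S (W p u)) (W p v).
Proof.
move=> p0; rewrite aff_shiftE//= W_adjoint; last exact: aff_inv_gt0.
congr (ip _ (W _ v)); case: p p0 => x a a0; rewrite /aff_inv /=.
have an0 : (a : R) != 0 by rewrite gt_eqF.
by rewrite invrK; congr pair; field.
Qed.

Lemma tclass_shift p S : A p -> tclass S -> tclass (aff_shift p S) /\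
  (forall M, trace_bound S M -> trace_bound (aff_shift p S) M).
Proof.
move=> p0 tS; have p0' := aff_inv_gt0 p0; rewrite aff_shiftE//.
apply: tclass_conj => //; try exact: bounded_W.
- by move=> x y; rewrite W_adjoint.
- by move=> x; rewrite hnorm_W.
- by move=> x; rewrite hnorm_W.
Qed.

Lemma bounded_shift p T : A p -> bounded T -> bounded (aff_shift p T).
Proof.
move=> p0 bT; rewrite aff_shiftE//.
apply: bounded_comp (bounded_W p0).
by apply: bounded_comp => //; apply: bounded_W; exact: aff_inv_gt0.
Qed.

Lemma tclass_comp S T : tclass S -> bounded T ->
  tclass (S \o T).
Proof.
move=> [bS [M SM]] bT; split; first exact: bounded_comp.
have [T' bT' TT'] := adjoint_exists bT.
have [c c0 cT'] := bounded_pos bT'.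
by exists (c * M); exact: (trace_bound_compr (proj1 bS) c0 TT' cT' SM).
Qed.

Lemma cmeasurable_tr_shift S T : tclass S -> bounded T ->
  cmeasurable A (fun q => tr e (aff_shift q S \o T)).
Proof.
move=> tS bT.
apply: (@cmeasurable_cvg _ _ _ _ (fun n q =>
  \sum_(k < n) ip (S (W q (T (e k)))) (W q (e k)))) => [n|q q0].
  by apply: cmeasurable_sum => k; apply: cmeasurable_form; case: tS.
have [_ [M qM]] := tclass_comp (proj1 (tclass_shift q0 tS)) bT.
apply: eq_ccvg (tr_cvg onb_e qM) => n.
by apply: eq_bigr => k _; rewrite /= shift_form.
Qed.

Lemma tclass_finite_rank S (r : R) : tclass S -> 0 < r -> finite_rank_approx S r.
Proof.
move=> [bS [M SM]] r0; have [B bB SB] := adjoint_exists bS.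
have [C [pC CC]] := abs_exists bS bB SB.
apply: (finite_rank_dense onb_e bS pC _ SM r0) => x y.
by rewrite SB -CC -(positive_symmetric pC).
Qed.

Lemma shift_rank1 p a b : A p ->
  aff_shift p (rank1 a b) = rank1 (W (aff_inv p) a) (W (aff_inv p) b).
Proof.
move=> p0; rewrite aff_shiftE//; apply/funext => x /=.
by rewrite /rank1 W_adjoint// (linear_mapZ (linear_W (aff_inv_gt0 p0))).
Qed.

Lemma shiftB p S T : A p ->
  aff_shift p (S - T) = aff_shift p S - aff_shift p T.
Proof.
move=> p0; rewrite !aff_shiftE//; apply/funext => x /=.
by rewrite !fctE (linear_mapB (linear_W (aff_inv_gt0 p0))).
Qed.

Lemma shift_sum p n (F : 'I_n -> L2 R -> L2 R) : A p ->
  aff_shift p (\sum_(k < n) F k) = \sum_(k < n) aff_shift p (F k).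
Proof.
move=> p0; apply: (big_morph (aff_shift p)) => [S T|].
  rewrite !aff_shiftE//; apply/funext => x /=.
  by rewrite !fctE (linear_mapD (linear_W (aff_inv_gt0 p0))).
rewrite aff_shiftE//; apply/funext => x /=.
by rewrite (linear_map0 (linear_W (aff_inv_gt0 p0))).
Qed.

Lemma weakly_measurable_W a : weakly_measurable A e (fun p => W (aff_inv p) a).
Proof.
move=> k; apply: (@eq_cmeasurable _ _ _ _ (fun p => (ip (W p (e k)) a)^*%C)).
  by move=> p /set_mem p0; rewrite W_adjoint// -ipC.
by apply: cmeasurableJ; exact: cmeasurable_coef.
Qed.

(** Approximate [S] by an operator of finite rank; the error is unchanged by the
    shift because [W p] is unitary. The shift of a rank-one operator is given by
    two vectors that move along orbits of [W]. *)
Lemma approximable_shift (f : plane R -> R[i]) S : cintegrable nu A f ->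
  tclass S -> approximable nu A (fun p => f p *: aff_shift p S).
Proof.
move=> If tS; apply: approximable_close; first exact: measurable_aff.
move=> r r0.
pose I := (\int[nu]_(p in A) (nc (f p))%:E)%E.
have I0 : (0 <= I)%E by apply: integral_ge0 => p _; rewrite lee_fin nc_ge0.
have IfinE : I = (fine I)%:E by rewrite fineK// ge0_fin_numE//; case: If.
have c0 : 0 < fine I + 1 by rewrite ltr_wpDl// -lee_fin -IfinE.
have d0 : 0 < r / (fine I + 1) by rewrite divr_gt0.
have [n [a [b Sab]]] := tclass_finite_rank tS d0.
have mnf : measurable_fun A (fun p => nc (f p)) by apply: measurable_nc; case: If.
exists (fun p => \sum_(k < n) f p *: rank1 (W (aff_inv p) (a k)) (W (aff_inv p) (b k))),
  (fun p => nc (f p) * (r / (fine I + 1))); split.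
- pose F (k : 'I_n) p := f p *: rank1 (W (aff_inv p) (a k)) (W (aff_inv p) (b k)).
  suff aF k : approximable nu A (F k).
    have mA := @measurable_aff R.
    have := approximable_sum mA (index_enum _) aF.
    exact.
  apply: (approximable_rank1 _ onb_e (alpha := hnorm (a k)) (beta := hnorm (b k))) => //.
  + exact: measurable_aff.
  + by move=> p p0; rewrite hnorm_W//; exact: aff_inv_gt0.
  + exact: weakly_measurable_W.
  + by move=> p p0; rewrite hnorm_W//; exact: aff_inv_gt0.
  + exact: weakly_measurable_W.
- by apply: measurable_funM => //; exact: measurable_cst.
- move=> p p0; rewrite -scaler_sumr -scalerBr.
  have -> : \sum_(k < n) rank1 (W (aff_inv p) (a k)) (W (aff_inv p) (b k)) =
      aff_shift p (\sum_(k < n) rank1 (a k) (b k)).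
    by rewrite shift_sum//; apply: eq_bigr => k _; rewrite shift_rank1.
  rewrite -shiftB//; apply: trace_boundZ.
  apply: (proj2 (tclass_shift p0 _)) Sab.
  apply: tclassB => //; apply: tclass_sum => k; exact: tclass_rank1.
under eq_integral do rewrite EFinM.
rewrite ge0_integralZr//; last 4 first.
- exact: measurable_aff.
- exact/measurable_EFinP.
- by move=> p _; rewrite lee_fin nc_ge0.
- by rewrite lee_fin ltW.
rewrite -/I IfinE -EFinM lee_fin mulrCA ger_pMr// ler_pdivrMr// mul1r; lra.
Qed.

End matrix_coefficients.

(** * The trace norm and the Bochner integral *)

Section trace_norm.
Variable R : realType.
Implicit Types (A B S T : L2 R -> L2 R).

Lemma trace_norm_bounded A : (trace_norm A < +oo)%E -> bounded A.
Proof. by rewrite /trace_norm; case: asboolP => //; rewrite ltxx. Qed.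

(** The absolute value exists, so the choice in [op_abs] is not the default. *)
Lemma op_absP A : bounded A -> positive (op_abs A) /\
  forall x y, ip (A x) (A y) = ip (op_abs A x) (op_abs A y).
Proof.
move=> bA; have [B bB AB] := adjoint_exists bA.
have [C [pC CC]] := abs_exists bA bB AB.
have : exists C : L2 R -> L2 R,
    [set C | positive_op C /\ C \o C = adjoint A \o A] C.
  exists C; split; first exact: pC.
  by rewrite (adjoint_eq AB); apply/funext => x; exact: CC.
move/(xgetPex 0) => -[pabs absE]; split; first exact: pabs.
move=> x y; rewrite AB -(adjoint_eq AB).
have -> : adjoint A (A y) = op_abs A (op_abs A y).
  by have /(congr1 (fun h => h y)) := absE.
by rewrite (positive_symmetric (pabs : positive (op_abs A))).
Qed.

Lemma trace_norm_term_ge0 A u : bounded A ->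
  (0 <= (Re (inner (op_abs A u) u))%:E)%E.
Proof.
move=> bA; have [[_ pos] _] := op_absP bA.
by have := pos u; rewrite lecE => /andP[_]; rewrite lee_fin.
Qed.

Lemma trace_norm_ge0 A : (0 <= trace_norm A)%E.
Proof.
rewrite /trace_norm; case: asboolP => [bA|_]; last exact: leey.
by apply: nneseries_ge0 => n _ _; exact: trace_norm_term_ge0.
Qed.

Hypothesis onb_e : is_onb (onb R).

(** The trace norm is a series of nonnegative terms, so it is bounded by [M] if
    and only if its partial sums are, and [trace_bound_abs] applies. *)
Lemma trace_normP A (M : R) : bounded A ->
  (trace_norm A <= M%:E)%E <-> trace_bound A M.
Proof.
move=> bA; have [pC CC] := op_absP bA.
rewrite (trace_bound_abs onb_e _ bA pC CC) /trace_norm asboolT//.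
pose a n := (Re (inner (op_abs A (onb R n)) (onb R n)))%:E.
have a0 n : (0 <= a n)%E by exact: trace_norm_term_ge0.
have aE n : (\sum_(0 <= k < n) a k)%E =
    (\sum_(k < n) Re (ip (op_abs A (onb R k)) (onb R k)))%:E.
  by rewrite big_mkord -sumEFin.
split=> [AM n|AM].
  rewrite -lee_fin -aE; apply: le_trans AM.
  exact: (nneseries_lim_ge n (fun k _ _ => a0 k)).
apply: lime_le; first by apply: is_cvg_nneseries => k _ _; exact: a0.
by apply: nearW => n; rewrite -/a aE lee_fin.
Qed.

Lemma trace_classP A : trace_class A <-> tclass A.
Proof.
split=> [AT|[bA [M AM]]].
  have bA := trace_norm_bounded AT; split=> //.
  exists (fine (trace_norm A)); apply/trace_normP => //.
  by rewrite fineK// ge0_fin_numE// trace_norm_ge0.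
by apply: (@le_lt_trans _ _ M%:E); [exact/trace_normP|exact: ltry].
Qed.

End trace_norm.

Section bochner_integrals.
Context d (T : measurableType d) (R : realType).
Variables (mu : {measure set T -> \bar R}) (D : set T) (mD : measurable D).
Hypothesis onb_e : is_onb (onb R).

Lemma simple_op_funP s : simple_op_fun mu D s <-> is_simple mu D s.
Proof.
by split=> ss p /ss [? ? ? tp]; split=> //; move: tp => /(trace_classP onb_e).
Qed.

Lemma cvge_dominated (a : nat -> \bar R) (b : nat -> R) :
  (forall k, (0 <= a k)%E) -> (forall k, (a k <= (b k)%:E)%E) ->
  b k @[k --> \oo] --> 0 -> a k @[k --> \oo] --> 0%E.
Proof.
move=> a0 ab b0; apply: (@squeeze_cvge _ _ _ _ (cst 0%E) a (EFin \o b)).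
- by apply: nearW => k; rewrite a0 ab.
- exact: cvg_cst.
- by apply/cvg_EFin => //; exact: nearW.
Qed.

Lemma cvg_half : (1 / (2 ^ k)%:R : R) @[k --> \oo] --> (0 : R).
Proof.
under eq_fun do rewrite natrX div1r -exprVn.
by apply: cvg_expr; rewrite ger0_norm// invf_lt1// ltr1n.
Qed.

(** The majorants [h] of [approximable_integral] dominate the trace norms. *)
Lemma bochner_exists (F : T -> L2 R -> L2 R) : approximable mu D F ->
  (forall x, D x -> tclass (F x)) -> exists A, is_bochner_integral mu D F A.
Proof.
move=> aF tF; have [A [s [h [[tA ss mh Fs] [Ih h0 As]]]]] := approximable_integral mD aF.
have tFs k x : D x -> bounded (F x - sval (s k) x).
  by move=> Dx; apply: (proj1 (tclassB (tF x Dx) (tclass_sval x (ss k)))).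
have Nh k x : D x -> (trace_norm (F x - sval (s k) x)%R <= (h k x)%:E)%E.
  move=> Dx; apply: (proj2 (trace_normP onb_e _ (tFs k x Dx))).
  exact: (Fs k x Dx).
exists A; split; first exact/trace_classP.
exists s; split.
- by move=> k; exact/simple_op_funP.
- apply: filterS h0 => x hx Dx.
  apply: (cvge_dominated _ _ (hx Dx)) => k; first exact: trace_norm_ge0.
  exact: Nh.
- have hk := cvg_half; rewrite -cvg_shiftS/= in hk.
  apply: (cvge_dominated _ _ hk) => k.
    by apply: integral_ge0 => x _; exact: trace_norm_ge0.
  apply: le_trans (Ih k); apply: ge0_le_integral_nomeas => x Dx.
    exact: trace_norm_ge0.
  exact: Nh.
- apply: (cvge_dominated _ _ cvg_half) => k; first exact: trace_norm_ge0.
  have tk := tclassB tA (tclass_sint (ss k)).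
  exact: (proj2 (trace_normP onb_e _ (proj1 tk)) (As k)).
Qed.

(** [functional_bochner] divides by the constant, which is therefore made
    positive. *)
Lemma bochner_functional (F : T -> L2 R -> L2 R) A (phi : (L2 R -> L2 R) -> R[i])
    (c : R) : 0 <= c -> trace_continuous phi c ->
  is_bochner_integral mu D F A ->
  (forall x, D x -> tclass (F x)) -> cmeasurable D (fun x => phi (F x)) ->
  phi A = cintegral mu D (fun x => phi (F x)).
Proof.
move=> c0 phic [tA [s [ss _ Fs As]]] tF mF.
have phic' : trace_continuous phi (c + 1).
  have [lin bd] := phic; split=> // B M bB BM.
  apply: le_trans (bd _ _ bB BM) _.
  by rewrite ler_wpM2r ?(trace_bound_ge0 BM)// lerDl.
apply: (functional_bochner mD (N := @trace_norm R) (s := s) _ phic') => //.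
- by rewrite ltr_wpDl.
- exact: trace_norm_ge0.
- by move=> X M bX /trace_normP; apply.
- exact/trace_classP.
- by move=> k; exact/simple_op_funP.
Qed.

End bochner_integrals.

(** * The two associativity laws *)

Section sigma_finite_haar.
Variable R : realType.
Local Notation leb := (@lebesgue_measure R).
Local Notation mu := (half_haar R).

(** A name for the Haar measure under which it is registered as sigma-finite. *)
Definition affine_haar : set (plane R) -> \bar R := aff_haar R.
HB.instance Definition _ := Measure.on affine_haar.

Let affine_haar_sigma_finite : sigma_finite setT affine_haar.
Proof.
have /sigma_finiteP[F [FT ndF Foo]] := sigma_finiteT leb.
have /sigma_finiteP[G [GT ndG Goo]] := sigma_finiteT mu.
exists (fun n => F n `*` G n) => [|n].
  apply/esym/seteqP; split=> // -[x y] _.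
  have [[n _ Fnx] [m _ Gmy]] : (\bigcup_n F n) x /\ (\bigcup_n G n) y.
    by rewrite -FT -GT.
  exists (maxn n m) => //; split => /=.
    exact: (subsetPset _ _ (ndF _ _ (leq_maxl n m))).
  exact: (subsetPset _ _ (ndG _ _ (leq_maxr n m))).
have [mF Fn] := Foo n; have [mG Gn] := Goo n; split; first exact: measurableX.
by rewrite /affine_haar product_measure1E// lte_mul_pinfty// ge0_fin_numE.
Qed.

HB.instance Definition _ := Measure_isSigmaFinite.Build _ _ _ affine_haar
  affine_haar_sigma_finite.

End sigma_finite_haar.

Section affine_convolution.
Variable R : realType.
Local Notation A := (aff R).
Variables f g : plane R -> R[i].
Hypotheses (If : aff_L1 f) (Ig : aff_L1 g).

Let nu : {sigma_finite_measure set (plane R) -> \bar R} := @affine_haar R.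

Let mmul : measurable_fun setT (fun z : plane R * plane R => aff_mul z.1 z.2).
Proof. exact: measurable_aff_mul. Qed.

Let minv : measurable_fun setT (@aff_inv R).
Proof. exact: measurable_aff_inv. Qed.

Let mulA (p q : plane R) : A q -> A (aff_mul p q) <-> A p.
Proof. by move=> q0; rewrite aff_mul_affE. Qed.

Let nu_mul (q : plane R) (h : plane R -> \bar R) : A q ->
  measurable_fun setT h -> (forall p, (0 <= h p)%E) ->
  (\int[nu]_p h (aff_mul p q) = \int[nu]_p h p)%E.
Proof. exact: ge0_integral_aff_mul. Qed.

Lemma aff_conv_integrable : aff_L1 (fun_conv f g).
Proof.
exact: (@conv_integrable _ _ R nu A (@aff_mul R) (@aff_inv R)
  (@measurable_aff R) mmul minv mulA (@aff_inv_gt0 R) nu_mul f g If Ig).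
Qed.

Lemma aff_conv_pairing (s : plane R -> R[i]) (M : R) : 0 <= M ->
  cmeasurable A s -> (forall p, A p -> nc (s p) <= M) ->
  cintegral (aff_haar R) A (fun p => fun_conv f g p * s p) =
  cintegral (aff_haar R) A (fun q =>
    f q * cintegral (aff_haar R) A (fun p => g p * s (aff_mul p q))).
Proof.
exact: (@conv_pairing _ _ R nu A (@aff_mul R) (@aff_inv R)
  (@measurable_aff R) mmul minv (@aff_mulK R) mulA (@aff_inv_gt0 R) nu_mul
  f g If Ig).
Qed.

End affine_convolution.

Section convolutions.
Variable R : realType.
Local Notation A := (aff R).
Local Notation nu := (aff_haar R).
Hypothesis onb_e : is_onb (onb R).
Implicit Types (f g : plane R -> R[i]) (S T : L2 R -> L2 R) (p q : plane R).

Lemma fun_op_convP f S : aff_L1 f -> tclass S ->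
  is_bochner_integral nu A (fun p => f p *: aff_shift p S) (fun_op_conv f S).
Proof.
move=> If tS; have aF := approximable_shift onb_e If tS.
have tF p : A p -> tclass (f p *: aff_shift p S).
  by move=> p0; apply: tclassZ; exact: (proj1 (tclass_shift p0 tS)).
have mA := @measurable_aff R.
exact: (xgetPex 0 (bochner_exists mA onb_e aF tF)).
Qed.

Lemma tclass_fun_op_conv f S : aff_L1 f -> tclass S -> tclass (fun_op_conv f S).
Proof. by move=> If tS; have [/(trace_classP onb_e)] := fun_op_convP If tS. Qed.

Lemma fun_op_conv_functional f S phi (c : R) : aff_L1 f -> tclass S ->
  0 <= c -> trace_continuous phi c ->
  cmeasurable A (fun p => phi (aff_shift p S)) ->
  phi (fun_op_conv f S) = cintegral nu A (fun p => f p * phi (aff_shift p S)).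
Proof.
move=> If tS c0 phic mphi; have mA := @measurable_aff R.
have tshift p : A p -> tclass (aff_shift p S).
  by move=> p0; exact: (proj1 (tclass_shift p0 tS)).
have tF p : A p -> tclass (f p *: aff_shift p S).
  by move=> p0; apply: tclassZ; exact: tshift.
have phiF : {in A, (fun p => f p * phi (aff_shift p S)) =1
    (fun p => phi (f p *: aff_shift p S))}.
  by move=> p /set_mem p0; rewrite (trace_continuousZ phic)//; exact: tshift.
have mF : cmeasurable A (fun p => f p * phi (aff_shift p S)).
  by apply: cmeasurableM => //; case: If.
rewrite (eq_cintegral _ phiF).
apply: (bochner_functional mA onb_e c0 phic (fun_op_convP If tS) tF).
exact: eq_cmeasurable phiF mF.
Qed.

Lemma aff_inv_mulV p q : A p -> A q ->
  aff_inv (aff_mul p (aff_inv q)) = aff_mul q (aff_inv p).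
Proof.
move=> p0 q0; have pn0 : (p.2 : R) != 0 by rewrite gt_eqF.
have qn0 : (q.2 : R) != 0 by rewrite gt_eqF.
case: p q pn0 qn0 {p0 q0} => x a [y b] /= pn0 qn0.
rewrite /aff_mul /aff_inv /=; congr pair; by field; rewrite pn0 qn0.
Qed.

(** [q p^-1] and [p q^-1] are inverse to each other. *)
Lemma conj_shift p q T : A p -> A q ->
  W q \o aff_shift p T \o W (aff_inv q) = aff_shift (aff_mul p (aff_inv q)) T.
Proof.
move=> p0 q0; have q0' := aff_inv_gt0 q0; have p0' := aff_inv_gt0 p0.
rewrite !aff_shiftE//; last exact: aff_mul_gt0.
apply/funext => x /=; rewrite aff_inv_mulV//.
by rewrite (W_mul _ p0 q0') (W_mul _ q0 p0').
Qed.

Lemma fun_op_conv_op_conv f S T p : aff_L1 f -> tclass S -> bounded T -> A p ->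
  op_conv (fun_op_conv f S) T p = fun_conv f (op_conv S T) p.
Proof.
move=> If tS bT p0; have bC := bounded_shift p0 bT.
have [C' bC' CC'] := adjoint_exists bC.
have [c c0 cC'] := bounded_pos bC'.
have phic := tr_comp_trace_continuous onb_e c0 CC' cC'.
rewrite /op_conv -[LHS]/(tr (onb R) (fun_op_conv f S \o aff_shift p T)).
rewrite (fun_op_conv_functional If tS (ltW c0) phic); last exact: cmeasurable_tr_shift.
apply: eq_cintegral => q /set_mem q0; congr (_ * _).
have q0' := aff_inv_gt0 q0.
rewrite (aff_shiftE S q0) (tr_conj onb_e (U := W q)) ?conj_shift//.
- by move=> x y; exact: W_adjoint.
- exact: bounded_W.
- exact: bounded_W.
- by move=> x; rewrite hnorm_W.
- by move=> x; rewrite hnorm_W.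
- by move=> r r0; exact: (tclass_finite_rank onb_e).
Qed.

Lemma fun_op_conv_form f S u v : aff_L1 f -> tclass S ->
  ip (fun_op_conv f S u) v =
  cintegral nu A (fun p => f p * ip (S (W p u)) (W p v)).
Proof.
move=> If tS.
have c0 : 0 <= hnorm u * hnorm v by rewrite mulr_ge0 ?hnorm_ge0.
have formE : {in A, (fun p => ip (S (W p u)) (W p v)) =1
    (fun p => ip (aff_shift p S u) v)}.
  by move=> p /set_mem p0; rewrite shift_form.
rewrite (fun_op_conv_functional If tS c0 (ip_trace_continuous u v)).
  by apply: eq_cintegral => p pA; rewrite formE.
apply: eq_cmeasurable formE _; apply: cmeasurable_form onb_e _ _ _ _.
by case: tS.
Qed.

Lemma fun_op_convA f g S : aff_L1 f -> aff_L1 g -> tclass S ->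
  fun_op_conv f (fun_op_conv g S) = fun_op_conv (fun_conv f g) S.
Proof.
move=> If Ig tS; apply/funext => u; apply: ip_inj => v.
have [bS [M SM]] := tS; have Ifg := aff_conv_integrable If Ig.
pose s p := ip (S (W p u)) (W p v).
have ms : cmeasurable A s by exact: (cmeasurable_form onb_e).
have sM p : A p -> nc (s p) <= M * hnorm u * hnorm v.
  move=> p0; apply: le_trans (trace_bound_form _ _ (proj1 bS) SM) _.
  by rewrite !hnorm_W.
have M0 : 0 <= M * hnorm u * hnorm v.
  by rewrite !mulr_ge0 ?hnorm_ge0// (trace_bound_ge0 SM).
transitivity (cintegral nu A (fun q =>
    f q * ip (fun_op_conv g S (W q u)) (W q v))).
  exact: (fun_op_conv_form u v If (tclass_fun_op_conv Ig tS)).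
transitivity (cintegral nu A (fun p => fun_conv f g p * s p)); last first.
  exact/esym/(fun_op_conv_form u v Ifg tS).
rewrite (aff_conv_pairing If Ig M0 ms sM).
apply: eq_cintegral => q /set_mem q0; congr (_ * _).
rewrite [LHS](fun_op_conv_form (W q u) (W q v) Ig tS).
by apply: eq_cintegral => p /set_mem p0; rewrite /s !W_mul.
Qed.

End convolutions.

Section without_basis.
Variable R : realType.
Local Notation A := (aff R).
Local Notation nu := (aff_haar R).
Hypothesis no_onb : ~ exists e : nat -> L2 R, orthonormal_basis e.

Let onb0 n : onb R n = 0.
Proof. by rewrite /onb xgetPN// => e he; apply: no_onb; exists e. Qed.

Lemma trace_without_basis (X : L2 R -> L2 R) : trace X = 0.
Proof.
have X0 (n : nat) : inner (X (onb R n)) (onb R n) = 0 by rewrite onb0; exact: ip0r.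
have s0 : limn (series (fun=> 0 : R)) = 0.
  rewrite (_ : series _ = fun=> 0) ?lim_cst//.
  by apply/funext => n; rewrite /series /= big1.
rewrite /trace.
under [X in limn (series X)]eq_fun do rewrite X0.
under [X in (_ +i* limn (series X))%C]eq_fun do rewrite X0.
by rewrite s0.
Qed.

Lemma trace_norm_without_basis (X : L2 R -> L2 R) : bounded X ->
  trace_norm X = 0%E.
Proof.
move=> bX; rewrite /trace_norm asboolT// eseries0// => n _ _.
by rewrite onb0 [inner _ _]ip0r.
Qed.

(** All bounded operators are at distance 0 from each other, so the empty list
    of simple functions approximates every family. *)
Lemma bochner_without_basis (f : plane R -> R[i]) (S X : L2 R -> L2 R) :
  bounded S ->
  is_bochner_integral nu A (fun p => f p *: aff_shift p S) X <-> bounded X.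
Proof.
move=> bS; split=> [[+ _]|bX]; first exact: trace_norm_bounded.
split; first by rewrite /trace_class trace_norm_without_basis.
have F0 p : A p ->
    trace_norm (f p *: aff_shift p S - simple_op_val [::] p) = 0%E.
  move=> p0; apply: trace_norm_without_basis; rewrite /simple_op_val big_nil subr0.
  by apply: boundedZ; exact: bounded_shift.
exists (fun=> [::]); split.
- by [].
- by apply: aeW => p p0; rewrite F0//; exact: cvg_cst.
- rewrite (_ : (\int[nu]_(x in A) _)%E = 0%E); first exact: cvg_cst.
  by apply: integral0_eq => p p0; exact: F0.
- rewrite trace_norm_without_basis; first exact: cvg_cst.
  by rewrite /simple_op_integral big_nil subr0.
Qed.

Lemma fun_op_conv_without_basis (f : plane R -> R[i]) (S : L2 R -> L2 R) :
  bounded S -> fun_op_conv f S = xget 0 (@bounded R (L2 R)).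
Proof.
move=> bS; rewrite /fun_op_conv /bochner_integral; congr xget.
by apply/funext => X; apply/propext; exact: bochner_without_basis.
Qed.

End without_basis.

Theorem proposition3p4 (R : realType) (f g : plane R -> R[i])
    (S T : L2 R -> L2 R) (hf : aff_L1 f) (hg : aff_L1 g)
    (hS : trace_class S) (hT : bounded_op T) :
  (forall p, aff R p ->
     op_conv (fun_op_conv f S) T p = fun_conv f (op_conv S T) p) /\
  fun_op_conv f (fun_op_conv g S) = fun_op_conv (fun_conv f g) S.
Proof.
have [onb_ex|no_onb] := pselect (exists e : nat -> L2 R, orthonormal_basis e).
  have onb_e : is_onb (onb R) by exact: (xgetPex (fun=> 0) onb_ex).
  have tS : tclass S by exact/(trace_classP onb_e).
  by split=> [p p0|]; [exact: fun_op_conv_op_conv|exact: fun_op_convA].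
split=> [p _|].
  rewrite /op_conv trace_without_basis// /fun_conv.
  under eq_fun do rewrite trace_without_basis// mulr0.
  by rewrite cintegral0.
have bS := trace_norm_bounded hS.
have b0 : bounded (xget 0 (@bounded R (L2 R))).
  by apply: (xgetPex 0); exists 0; exact: bounded0.
by rewrite !fun_op_conv_without_basis//.
Qed.
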